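(* Let $G$ be a finite group, $\mathcal{O}$ an indexing category for $G$, and $H$ a subgroup of $G$. If $\underline{A}^{\mathcal{O}}[x_{G/H}]$ is flat as an $\underline{A}$-module (that is, its underlying Mackey functor is flat), then: (a) $i_H^*\mathcal{O}\cong\mathcal{O}^{\mathrm{triv}}$ (the trivial indexing category for $H$); (b) $H$ is a normal subgroup of $G$. Moreover, if in addition $G/H$ is solvable, then $G/H$ is admissible for $\mathcal{O}$.
   Context: $\mathrm{Set}^G$ is the category of finite $G$-sets. An indexing category for $G$ is a subcategory $\mathcal{O}\subseteq\mathrm{Set}^G$ which is wide (contains all objects), pullback stable (if $f\colon A\to C$ is the pullback in $\mathrm{Set}^G$ of a morphism $g\colon B\to D$ of $\mathcal{O}$ along any map $C\to D$, then $f\in\mathcal{O}$) and finite coproduct complete (it has all finite coproducts, created in $\mathrm{Set}^G$). The trivial indexing category $\mathcal{O}^{\mathrm{triv}}$ consists of all maps $g\colon X\to Y$ such that the stabilizer of $x$ equals the stabilizer of $g(x)$ for every $x\in X$. For $H\le G$, $i_H^*\mathcal{O}$ is the indexing category for $H$ consisting of the maps $f$ of finite $H$-sets with $G\times_H f\in\mathcal{O}$. $G/H$ is admissible for $\mathcal{O}$ if $\mathcal{O}$ contains a morphism $G/H\to G/G$. Polynomials: $\mathcal{P}^G_{\mathcal{O}}$ has finite $G$-sets as objects; a morphism $X\to Y$ is an isomorphism class of diagrams $[X\xleftarrow{f}A\xrightarrow{g}B\xrightarrow{h}Y]$ of finite $G$-sets with $g\in\mathcal{O}$ (isomorphisms are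 compatible isomorphisms $A\cong A'$, $B\cong B'$ over $X$ and $Y$). Such a morphism is $T_h\circ N_g\circ R_f$, where $R_f=[X\xleftarrow{f}A=A=A]$, $N_g=[A=A\xrightarrow{g}B=B]$, $T_h=[B=B=B\xrightarrow{h}Y]$. Composition is determined by: $R$ is contravariantly functorial, $N$ and $T$ are covariantly functorial; for a pullback square with $f\colon X\to Y$, $g\colon Y'\to Y$ and base changes $f'\colon X'\to Y'$, $g'\colon X'\to X$, one has $R_gN_f=N_{f'}R_{g'}$ and $R_gT_f=T_{f'}R_{g'}$; and for $g\colon A\to S$, $h\colon S\to T$, $N_hT_g=T_{h'}N_{g'}R_{f'}$, where $\Pi_h$ is the right adjoint of pullback $h^*\colon\mathrm{Set}^G_{/T}\to\mathrm{Set}^G_{/S}$, $h'\colon\Pi_hA\to T$ is the structure map, $g'\colon S\times_T\Pi_hA\to\Pi_hA$ the projection and $f'\colon S\times_T\Pi_hA\to A$ the counit. Disjoint union is the categorical product in $\mathcal{P}^G_{\mathcal{O}}$. Each $\mathcal{P}^G_{\mathcal{O}}(X,Y)$ is a commutative monoid under disjoint union of $A$'s and $B$'s; $(-)^+$ denotes group completion. An $\mathcal{O}$-Tambara functor is a product-preserving functor $\underline{R}\colon\mathcal{P}^G_{\mathcal{O}}\to\mathrm{Set}$ such that every $\underline{R}(X)$ is an abelian group. For a finite $G$-set $T$, the free $\mathcal{O}$-Tambara functor on a generator at level $T$ is $\underline{A}^{\mathcal{O}}[x_T]:=\mathcal{P}^G_{\mathcal{O}}(T,-)^+$. Mackey functors: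 the Burnside category $\mathcal{A}^G$ has finite $G$-sets as objects and $\mathcal{A}^G(X,Y)$ is the group completion (under disjoint union) of the monoid of isomorphism classes of spans $X\leftarrow S\to Y$, composed by pullback. A Mackey functor is an additive functor $\mathcal{A}^G\to\mathrm{Ab}$. The underlying Mackey functor of an $\mathcal{O}$-Tambara functor is obtained by keeping only the restrictions (images of $R_f$) and transfers (images of $T_h$). The box product $\boxtimes$ of Mackey functors is the Day convolution product built from the Cartesian product of finite $G$-sets and $\otimes_{\mathbb{Z}}$; its unit is the Burnside Mackey functor $\underline{A}=\mathcal{A}^G(G/G,-)$, so $\underline{A}$-modules are the same as Mackey functors. A Mackey functor $\underline{M}$ is flat if $-\boxtimes\underline{M}$ is an exact functor on Mackey functors. *)

(* Defs.v *)
From HB Require Import structures.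
From mathcomp Require Import all_boot all_order all_algebra all_fingroup.
From mathcomp Require Import boolp.

Set Implicit Arguments.
Unset Strict Implicit.
Unset Printing Implicit Defensive.

Import GRing.Theory.

Local Open Scope ring_scope.
Local Open Scope quotient_scope.

Record setoid := Setoid {
  setoid_sort :> Type;
  setoid_rel : setoid_sort -> setoid_sort -> Prop;
  setoid_refl : forall x, setoid_rel x x;
  setoid_sym : forall x y, setoid_rel x y -> setoid_rel y x;
  setoid_trans : forall x y z,
    setoid_rel x y -> setoid_rel y z -> setoid_rel x z }.

Section Quotient.
Variable E : setoid.

Definition setoid_relb : rel {classic E} := fun x y => `[< setoid_rel x y >].

Lemma setoid_relb_refl : reflexive setoid_relb.
Proof. by move=> x; apply/asboolP; exact: setoid_refl. Qed.

Lemma setoid_relb_sym : symmetric setoid_relb.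
Proof. by move=> x y; apply/asboolP/asboolP; exact: setoid_sym. Qed.

Lemma setoid_relb_trans : transitive setoid_relb.
Proof.
move=> y x z /asboolP xy /asboolP yz; apply/asboolP; exact: setoid_trans yz.
Qed.

Definition setoid_equiv :=
  EquivRel setoid_relb setoid_relb_refl setoid_relb_sym setoid_relb_trans.

Definition quot : choiceType := {eq_quot setoid_equiv}.

Definition cls (x : E) : quot := \pi_({eq_quot setoid_equiv}) x.
Definition rep (c : quot) : E := generic_quotient.repr (c : {eq_quot setoid_equiv}).

Lemma repK (c : quot) : cls (rep c) = c.
Proof. exact: reprK. Qed.

Lemma clsP (x y : E) : cls x = cls y <-> setoid_rel x y.
Proof. by split=> [/eqmodP/asboolP|h] //; apply/eqmodP/asboolP. Qed.

Lemma rep_cls (x : E) : setoid_rel (rep (cls x)) x.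
Proof. by apply/clsP; rewrite repK. Qed.

End Quotient.

Section GroupCompletion.
Variable M : nmodType.

(* (x, y) stands for x - y *)
Definition gc_rel (p q : M * M) : Prop :=
  exists k, p.1 + q.2 + k = q.1 + p.2 + k.

Lemma gc_rel_trans p q r : gc_rel p q -> gc_rel q r -> gc_rel p r.
Proof.
move=> [k hk] [l hl]; exists (q.1 + q.2 + k + l).
have -> : p.1 + r.2 + (q.1 + q.2 + k + l)
    = (p.1 + q.2 + k) + (q.1 + r.2 + l).
  by rewrite [RHS](AC (3*3) ((1*5)*(((4*2)*3)*6))).
rewrite hk hl.
by rewrite (AC (3*3) ((4*2)*(((1*5)*3)*6))).
Qed.

Definition gc_setoid : setoid :=
  @Setoid (M * M) gc_rel (fun p => ex_intro _ 0 erefl)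
    (fun p q h => let: ex_intro k e := h in ex_intro _ k (esym e))
    gc_rel_trans.

Definition gcompl : Type := quot gc_setoid.
HB.instance Definition _ := Choice.on gcompl.

Definition gc_cls (x y : M) : gcompl := cls (E := gc_setoid) (x, y).
Definition gc_in (x : M) : gcompl := gc_cls x 0.
Definition gc_pos (c : gcompl) : M := (rep c).1.
Definition gc_neg (c : gcompl) : M := (rep c).2.
Definition gc_add (c d : gcompl) : gcompl :=
  gc_cls (gc_pos c + gc_pos d) (gc_neg c + gc_neg d).
Definition gc_opp (c : gcompl) : gcompl := gc_cls (gc_neg c) (gc_pos c).

Lemma gc_repK c : gc_cls (gc_pos c) (gc_neg c) = c.
Proof. by rewrite /gc_cls /gc_pos /gc_neg -surjective_pairing; apply: repK. Qed.

Lemma gc_clsP x y x' y' :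
  gc_cls x y = gc_cls x' y' <-> exists k, x + y' + k = x' + y + k.
Proof. exact: clsP. Qed.

Lemma gc_rep x y :
  exists k, gc_pos (gc_cls x y) + y + k = x + gc_neg (gc_cls x y) + k.
Proof. by apply/gc_clsP; rewrite gc_repK. Qed.

Lemma gc_addE x y x' y' :
  gc_add (gc_cls x y) (gc_cls x' y') = gc_cls (x + x') (y + y').
Proof.
have [k hk] := gc_rep x y; have [l hl] := gc_rep x' y'.
apply/gc_clsP; exists (k + l).
set p := gc_pos (gc_cls x y) in hk *; set n := gc_neg (gc_cls x y) in hk *.
set p' := gc_pos _ in hl *; set n' := gc_neg _ in hl *.
transitivity ((p + y + k) + (p' + y' + l)).
  by rewrite [RHS](AC (3*3) ((((1*4)*(2*5))*(3*6)))).
by rewrite hk hl (AC (3*3) ((((1*4)*(2*5))*(3*6)))).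
Qed.

Lemma gc_oppE x y : gc_opp (gc_cls x y) = gc_cls y x.
Proof.
have [k hk] := gc_rep x y; apply/gc_clsP; exists k.
by rewrite [_ + x]addrC -hk [y + _]addrC.
Qed.

Lemma gc_addA : associative gc_add.
Proof.
move=> a b c; rewrite -(gc_repK a) -(gc_repK b) -(gc_repK c).
by rewrite !gc_addE !addrA.
Qed.

Lemma gc_addC : commutative gc_add.
Proof.
move=> a b; rewrite -(gc_repK a) -(gc_repK b) !gc_addE.
by congr gc_cls; rewrite addrC.
Qed.

Lemma gc_add0 : left_id (gc_cls 0 0) gc_add.
Proof. by move=> a; rewrite -(gc_repK a) gc_addE !add0r. Qed.

Lemma gc_addN : left_inverse (gc_cls 0 0) gc_opp gc_add.
Proof.
move=> a; rewrite -(gc_repK a) gc_oppE gc_addE.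
by apply/gc_clsP; exists 0; rewrite !addr0 add0r addrC.
Qed.

HB.instance Definition _ :=
  GRing.isZmodule.Build gcompl gc_addA gc_addC gc_add0 gc_addN.

Lemma gc_inD x y : gc_in (x + y) = gc_in x + gc_in y.
Proof. by rewrite [RHS]gc_addE addr0. Qed.

Lemma gc_clsE x y : gc_cls x y = gc_in x - gc_in y.
Proof. by rewrite [- _]gc_oppE [RHS]gc_addE addr0 add0r. Qed.

Lemma gc_in_ext (V : zmodType) (f g : gcompl -> V) :
    {morph f : x y / x + y} -> {morph g : x y / x + y} ->
  (forall x, f (gc_in x) = g (gc_in x)) -> f =1 g.
Proof.
move=> fD gD fg c.
have opp (h : gcompl -> V) : {morph h : x y / x + y} -> forall x, h (- x) = - h x.
  move=> hD x; apply/eqP; rewrite -subr_eq0 opprK -hD addNr; apply/eqP.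
  by apply: (@addrI _ (h 0)); rewrite -hD !addr0.
by rewrite -(gc_repK c) gc_clsE fD gD (opp f) // (opp g) // !fg.
Qed.

(* the additive extension of an additive map to the group completion *)
Definition gc_lift (V : zmodType) (f : M -> V) (c : gcompl) : V :=
  f (gc_pos c) - f (gc_neg c).

Section Lift.
Variables (V : zmodType) (f : M -> V) (fD : {morph f : x y / x + y}).

Lemma gc_lift_cls x y : gc_lift f (gc_cls x y) = f x - f y.
Proof.
rewrite /gc_lift; have [k hk] := gc_rep x y.
apply/eqP; rewrite subr_eq addrAC eq_sym subr_eq -!fD; apply/eqP.
by apply: (@addIr _ (f k)); rewrite -!fD hk.
Qed.

Lemma gc_lift_in x : gc_lift f (gc_in x) = f x.
Proof.
rewrite gc_lift_cls; have -> : f 0 = 0 by apply: (@addrI _ (f 0)); rewrite -fD !addr0.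
by rewrite subr0.
Qed.

Lemma gc_liftD : {morph gc_lift f : c d / c + d}.
Proof.
move=> c d; rewrite -(gc_repK c) -(gc_repK d).
by rewrite [_ + _]gc_addE !gc_lift_cls !fD opprD addrACA.
Qed.

End Lift.
End GroupCompletion.

Section BiLift.
Variables (M N : nmodType) (V : zmodType) (f : M -> N -> V).

(* the biadditive extension of a biadditive map to the group completions *)
Definition gc_lift2 (c : gcompl M) (d : gcompl N) : V :=
  gc_lift (fun x => gc_lift (f x) d) c.

Hypothesis fDl : forall y, {morph f^~ y : x x' / x + x'}.
Hypothesis fDr : forall x, {morph f x : y y' / y + y'}.

Lemma gc_lift2_aux d : {morph (fun x => gc_lift (f x) d) : x x' / x + x'}.
Proof. by move=> x x'; rewrite /gc_lift !fDl opprD addrACA. Qed.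

Lemma gc_lift2_in x y : gc_lift2 (gc_in x) (gc_in y) = f x y.
Proof. by rewrite /gc_lift2 gc_lift_in ?gc_lift_in //; apply: gc_lift2_aux. Qed.

Lemma gc_lift2Dl d : {morph gc_lift2^~ d : c c' / c + c'}.
Proof. by move=> c c'; apply: gc_liftD; apply: gc_lift2_aux. Qed.

Lemma gc_lift2Dr c : {morph gc_lift2 c : d d' / d + d'}.
Proof.
move=> d d'; set x := gc_pos c; set y := gc_neg c.
rewrite -[LHS]/(gc_lift (f x) (d + d') - gc_lift (f y) (d + d')).
rewrite !gc_liftD // opprD addrACA; by [].
Qed.

End BiLift.

(* G is the whole finGroupType gT; actions are right actions, as everywhere in
   MathComp. *)
Record gset (gT : finGroupType) := GSet {
  gset_sort :> finType;
  gact : {action gT &-> gset_sort} }.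

Record gmap (gT : finGroupType) (X Y : gset gT) := GMap {
  gfun :> X -> Y;
  gfunP : forall x a, gfun (gact X x a) = gact Y (gfun x) a }.

Section GSets.
Variable gT : finGroupType.
Implicit Types X Y Z W A B C D : gset gT.

Lemma gmap_eq X Y (f g : gmap X Y) : f =1 g -> f = g.
Proof.
case: f g => [f fP] [g gP] /= /funext fg; case: _ / fg in gP *.
by congr GMap; apply: Prop_irrelevance.
Qed.

Definition gid X : gmap X X := @GMap gT X X id (fun _ _ => erefl).

Lemma gcomp_subproof X Y Z (g : gmap Y Z) (f : gmap X Y) x a :
  (g \o f) (gact X x a) = gact Z ((g \o f) x) a.
Proof. by rewrite /= !gfunP. Qed.

Definition gcomp X Y Z (g : gmap Y Z) (f : gmap X Y) : gmap X Z :=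
  GMap (gcomp_subproof g f).

Definition is_pullback A B C D
    (p : gmap A B) (f : gmap A C) (g : gmap B D) (k : gmap C D) : Prop :=
  gcomp g p = gcomp k f /\
  forall W (u : gmap W B) (v : gmap W C), gcomp g u = gcomp k v ->
    exists! w : gmap W A, gcomp p w = u /\ gcomp f w = v.

Definition is_coproduct (I : finType) (X : I -> gset gT) S
    (inj : forall i, gmap (X i) S) : Prop :=
  forall Z (f : forall i, gmap (X i) Z),
    exists! h : gmap S Z, forall i, gcomp h (inj i) = f i.

Definition gprod_act X Y (p : X * Y) (a : gT) := (gact X p.1 a, gact Y p.2 a).

Lemma gprod_act1 X Y p : @gprod_act X Y p 1%g = p.
Proof. by case: p => x y; rewrite /gprod_act !act1. Qed.

Lemma gprod_actM X Y p : act_morph (@gprod_act X Y) p.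
Proof. by case: p => x y a b; rewrite /gprod_act !actM. Qed.

Definition gprod X Y : gset gT :=
  GSet (TotalAction (@gprod_act1 X Y) (@gprod_actM X Y)).

Definition gprod_fun X Y X' Y' (f : X -> X') (g : Y -> Y') (p : X * Y) :=
  (f p.1, g p.2).

Definition gprod_map X Y X' Y' (f : gmap X X') (g : gmap Y Y') :
  gmap (gprod X Y) (gprod X' Y').
Proof.
by exists (gprod_fun f g); case=> x y a; rewrite /gprod_fun /= !gfunP.
Defined.

Definition gsum_act X Y (p : X + Y) (a : gT) : X + Y :=
  match p with inl x => inl (gact X x a) | inr y => inr (gact Y y a) end.

Lemma gsum_act1 X Y p : @gsum_act X Y p 1%g = p.
Proof. by case: p => x /=; rewrite act1. Qed.

Lemma gsum_actM X Y p : act_morph (@gsum_act X Y) p.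
Proof. by case: p => x a b /=; rewrite actM. Qed.

Definition gsum X Y : gset gT :=
  GSet (TotalAction (@gsum_act1 X Y) (@gsum_actM X Y)).

Definition ginl X Y : gmap X (gsum X Y) :=
  @GMap gT X (gsum X Y) inl (fun _ _ => erefl).
Definition ginr X Y : gmap Y (gsum X Y) :=
  @GMap gT Y (gsum X Y) inr (fun _ _ => erefl).

Definition gcopair_fun X Y (Z : Type) (f : X -> Z) (g : Y -> Z) (p : X + Y) :=
  match p with inl x => f x | inr y => g y end.

Definition gcopair X Y Z (f : gmap X Z) (g : gmap Y Z) : gmap (gsum X Y) Z.
Proof.
by exists (gcopair_fun f g); case=> x a /=; rewrite gfunP.
Defined.

Definition gsum_map X Y X' Y' (f : gmap X X') (g : gmap Y Y') :
    gmap (gsum X Y) (gsum X' Y') :=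
  gcopair (gcomp (ginl X' Y') f) (gcomp (ginr X' Y') g).

Definition gempty : gset gT :=
  GSet (TotalAction (to := fun (x : void) (_ : gT) => x)
    (fun _ => erefl) (fun _ _ _ => erefl)).

Definition gempty_map X : gmap gempty X :=
  @GMap gT gempty X (of_void X) (fun x => match x with end).

Section Pullback.
Variables (X Y Z : gset gT) (f : gmap X Z) (g : gmap Y Z).

Definition gpb_sort : finType := {p : X * Y | f p.1 == g p.2}.

Lemma gpb_act_subproof (p : gpb_sort) a :
  f (gact X (val p).1 a) == g (gact Y (val p).2 a).
Proof. by rewrite !gfunP (eqP (valP p)). Qed.

Definition gpb_act (p : gpb_sort) a : gpb_sort :=
  exist (fun p : X * Y => f p.1 == g p.2)
    (gprod_act (val p) a) (gpb_act_subproof p a).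

Lemma gpb_act1 p : gpb_act p 1%g = p.
Proof. by apply: val_inj; apply: gprod_act1. Qed.

Lemma gpb_actM p : act_morph gpb_act p.
Proof. by move=> a b; apply: val_inj; apply: gprod_actM. Qed.

Definition gpb : gset gT := GSet (TotalAction gpb_act1 gpb_actM).

Definition gpb1 : gmap gpb X :=
  @GMap gT gpb X (fun p => (val p).1) (fun _ _ => erefl).
Definition gpb2 : gmap gpb Y :=
  @GMap gT gpb Y (fun p => (val p).2) (fun _ _ => erefl).

Lemma gpbE (p : gpb) : f (gpb1 p) = g (gpb2 p).
Proof. exact: eqP (valP p). Qed.

Lemma gpb_ext (p q : gpb) : gpb1 p = gpb1 q -> gpb2 p = gpb2 q -> p = q.
Proof.
by case: p q => [[x y] h] [[x' y'] h'] /= ex ey; apply: val_inj; rewrite /= ex ey.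
Qed.

Lemma gpb_ex x y : f x = g y -> exists p : gpb, gpb1 p = x /\ gpb2 p = y.
Proof. by move/eqP=> e; exists (exist _ (x, y) e). Qed.

Section Pair.
Variables (W : gset gT) (u : gmap W X) (v : gmap W Y).
Hypothesis uv : forall w, f (u w) = g (v w).

Definition gpb_pair_fun (w : W) : gpb :=
  exist (fun p : X * Y => f p.1 == g p.2) (u w, v w) (introT eqP (uv w)).

Definition gpb_pair : gmap W gpb.
Proof.
by exists gpb_pair_fun => w a; apply: gpb_ext; rewrite /= gfunP.
Defined.

End Pair.
End Pullback.

Lemma gpbP X Y Z (f : gmap X Z) (g : gmap Y Z) :
  is_pullback (gpb1 f g) (gpb2 f g) f g.
Proof.
split=> [|W u v uv]; first by apply: gmap_eq => p; apply: gpbE.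
have uv' w : f (u w) = g (v w) by have /(congr1 (fun h => gfun h w)) := uv.
exists (gpb_pair uv'); split; first by split; apply: gmap_eq.
by move=> w' [e1 e2]; apply: gmap_eq => w; apply: gpb_ext;
  [rewrite -[RHS]/(gcomp (gpb1 f g) w' w) e1 | rewrite -[RHS]/(gcomp (gpb2 f g) w' w) e2].
Qed.

Lemma gpb_pair_inj X Y Z (f : gmap X Z) (g : gmap Y Z) W (u : gmap W X)
    (v : gmap W Y) (uv : forall w, f (u w) = g (v w)) :
    (forall x y, u x = u y -> v x = v y -> x = y) -> injective (gpb_pair uv).
Proof. by move=> h x y /(congr1 val) [] /h /[apply]. Qed.

Lemma gpb_pair_surj X Y Z (f : gmap X Z) (g : gmap Y Z) W (u : gmap W X)
    (v : gmap W Y) (uv : forall w, f (u w) = g (v w)) :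
    (forall x y, f x = g y -> exists w, u w = x /\ v w = y) ->
  forall p, exists w, gpb_pair uv w = p.
Proof.
move=> h p; have [w [w1 w2]] := h _ _ (gpbE p).
by exists w; apply: gpb_ext; [exact: w1 | exact: w2].
Qed.

Lemma gmap_bij X Y (f : gmap X Y) :
  injective f -> (forall y, exists x, f x = y) -> bijective f.
Proof.
move=> finj fsurj; have h y : {x | f x == y}.
  by apply: sigW; have [x <-] := fsurj y; exists x.
exists (fun y => sval (h y)) => [x|y]; last exact: (eqP (svalP (h y))).
by apply: finj; exact: (eqP (svalP (h (f x)))).
Qed.

Lemma bij_surj X Y (f : X -> Y) : bijective f -> forall y, exists x, f x = y.
Proof. by case=> g _ gK y; exists (g y). Qed.

Lemma gmap_inv X Y (f : gmap X Y) : bijective f ->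
  exists g : gmap Y X, cancel f g /\ cancel g f.
Proof.
case=> g fK gK.
have gP y a : g (gact Y y a) = gact X (g y) a.
  by rewrite -{1}(gK y) -gfunP fK.
by exists (GMap gP).
Qed.

End GSets.

Section Orbits.
Variables (gT : finGroupType) (H : {group gT}).

Definition coset_sort : finType := {A : {set gT} | A \in rcosets H [set: gT]}.

Lemma coset_act_subproof (A : coset_sort) a :
  (val A :* a)%g \in rcosets H [set: gT].
Proof.
case: A => A /= /rcosetsP[x _ ->].
by rewrite -rcosetM mem_rcosets mulSGid ?subsetT ?inE.
Qed.

Definition coset_act (A : coset_sort) (a : gT) : coset_sort :=
  exist (fun A : {set gT} => A \in rcosets H [set: gT])
    (val A :* a)%g (coset_act_subproof A a).

Lemma coset_act1 A : coset_act A 1%g = A.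
Proof. by apply: val_inj; rewrite /= rcoset1. Qed.

Lemma coset_actM A : act_morph coset_act A.
Proof. by move=> a b; apply: val_inj; rewrite /= rcosetM. Qed.

Definition orbit_gset : gset gT := GSet (TotalAction coset_act1 coset_actM).

End Orbits.

(* The last two fields say that finite coproducts of Set^G are coproducts in
   the subcategory, i.e. that it has finite coproducts created in Set^G. *)
Record indexing (gT : finGroupType) := Indexing {
  indexing_mor :> forall X Y : gset gT, gmap X Y -> Prop;
  indexing_id : forall X, indexing_mor (gid X);
  indexing_comp : forall X Y Z (g : gmap Y Z) (f : gmap X Y),
    indexing_mor g -> indexing_mor f -> indexing_mor (gcomp g f);
  indexing_pullback : forall (A B C D : gset gT)
      (p : gmap A B) (f : gmap A C) (g : gmap B D) (k : gmap C D),
    is_pullback p f g k -> indexing_mor g -> indexing_mor f;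
  indexing_inj : forall (I : finType) (X : I -> gset gT) S
      (inj : forall i, gmap (X i) S),
    is_coproduct inj -> forall i, indexing_mor (inj i);
  indexing_copair : forall (I : finType) (X : I -> gset gT) S
      (inj : forall i, gmap (X i) S), is_coproduct inj ->
    forall Z (h : gmap S Z),
      (forall i, indexing_mor (gcomp h (inj i))) -> indexing_mor h }.

Definition trivial_indexing (gT : finGroupType) (X Y : gset gT)
    (g : gmap X Y) : Prop :=
  forall x : X, 'C[x | gact X]%g = 'C[g x | gact Y]%g.

Section Induction.
Variables (gT : finGroupType) (H : {group gT}).
Implicit Types X Y : gset (subg_of H).

Definition ind_pre_act X (p : X * gT) (h : subg_of H) : X * gT :=
  (gact X p.1 h, (sgval h)^-1 * p.2)%g.

Lemma ind_pre_act1 X p : @ind_pre_act X p 1%g = p.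
Proof. by case: p => x g; rewrite /ind_pre_act act1 /= invg1 mul1g. Qed.

Lemma ind_pre_actM X p : act_morph (@ind_pre_act X) p.
Proof. by case: p => x g a b; rewrite /ind_pre_act /= actM invMg mulgA. Qed.

Definition ind_pre X : {action subg_of H &-> X * gT} :=
  TotalAction (@ind_pre_act1 X) (@ind_pre_actM X).

Definition ind_cls X (p : X * gT) : {set X * gT} :=
  orbit (ind_pre X) [set: subg_of H] p.

Definition ind_sort X : finType :=
  {A : {set X * gT} | A \in [set ind_cls p | p : X * gT]}.

Definition ind_fun X Y (f : X -> Y) (A : {set X * gT}) : {set Y * gT} :=
  [set (f q.1, q.2) | q in A].

Definition ind_tr X (A : {set X * gT}) (a : gT) : {set X * gT} :=
  [set (q.1, q.2 * a)%g | q in A].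

Lemma ind_tr_cls X (p : X * gT) a :
  ind_tr (ind_cls p) a = ind_cls (p.1, p.2 * a)%g.
Proof.
apply/setP=> q; apply/imsetP/imsetP => [[_ /imsetP[h _ ->] ->]|[h _ ->]].
  by exists h; rewrite ?inE //= /ind_pre_act /= mulgA.
exists (ind_pre_act p h); first exact: (imset_f (ind_pre _ p) (in_setT h)).
by rewrite /= /ind_pre_act /= mulgA.
Qed.

Lemma ind_fun_cls X Y (f : gmap X Y) (p : X * gT) :
  ind_fun f (ind_cls p) = ind_cls (f p.1, p.2).
Proof.
apply/setP=> q; apply/imsetP/imsetP => [[_ /imsetP[h _ ->] ->]|[h _ ->]].
  by exists h; rewrite ?inE //= /ind_pre_act /= gfunP.
exists (ind_pre_act p h); first exact: (imset_f (ind_pre _ p) (in_setT h)).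
by rewrite /= /ind_pre_act /= gfunP.
Qed.

Lemma ind_act_subproof X (A : ind_sort X) a :
  ind_tr (val A) a \in [set ind_cls p | p : X * gT].
Proof.
by case: A => A /= /imsetP[p _ ->]; rewrite ind_tr_cls imset_f.
Qed.

Definition ind_act X (A : ind_sort X) a : ind_sort X :=
  exist (fun A : {set X * gT} => A \in [set ind_cls p | p : X * gT])
    (ind_tr (val A) a) (ind_act_subproof A a).

Lemma ind_act1 X A : @ind_act X A 1%g = A.
Proof.
apply: val_inj; case: A => A /= /imsetP[p _ ->].
by rewrite ind_tr_cls mulg1 -surjective_pairing.
Qed.

Lemma ind_actM X A : act_morph (@ind_act X) A.
Proof.
move=> a b; apply: val_inj; case: A => A /= /imsetP[p _ ->].
by rewrite !ind_tr_cls mulgA.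
Qed.

(* G x_H X as the set of orbits of H on X * G under (x, g) |-> (x h, h^-1 g),
   with G acting by right translation of the second component. *)
Definition ind_gset X : gset gT :=
  GSet (TotalAction (@ind_act1 X) (@ind_actM X)).

Lemma ind_map_subproof X Y (f : gmap X Y) (A : ind_sort X) :
  ind_fun f (val A) \in [set ind_cls p | p : Y * gT].
Proof.
by case: A => A /= /imsetP[p _ ->]; rewrite ind_fun_cls imset_f.
Qed.

Definition ind_map_fun X Y (f : gmap X Y) (A : ind_sort X) : ind_sort Y :=
  exist (fun A : {set Y * gT} => A \in [set ind_cls p | p : Y * gT])
    (ind_fun f (val A)) (ind_map_subproof f A).

Lemma ind_mapP X Y (f : gmap X Y) (A : ind_gset X) a :
  ind_map_fun f (gact (ind_gset X) A a)
  = gact (ind_gset Y) (ind_map_fun f A) a.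
Proof.
apply: val_inj; case: A => A /= /imsetP[p _ ->].
by rewrite ind_tr_cls !ind_fun_cls ind_tr_cls.
Qed.

Definition ind_map X Y (f : gmap X Y) : gmap (ind_gset X) (ind_gset Y) :=
  @GMap gT (ind_gset X) (ind_gset Y) (ind_map_fun f) (ind_mapP f).

(* the class of morphisms of i_H^* O *)
Definition restrict_indexing (O : indexing gT) X Y (f : gmap X Y) : Prop :=
  O _ _ (ind_map f).

End Induction.

Definition admissible (gT : finGroupType) (O : indexing gT) (H : {group gT}) :=
  exists f : gmap (orbit_gset H) (orbit_gset [set: gT]%G), O _ _ f.

(* Every finite G-set is isomorphic to one carried by an ordinal. Taking the
   apex of a span (and the middle terms of a bispan) of this form makes the
   hom-sets below small, so that they are carriers of zmodTypes. *)
Record ordgset (gT : finGroupType) := OrdGSet {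
  ord_size : nat;
  ord_act : {action gT &-> 'I_ord_size} }.

Definition gset_of_ord (gT : finGroupType) (A : ordgset gT) : gset gT :=
  GSet (ord_act A).
Coercion gset_of_ord : ordgset >-> gset.

Section OrdModel.
Variables (gT : finGroupType) (A : gset gT).

Definition to_ord_act (i : 'I_#|A|) (a : gT) : 'I_#|A| :=
  enum_rank (gact A (enum_val i) a).

Lemma to_ord_act1 i : to_ord_act i 1%g = i.
Proof. by rewrite /to_ord_act act1 enum_valK. Qed.

Lemma to_ord_actM i : act_morph to_ord_act i.
Proof. by move=> a b; rewrite /to_ord_act actM enum_rankK. Qed.

Definition to_ord : ordgset gT :=
  OrdGSet (TotalAction to_ord_act1 to_ord_actM).

Lemma rank_mapP x a :
  enum_rank (gact A x a) = gact to_ord (enum_rank x) a.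
Proof. by rewrite /= /to_ord_act enum_rankK. Qed.

Definition rank_map : gmap A to_ord := @GMap gT A to_ord enum_rank rank_mapP.

Lemma val_mapP (i : to_ord) a :
  enum_val (gact to_ord i a) = gact A (enum_val i) a.
Proof. by rewrite /= /to_ord_act enum_rankK. Qed.

Definition val_map : gmap to_ord A := @GMap gT to_ord A enum_val val_mapP.

Lemma rank_mapK : cancel rank_map val_map.
Proof. exact: enum_rankK. Qed.

Lemma val_mapK : cancel val_map rank_map.
Proof. exact: enum_valK. Qed.

End OrdModel.

Record gspan (gT : finGroupType) (X Y : gset gT) := Span {
  apex : ordgset gT;
  lleg : gmap apex X;
  rleg : gmap apex Y }.

Section Spans.
Variable gT : finGroupType.
Implicit Types X Y Z W : gset gT.

Definition span_iso X Y (S S' : gspan X Y) : Prop :=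
  exists phi : gmap (apex S) (apex S'),
    [/\ bijective phi, gcomp (lleg S') phi = lleg S
      & gcomp (rleg S') phi = rleg S].

Lemma span_iso_refl X Y (S : gspan X Y) : span_iso S S.
Proof.
by exists (gid _); split; [exists id | apply: gmap_eq | apply: gmap_eq].
Qed.

Lemma span_iso_sym X Y (S S' : gspan X Y) : span_iso S S' -> span_iso S' S.
Proof.
move=> [f [fb fl fr]]; have [g [fK gK]] := gmap_inv fb.
exists g; split; first by exists f.
- by apply: gmap_eq => x; rewrite -fl /= gK.
- by apply: gmap_eq => x; rewrite -fr /= gK.
Qed.

Lemma span_iso_trans X Y (S S' S'' : gspan X Y) :
  span_iso S S' -> span_iso S' S'' -> span_iso S S''.
Proof.
move=> [f [fb fl fr]] [g [gb gl gr]]; exists (gcomp g f).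
split; first exact: bij_comp.
- by rewrite -fl -gl; apply: gmap_eq.
- by rewrite -fr -gr; apply: gmap_eq.
Qed.

Definition span_setoid X Y : setoid :=
  Setoid (@span_iso_refl X Y) (@span_iso_sym X Y) (@span_iso_trans X Y).

Definition spancls X Y : Type := quot (span_setoid X Y).
HB.instance Definition _ X Y := Choice.on (spancls X Y).

(* the class of a span X <- A -> Y with arbitrary apex A *)
Definition mkspan X Y (A : gset gT) (f : gmap A X) (g : gmap A Y)
    : spancls X Y :=
  cls (E := span_setoid X Y)
    (Span (gcomp f (val_map A)) (gcomp g (val_map A))).

Lemma mkspan_eq X Y (A A' : gset gT) (f : gmap A X) (g : gmap A Y)
    (f' : gmap A' X) (g' : gmap A' Y) (phi : gmap A A') :
    injective phi -> (forall y, exists x, phi x = y) ->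
    (forall x, f' (phi x) = f x) -> (forall x, g' (phi x) = g x) ->
  mkspan f g = mkspan f' g'.
Proof.
move=> pi ps ef eg; apply/clsP.
exists (gcomp (rank_map A') (gcomp phi (val_map A))); split.
- apply: bij_comp; last apply: bij_comp.
  + by exists (val_map A'); [exact: rank_mapK | exact: val_mapK].
  + exact: gmap_bij.
  + by exists (rank_map A); [exact: val_mapK | exact: rank_mapK].
- by apply: gmap_eq => x; rewrite /= enum_rankK ef.
- by apply: gmap_eq => x; rewrite /= enum_rankK eg.
Qed.

Lemma mkspan_rep X Y (c : spancls X Y) :
  mkspan (lleg (rep c)) (rleg (rep c)) = c.
Proof.
rewrite -[RHS]repK; apply/clsP; exists (val_map _).
split; try exact: gmap_eq.
by exists (rank_map (apex (rep c))); [exact: val_mapK | exact: rank_mapK].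
Qed.

Lemma rep_mkspan X Y (A : gset gT) (f : gmap A X) (g : gmap A Y) :
  exists phi : gmap (apex (rep (mkspan f g))) A,
    [/\ injective phi, forall y, exists x, phi x = y,
        forall x, f (phi x) = lleg (rep (mkspan f g)) x
      & forall x, g (phi x) = rleg (rep (mkspan f g)) x].
Proof.
have [phi [pb pf pg]] := rep_cls (E := span_setoid X Y)
  (Span (gcomp f (val_map A)) (gcomp g (val_map A))).
exists (gcomp (val_map A) phi); split.
- exact: inj_comp (can_inj (@val_mapK _ A)) (bij_inj pb).
- move=> y; have [x ex] := bij_surj pb (rank_map A y).
  by exists x; rewrite /= ex; apply: rank_mapK.
- by move=> x; rewrite -pf.
- by move=> x; rewrite -pg.
Qed.

Lemma span_ind X Y (P : spancls X Y -> Prop) :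
  (forall (A : gset gT) (f : gmap A X) (g : gmap A Y), P (mkspan f g)) ->
  forall c, P c.
Proof. by move=> h c; rewrite -(mkspan_rep c). Qed.

Definition span_add X Y (c d : spancls X Y) : spancls X Y :=
  mkspan (gcopair (lleg (rep c)) (lleg (rep d)))
         (gcopair (rleg (rep c)) (rleg (rep d))).

Definition span_zero X Y : spancls X Y :=
  mkspan (gempty_map X) (gempty_map Y).

Lemma gsum_map_inj X Y X' Y' (f : gmap X X') (g : gmap Y Y') :
  injective f -> injective g -> injective (gsum_map f g).
Proof. by move=> fi gi [x|x] [y|y] //= [] => [/fi|/gi] ->. Qed.

Lemma gsum_map_surj X Y X' Y' (f : gmap X X') (g : gmap Y Y') :
    (forall y, exists x, f x = y) -> (forall y, exists x, g x = y) ->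
  forall y, exists x, gsum_map f g x = y.
Proof.
by move=> fs gs [y|y]; [have [x <-] := fs y; exists (inl x)
                      | have [x <-] := gs y; exists (inr x)].
Qed.

Lemma span_addE X Y (A B : gset gT) (f : gmap A X) (g : gmap A Y)
    (f' : gmap B X) (g' : gmap B Y) :
  span_add (mkspan f g) (mkspan f' g')
  = mkspan (gcopair f f') (gcopair g g').
Proof.
have [p [pi ps pf pg]] := rep_mkspan f g.
have [q [qi qs qf qg]] := rep_mkspan f' g'.
apply: (mkspan_eq (phi := gsum_map p q)).
- exact: gsum_map_inj.
- exact: gsum_map_surj.
- by case=> x /=.
- by case=> x /=.
Qed.

Lemma span_addA X Y : associative (@span_add X Y).
Proof.
elim/span_ind=> A f g; elim/span_ind=> B f' g'; elim/span_ind=> C f'' g''.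
rewrite !span_addE; apply: (mkspan_eq (phi := gcopair
  (gcomp (ginl _ _) (ginl A B))
  (gcopair (gcomp (ginl _ _) (ginr A B)) (ginr _ C)))).
- by move=> [x|[x|x]] [y|[y|y]] //= [->].
- by move=> [[x|x]|x]; [exists (inl x) | exists (inr (inl x)) | exists (inr (inr x))].
- by move=> [x|[x|x]].
- by move=> [x|[x|x]].
Qed.

Lemma span_addC X Y : commutative (@span_add X Y).
Proof.
elim/span_ind=> A f g; elim/span_ind=> B f' g'.
rewrite !span_addE; apply: (mkspan_eq (phi := gcopair (ginr B A) (ginl B A))).
- by move=> [x|x] [y|y] //= [->].
- by move=> [x|x]; [exists (inr x) | exists (inl x)].
- by move=> [x|x].
- by move=> [x|x].
Qed.

Lemma span_add0 X Y : left_id (span_zero X Y) (@span_add X Y).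
Proof.
elim/span_ind=> A f g; rewrite span_addE; symmetry.
apply: (mkspan_eq (phi := ginr (gempty gT) A)) => //.
- by move=> x y [].
- by move=> [[]|x]; exists x.
Qed.

HB.instance Definition _ X Y := GRing.isNmodule.Build (spancls X Y)
  (@span_addA X Y) (@span_addC X Y) (@span_add0 X Y).

Lemma mkspanD X Y (A B : gset gT) (f : gmap A X) (g : gmap A Y)
    (f' : gmap B X) (g' : gmap B Y) :
  mkspan f g + mkspan f' g' = mkspan (gcopair f f') (gcopair g g').
Proof. exact: span_addE. Qed.

Definition span_comp X Y Z (d : spancls Y Z) (c : spancls X Y) : spancls X Z :=
  mkspan (gcomp (lleg (rep c)) (gpb1 (rleg (rep c)) (lleg (rep d))))
         (gcomp (rleg (rep d)) (gpb2 (rleg (rep c)) (lleg (rep d)))).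

Lemma span_compE X Y Z (A B : gset gT) (f : gmap A X) (g : gmap A Y)
    (f' : gmap B Y) (g' : gmap B Z) :
  span_comp (mkspan f' g') (mkspan f g)
  = mkspan (gcomp f (gpb1 g f')) (gcomp g' (gpb2 g f')).
Proof.
have [p [pi ps pf pg]] := rep_mkspan f g.
have [q [qi qs qf qg]] := rep_mkspan f' g'.
have e w : g (gcomp p (gpb1 _ _) w) = f' (gcomp q (gpb2 (rleg _) (lleg _)) w).
  by rewrite /= pg qf; apply: gpbE w.
apply: (mkspan_eq (phi := gpb_pair e)).
- move=> x y /(congr1 val) [] /pi e1 /qi e2; apply: gpb_ext; [exact: e1 | exact: e2].
- move=> y; have [a ea] := ps (gpb1 _ _ y); have [b eb] := qs (gpb2 _ _ y).
  have [|x [x1 x2]] := @gpb_ex _ _ _ _ (rleg (rep (mkspan f g)))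
                         (lleg (rep (mkspan f' g'))) a b.
    by rewrite -pg -qf ea eb; apply: gpbE.
  exists x; apply: gpb_ext; [rewrite -ea -x1 | rewrite -eb -x2]; by [].
- by move=> x /=; rewrite pf.
- by move=> x /=; rewrite qg.
Qed.

Definition span_id X : spancls X X := mkspan (gid X) (gid X).

Lemma span_compDl X Y Z (c : spancls X Y) :
  {morph (fun d : spancls Y Z => span_comp d c) : d d' / d + d'}.
Proof.
elim/span_ind: c => A f g; elim/span_ind=> B f1 g1; elim/span_ind=> C f2 g2.
rewrite mkspanD !span_compE mkspanD; symmetry.
have e1 w : g (gpb1 g f1 w)
    = gcopair f1 f2 (gcomp (ginl B C) (gpb2 g f1) w) by apply: gpbE.
have e2 w : g (gpb1 g f2 w)
    = gcopair f1 f2 (gcomp (ginr B C) (gpb2 g f2) w) by apply: gpbE.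
apply: (mkspan_eq (phi := gcopair (gpb_pair e1) (gpb_pair e2))).
- by move=> [x|x] [y|y] /(congr1 val) [] // h1 h2; congr (_ _); apply: gpb_ext.
- move=> y; case E: (gpb2 g (gcopair f1 f2) y) (gpbE y) => [b|b] h.
  + have [x [x1 x2]] := gpb_ex (g := f1) h; exists (inl x).
    by apply: gpb_ext; [exact: x1 | rewrite E -x2].
  + have [x [x1 x2]] := gpb_ex (g := f2) h; exists (inr x).
    by apply: gpb_ext; [exact: x1 | rewrite E -x2].
- by case.
- by case.
Qed.

Lemma span_compDr X Y Z (d : spancls Y Z) :
  {morph (fun c : spancls X Y => span_comp d c) : c c' / c + c'}.
Proof.
elim/span_ind: d => A f g; elim/span_ind=> B f1 g1; elim/span_ind=> C f2 g2.
rewrite mkspanD !span_compE mkspanD; symmetry.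
have e1 w : gcopair g1 g2 (gcomp (ginl B C) (gpb1 g1 f) w)
    = f (gpb2 g1 f w) by apply: gpbE.
have e2 w : gcopair g1 g2 (gcomp (ginr B C) (gpb1 g2 f) w)
    = f (gpb2 g2 f w) by apply: gpbE.
apply: (mkspan_eq (phi := gcopair (gpb_pair e1) (gpb_pair e2))).
- by move=> [x|x] [y|y] /(congr1 val) [] // h1 h2; congr (_ _); apply: gpb_ext.
- move=> y; case E: (gpb1 (gcopair g1 g2) f y) (gpbE y) => [b|b] h.
  + have [x [x1 x2]] := gpb_ex (f := g1) h; exists (inl x).
    by apply: gpb_ext; [rewrite E -x1 | exact: x2].
  + have [x [x1 x2]] := gpb_ex (f := g2) h; exists (inr x).
    by apply: gpb_ext; [rewrite E -x1 | exact: x2].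
- by case.
- by case.
Qed.

Lemma span_compA X Y Z W (c : spancls Z W) (b : spancls Y Z) (a : spancls X Y) :
  span_comp c (span_comp b a) = span_comp (span_comp c b) a.
Proof.
elim/span_ind: a => A f g; elim/span_ind: b => B f' g'.
elim/span_ind: c => C f'' g''; rewrite !span_compE.
set P := gpb g f'; set Q := gpb g' f''.
have e1 w : g' (gcomp (gpb2 g f') (gpb1 (gcomp g' (gpb2 g f')) f'') w)
    = f'' (gpb2 (gcomp g' (gpb2 g f')) f'' w) by apply: (gpbE w).
have e2 w : g (gcomp (gpb1 g f') (gpb1 (gcomp g' (gpb2 g f')) f'') w)
    = gcomp f' (gpb1 g' f'') (gpb_pair e1 w).
  exact: (gpbE (gpb1 (gcomp g' (gpb2 g f')) f'' w)).
apply: (mkspan_eq (phi := gpb_pair e2)) => //.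
- move=> x y /(congr1 val) [] h1 h2 h3.
  apply: gpb_ext; last exact: h3.
  by apply: gpb_ext; [exact: h1 | exact: h2].
- move=> y; set q := gpb2 _ _ y.
  have h1 : g (gpb1 _ _ y) = f' (gpb1 _ _ q) := gpbE y.
  have [p [p1 p2]] := gpb_ex h1.
  have h2 : gcomp g' (gpb2 g f') p = f'' (gpb2 _ _ q).
    by rewrite -[LHS]/(g' (gpb2 g f' p)) p2; apply: (gpbE q).
  have [x [x1 x2]] := gpb_ex h2; exists x.
  apply: gpb_ext; first by rewrite -p1 -x1.
  by apply: gpb_ext; [rewrite -/q -p2 -x1 | rewrite -/q -x2].
Qed.

Lemma span_comp1l X Y (c : spancls X Y) : span_comp (span_id Y) c = c.
Proof.
elim/span_ind: c => A f g; rewrite span_compE; symmetry.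
have e w : g (gid A w) = gid Y (g w) by [].
apply: (mkspan_eq (phi := gpb_pair e)) => //.
- by move=> x y /(congr1 val) [].
- by move=> y; exists (gpb1 _ _ y); apply: gpb_ext => //; apply: (gpbE y).
Qed.

Lemma span_comp1r X Y (c : spancls X Y) : span_comp c (span_id X) = c.
Proof.
elim/span_ind: c => A f g; rewrite span_compE; symmetry.
have e w : gid X (f w) = f (gid A w) by [].
apply: (mkspan_eq (phi := gpb_pair e)) => //.
- by move=> x y /(congr1 val) [].
- by move=> y; exists (gpb2 _ _ y); apply: gpb_ext => //; symmetry; apply: (gpbE y).
Qed.

Definition span_prod X Y X' Y' (c : spancls X X') (d : spancls Y Y') :
    spancls (gprod X Y) (gprod X' Y') :=
  mkspan (gprod_map (lleg (rep c)) (lleg (rep d)))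
         (gprod_map (rleg (rep c)) (rleg (rep d))).

Lemma span_prodE X Y X' Y' (A B : gset gT) (f : gmap A X) (g : gmap A X')
    (f' : gmap B Y) (g' : gmap B Y') :
  span_prod (mkspan f g) (mkspan f' g')
  = mkspan (gprod_map f f') (gprod_map g g').
Proof.
have [p [pi ps pf pg]] := rep_mkspan f g.
have [q [qi qs qf qg]] := rep_mkspan f' g'.
apply: (mkspan_eq (phi := gprod_map p q)).
- by move=> [x y] [x' y'] [/pi -> /qi ->].
- by move=> [x y]; have [a <-] := ps x; have [b <-] := qs y; exists (a, b).
- by case=> x y; rewrite /= /gprod_fun /= pf qf.
- by case=> x y; rewrite /= /gprod_fun /= pg qg.
Qed.

Lemma span_prodDl X Y X' Y' (d : spancls Y Y') :
  {morph (fun c : spancls X X' => span_prod c d) : c c' / c + c'}.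
Proof.
elim/span_ind: d => A f g; elim/span_ind=> B f1 g1; elim/span_ind=> C f2 g2.
rewrite mkspanD !span_prodE mkspanD; symmetry.
apply: (mkspan_eq (phi := gcopair
  (gprod_map (ginl B C) (gid A)) (gprod_map (ginr B C) (gid A)))).
- by move=> [[? ?]|[? ?]] [[? ?]|[? ?]] //= [] -> ->.
- by move=> [[b|b] a]; [exists (inl (b, a)) | exists (inr (b, a))].
- by move=> [[? ?]|[? ?]].
- by move=> [[? ?]|[? ?]].
Qed.

Lemma span_prodDr X Y X' Y' (c : spancls X X') :
  {morph (fun d : spancls Y Y' => span_prod c d) : d d' / d + d'}.
Proof.
elim/span_ind: c => A f g; elim/span_ind=> B f1 g1; elim/span_ind=> C f2 g2.
rewrite mkspanD !span_prodE mkspanD; symmetry.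
apply: (mkspan_eq (phi := gcopair
  (gprod_map (gid A) (ginl B C)) (gprod_map (gid A) (ginr B C)))).
- by move=> [[? ?]|[? ?]] [[? ?]|[? ?]] //= [] -> ->.
- by move=> [a [b|b]]; [exists (inl (a, b)) | exists (inr (a, b))].
- by move=> [[? ?]|[? ?]].
- by move=> [[? ?]|[? ?]].
Qed.

End Spans.

Section Burnside.
Variable gT : finGroupType.
Implicit Types X Y Z W : gset gT.

Definition burn X Y : zmodType := gcompl (spancls X Y).

Definition burn_id X : burn X X := gc_in (span_id X).

Definition burn_comp X Y Z (b : burn Y Z) (a : burn X Y) : burn X Z :=
  gc_lift2 (fun d c => gc_in (span_comp d c) : burn X Z) b a.

Definition burn_prod X Y X' Y' (a : burn X X') (b : burn Y Y') :
    burn (gprod X Y) (gprod X' Y') :=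
  gc_lift2 (fun c d => gc_in (span_prod c d) : burn _ _) a b.

Let comp_auxl X Y Z (c : spancls X Y) :
  {morph (fun d : spancls Y Z => gc_in (span_comp d c)) : d d' / d + d'}.
Proof. by move=> d d'; rewrite span_compDl gc_inD. Qed.

Let comp_auxr X Y Z (d : spancls Y Z) :
  {morph (fun c : spancls X Y => gc_in (span_comp d c)) : c c' / c + c'}.
Proof. by move=> c c'; rewrite span_compDr gc_inD. Qed.

Lemma burn_comp_in X Y Z (d : spancls Y Z) (c : spancls X Y) :
  burn_comp (gc_in d) (gc_in c) = gc_in (span_comp d c).
Proof. by apply: gc_lift2_in => ?; [apply: comp_auxl | apply: comp_auxr]. Qed.

Lemma burn_compDl X Y Z (a : burn X Y) :
  {morph (fun b : burn Y Z => burn_comp b a) : b b' / b + b'}.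
Proof. by apply: gc_lift2Dl => ?; apply: comp_auxl. Qed.

Lemma burn_compDr X Y Z (b : burn Y Z) :
  {morph (fun a : burn X Y => burn_comp b a) : a a' / a + a'}.
Proof. by apply: gc_lift2Dr => ?; apply: comp_auxr. Qed.

Lemma burn_ext X Y (V : zmodType) (f g : burn X Y -> V) :
    {morph f : x y / x + y} -> {morph g : x y / x + y} ->
  (forall c : spancls X Y, f (gc_in c) = g (gc_in c)) -> f =1 g.
Proof. exact: gc_in_ext. Qed.

Lemma burn_compA X Y Z W (c : burn Z W) (b : burn Y Z) (a : burn X Y) :
  burn_comp c (burn_comp b a) = burn_comp (burn_comp c b) a.
Proof.
move: c; apply: burn_ext => [x y|x y|c].
- exact: burn_compDl.
- by rewrite (burn_compDl b x y) (burn_compDl a (burn_comp x b) (burn_comp y b)).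
move: b; apply: burn_ext => [x y|x y|b].
- rewrite (burn_compDl a x y).
  exact: (burn_compDr (gc_in c) (burn_comp x a) (burn_comp y a)).
- rewrite (burn_compDr (gc_in c) x y).
  exact: (burn_compDl a (burn_comp (gc_in c) x) (burn_comp (gc_in c) y)).
move: a; apply: burn_ext => [x y|x y|a].
- rewrite (burn_compDr (gc_in b) x y).
  exact: (burn_compDr (gc_in c) (burn_comp (gc_in b) x) (burn_comp (gc_in b) y)).
- exact: (burn_compDr (burn_comp (gc_in c) (gc_in b)) x y).
by rewrite !burn_comp_in span_compA.
Qed.

Lemma burn_comp1l X Y (a : burn X Y) : burn_comp (burn_id Y) a = a.
Proof.
move: a; apply: burn_ext => [x y|//|a]; first exact: (burn_compDr (burn_id Y) x y).
by rewrite burn_comp_in span_comp1l.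
Qed.

Lemma burn_comp1r X Y (a : burn X Y) : burn_comp a (burn_id X) = a.
Proof.
move: a; apply: burn_ext => [x y|//|a]; first exact: (burn_compDl (burn_id X) x y).
by rewrite burn_comp_in span_comp1r.
Qed.

End Burnside.

Record mackey (gT : finGroupType) := Mackey {
  mk_obj :> gset gT -> zmodType;
  mk_map : forall X Y : gset gT, burn X Y -> mk_obj X -> mk_obj Y;
  mk_mapDr : forall X Y (a : burn X Y) (m m' : mk_obj X),
    mk_map a (m + m') = mk_map a m + mk_map a m';
  mk_mapDl : forall X Y (a b : burn X Y) (m : mk_obj X),
    mk_map (a + b) m = mk_map a m + mk_map b m;
  mk_map_id : forall X (m : mk_obj X), mk_map (burn_id X) m = m;
  mk_map_comp : forall X Y Z (b : burn Y Z) (a : burn X Y) (m : mk_obj X),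
    mk_map (burn_comp b a) m = mk_map b (mk_map a m) }.

Record mkhom (gT : finGroupType) (M N : mackey gT) := MkHom {
  mkhom_fun :> forall X : gset gT, M X -> N X;
  mkhomD : forall X (m m' : M X),
    mkhom_fun (m + m') = mkhom_fun m + mkhom_fun m';
  mkhom_nat : forall X Y (a : burn X Y) (m : M X),
    mkhom_fun (mk_map a m) = mk_map a (mkhom_fun m) }.

(* exactness of 0 -> L -> M -> N -> 0; it is computed levelwise *)
Definition short_exact (gT : finGroupType) (L M N : mackey gT)
    (i : mkhom L M) (p : mkhom M N) : Prop :=
  forall X : gset gT,
    [/\ injective (i X),
        forall m : M X, p X m = 0 <-> exists l : L X, i X l = m
      & forall n : N X, exists m : M X, p X m = n].

(* (M box N)(Z) is the coend of burn (X * Y) Z (x) M X (x) N Y over X and Y,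
   presented by generators and relations. The indices X and Y run over the
   finite G-sets carried by ordinals, a small full subcategory equivalent to
   that of all finite G-sets. *)
Section Box.
Variables (gT : finGroupType) (M N : mackey gT).

Inductive box_term (Z : gset gT) : Type :=
| BoxZero
| BoxAdd of box_term Z & box_term Z
| BoxOpp of box_term Z
| BoxGen (X Y : ordgset gT) of burn (gprod X Y) Z & M X & N Y.

Arguments BoxZero {Z}.

Inductive box_rel (Z : gset gT) : box_term Z -> box_term Z -> Prop :=
| box_refl x : box_rel x x
| box_sym x y : box_rel x y -> box_rel y x
| box_trans x y z : box_rel x y -> box_rel y z -> box_rel x z
| box_congD x x' y y' :
    box_rel x x' -> box_rel y y' -> box_rel (BoxAdd x y) (BoxAdd x' y')
| box_congN x x' : box_rel x x' -> box_rel (BoxOpp x) (BoxOpp x')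
| box_addA x y z : box_rel (BoxAdd x (BoxAdd y z)) (BoxAdd (BoxAdd x y) z)
| box_addC x y : box_rel (BoxAdd x y) (BoxAdd y x)
| box_add0 x : box_rel (BoxAdd BoxZero x) x
| box_addN x : box_rel (BoxAdd (BoxOpp x) x) BoxZero
| box_genD1 (X Y : ordgset gT) (a a' : burn (gprod X Y) Z) (m : M X) (n : N Y) :
    box_rel (BoxGen (a + a') m n) (BoxAdd (BoxGen a m n) (BoxGen a' m n))
| box_genD2 (X Y : ordgset gT) (a : burn (gprod X Y) Z) (m m' : M X) (n : N Y) :
    box_rel (BoxGen a (m + m') n) (BoxAdd (BoxGen a m n) (BoxGen a m' n))
| box_genD3 (X Y : ordgset gT) (a : burn (gprod X Y) Z) (m : M X) (n n' : N Y) :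
    box_rel (BoxGen a m (n + n')) (BoxAdd (BoxGen a m n) (BoxGen a m n'))
| box_coend (X Y X' Y' : ordgset gT) (a : burn (gprod X' Y') Z)
    (u : burn X X') (v : burn Y Y') (m : M X) (n : N Y) :
    box_rel (BoxGen (burn_comp a (burn_prod u v)) m n)
            (BoxGen a (mk_map u m) (mk_map v n)).

Definition box_setoid (Z : gset gT) : setoid :=
  Setoid (@box_refl Z) (@box_sym Z) (@box_trans Z).

Section Obj.
Variable Z : gset gT.

Definition box_quot : Type := quot (box_setoid Z).
HB.instance Definition _ := Choice.on box_quot.

Definition box_cls (x : box_term Z) : box_quot := cls (E := box_setoid Z) x.

Lemma box_clsP x y : box_cls x = box_cls y <-> box_rel x y.
Proof. exact: clsP. Qed.

Definition box_qzero : box_quot := box_cls BoxZero.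
Definition box_qadd (c d : box_quot) : box_quot :=
  box_cls (BoxAdd (rep c) (rep d)).
Definition box_qopp (c : box_quot) : box_quot := box_cls (BoxOpp (rep c)).

Lemma box_qaddE x y : box_qadd (box_cls x) (box_cls y) = box_cls (BoxAdd x y).
Proof. by apply/box_clsP; apply: box_congD; apply: (rep_cls (E := box_setoid Z)). Qed.

Lemma box_qoppE x : box_qopp (box_cls x) = box_cls (BoxOpp x).
Proof. by apply/box_clsP; apply: box_congN; apply: (rep_cls (E := box_setoid Z)). Qed.

Lemma box_ind_cls (P : box_quot -> Prop) : (forall x, P (box_cls x)) -> forall c, P c.
Proof. by move=> h c; rewrite -(repK c); apply: h. Qed.

Lemma box_qaddA : associative box_qadd.
Proof.
elim/box_ind_cls=> x; elim/box_ind_cls=> y; elim/box_ind_cls=> z.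
by rewrite !box_qaddE; apply/box_clsP; apply: box_addA.
Qed.

Lemma box_qaddC : commutative box_qadd.
Proof.
elim/box_ind_cls=> x; elim/box_ind_cls=> y.
by rewrite !box_qaddE; apply/box_clsP; apply: box_addC.
Qed.

Lemma box_qadd0 : left_id box_qzero box_qadd.
Proof.
by elim/box_ind_cls=> x; rewrite box_qaddE; apply/box_clsP; apply: box_add0.
Qed.

Lemma box_qaddN : left_inverse box_qzero box_qopp box_qadd.
Proof.
elim/box_ind_cls=> x; rewrite box_qoppE box_qaddE.
by apply/box_clsP; apply: box_addN.
Qed.

HB.instance Definition _ :=
  GRing.isZmodule.Build box_quot box_qaddA box_qaddC box_qadd0 box_qaddN.

Definition box_obj : zmodType := box_quot.

End Obj.

Fixpoint box_term_map Z Z' (b : burn Z Z') (x : box_term Z) : box_term Z' :=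
  match x with
  | BoxZero => BoxZero
  | BoxAdd y z => BoxAdd (box_term_map b y) (box_term_map b z)
  | BoxOpp y => BoxOpp (box_term_map b y)
  | BoxGen X Y a m n => BoxGen (burn_comp b a) m n
  end.

Lemma box_term_mapP Z Z' (b : burn Z Z') x y :
  box_rel x y -> box_rel (box_term_map b x) (box_term_map b y).
Proof.
elim=> {x y} /=.
- by move=> x; apply: box_refl.
- by move=> x y _; apply: box_sym.
- by move=> x y z _ xy _; apply: box_trans.
- by move=> x x' y y' _ xx' _; apply: box_congD.
- by move=> x x' _; apply: box_congN.
- by move=> x y z; apply: box_addA.
- by move=> x y; apply: box_addC.
- by move=> x; apply: box_add0.
- by move=> x; apply: box_addN.
- move=> X Y a a' m n; rewrite (burn_compDr b a a'); exact: box_genD1.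
- move=> X Y a m m' n; exact: box_genD2.
- move=> X Y a m n n'; exact: box_genD3.
- move=> X Y X' Y' a u v m n; rewrite burn_compA; exact: box_coend.
Qed.

Definition box_mk_map Z Z' (b : burn Z Z') (c : box_obj Z) : box_obj Z' :=
  box_cls (box_term_map b (rep c)).

Lemma box_mk_mapE Z Z' (b : burn Z Z') x :
  box_mk_map b (box_cls x) = box_cls (box_term_map b x).
Proof.
by apply/box_clsP; apply: box_term_mapP; apply: (rep_cls (E := box_setoid Z)).
Qed.

Lemma box_mk_mapDr Z Z' (b : burn Z Z') (c d : box_obj Z) :
  box_mk_map b (c + d) = box_mk_map b c + box_mk_map b d.
Proof.
elim/box_ind_cls: c => x; elim/box_ind_cls: d => y.
by rewrite [_ + _]box_qaddE !box_mk_mapE [RHS]box_qaddE.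
Qed.

Lemma box_mk_mapDl Z Z' (b b' : burn Z Z') (c : box_obj Z) :
  box_mk_map (b + b') c = box_mk_map b c + box_mk_map b' c.
Proof.
elim/box_ind_cls: c => x; rewrite !box_mk_mapE.
elim: x => [|x IHx y IHy|x IHx|X Y a m n] /=.
- by rewrite -[box_cls BoxZero]/(0 : box_obj Z') addr0.
- by rewrite -!box_qaddE IHx IHy; apply: addrACA.
- by rewrite -!box_qoppE IHx; apply: opprD.
- rewrite (burn_compDl a b b') [RHS]box_qaddE;
  by apply/box_clsP; apply: box_genD1.
Qed.

Lemma box_mk_map_id Z (c : box_obj Z) : box_mk_map (burn_id Z) c = c.
Proof.
elim/box_ind_cls: c => x; rewrite box_mk_mapE; congr box_cls.
by elim: x => //= [x -> y ->|x ->|X Y a m n] //; rewrite burn_comp1l.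
Qed.

Lemma box_mk_map_comp Z Z' Z'' (b : burn Z' Z'') (a : burn Z Z')
    (c : box_obj Z) :
  box_mk_map (burn_comp b a) c = box_mk_map b (box_mk_map a c).
Proof.
elim/box_ind_cls: c => x; rewrite !box_mk_mapE; congr box_cls.
by elim: x => //= [x -> y ->|x ->|X Y e m n] //; rewrite burn_compA.
Qed.

Definition box : mackey gT :=
  Mackey box_mk_mapDr box_mk_mapDl box_mk_map_id box_mk_map_comp.

End Box.

Arguments BoxZero {gT M N Z}.

Section BoxMap.
Variables (gT : finGroupType) (M M' : mackey gT) (f : mkhom M M').
Variable N : mackey gT.

Fixpoint box_hom_term Z (x : box_term M N Z) : box_term M' N Z :=
  match x with
  | BoxZero => BoxZero
  | BoxAdd y z => BoxAdd (box_hom_term y) (box_hom_term z)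
  | BoxOpp y => BoxOpp (box_hom_term y)
  | BoxGen X Y a m n => BoxGen a (f X m) n
  end.

Lemma box_hom_termP Z (x y : box_term M N Z) :
  box_rel x y -> box_rel (box_hom_term x) (box_hom_term y).
Proof.
elim=> {x y} /=.
- by move=> x; apply: box_refl.
- by move=> x y _; apply: box_sym.
- by move=> x y z _ xy _; apply: box_trans.
- by move=> x x' y y' _ xx' _; apply: box_congD.
- by move=> x x' _; apply: box_congN.
- by move=> x y z; apply: box_addA.
- by move=> x y; apply: box_addC.
- by move=> x; apply: box_add0.
- by move=> x; apply: box_addN.
- move=> X Y a a' m n; exact: box_genD1.
- move=> X Y a m m' n; rewrite mkhomD; exact: box_genD2.
- move=> X Y a m n n'; exact: box_genD3.
- move=> X Y X' Y' a u v m n; rewrite mkhom_nat; exact: box_coend.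
Qed.

Definition box_hom_fun Z (c : box M N Z) : box M' N Z :=
  box_cls (box_hom_term (rep c)).

Lemma box_hom_funE Z (x : box_term M N Z) :
  box_hom_fun (box_cls x) = box_cls (box_hom_term x).
Proof.
by apply/box_clsP; apply: box_hom_termP; apply: (rep_cls (E := box_setoid M N Z)).
Qed.

Lemma box_hom_funD Z (c d : box M N Z) :
  box_hom_fun (c + d) = box_hom_fun c + box_hom_fun d.
Proof.
elim/box_ind_cls: c => x; elim/box_ind_cls: d => y.
by rewrite [_ + _]box_qaddE !box_hom_funE [RHS]box_qaddE.
Qed.

Lemma box_hom_nat Z Z' (b : burn Z Z') (c : box M N Z) :
  box_hom_fun (mk_map b c) = mk_map b (box_hom_fun c).
Proof.
elim/box_ind_cls: c => x.
rewrite [mk_map b _]box_mk_mapE !box_hom_funE [RHS]box_mk_mapE; congr box_cls.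
by elim: x => //= [x -> y ->|x ->].
Qed.

Definition box_hom : mkhom (box M N) (box M' N) :=
  MkHom box_hom_funD box_hom_nat.

End BoxMap.

Definition flat (gT : finGroupType) (M : mackey gT) : Prop :=
  forall (K L N : mackey gT) (i : mkhom K L) (p : mkhom L N),
    short_exact i p -> short_exact (box_hom i M) (box_hom p M).

Section IndexingTheory.
Variables (gT : finGroupType) (O : indexing gT).
Implicit Types X Y Z A B : gset gT.

Lemma indexing_bij X Y (f : gmap X Y) : bijective f -> O _ _ f.
Proof.
move=> fb; have [g [fK gK]] := gmap_inv fb.
apply: (indexing_pullback (p := f) (g := gid Y) (k := gid Y)); last first.
  exact: indexing_id.
split=> [|W u v uv]; first by apply: gmap_eq.
have uv' w : u w = v w by have /(congr1 (fun h => gfun h w)) := uv.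
exists (gcomp g u); split.
  by split; apply: gmap_eq => w /=; rewrite gK.
by move=> w [<- _]; apply: gmap_eq => x; rewrite /= fK.
Qed.

Lemma indexing_gpb2 X Y Z (f : gmap X Z) (k : gmap Y Z) :
  O _ _ f -> O _ _ (gpb2 f k).
Proof. by move=> Of; apply: indexing_pullback (gpbP f k) Of. Qed.

Definition bool_fam X Y (b : bool) : gset gT := if b then X else Y.

Definition bool_inj X Y (b : bool) : gmap (bool_fam X Y b) (gsum X Y) :=
  match b with true => ginl X Y | false => ginr X Y end.

Lemma bool_coproduct X Y : is_coproduct (@bool_inj X Y).
Proof.
move=> Z f; exists (gcopair (f true) (f false)); split.
  by case; apply: gmap_eq.
move=> h hf; apply: gmap_eq => -[x|y] /=.
  by rewrite -(hf true).
by rewrite -(hf false).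
Qed.

Lemma indexing_sum X Y X' Y' (f : gmap X X') (g : gmap Y Y') :
  O _ _ f -> O _ _ g -> O _ _ (gsum_map f g).
Proof.
move=> Of Og; apply: (@indexing_copair _ O _ _ _ _ (@bool_coproduct X Y)) => b.
have inj := @indexing_inj _ O _ _ _ _ (@bool_coproduct X' Y').
have -> : gcomp (gsum_map f g) (bool_inj X Y b)
  = if b return gmap (bool_fam X Y b) (gsum X' Y')
    then gcomp (ginl X' Y') f else gcomp (ginr X' Y') g.
  by apply: gmap_eq; case: b.
by case: b; apply: indexing_comp => //; [exact: (inj true) | exact: (inj false)].
Qed.

End IndexingTheory.

(* T <- A -> B -> X with the middle map in O *)
Record bispan (gT : finGroupType) (O : indexing gT) (T X : gset gT) := BiSpan {
  bi_src : ordgset gT;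
  bi_tgt : ordgset gT;
  bi_res : gmap bi_src T;
  bi_norm : gmap bi_src bi_tgt;
  bi_tr : gmap bi_tgt X;
  bi_normP : O _ _ bi_norm }.

Section BiSpans.
Variables (gT : finGroupType) (O : indexing gT) (T : gset gT).
Implicit Types X Y Z A B : gset gT.

Definition bispan_iso X (S S' : bispan O T X) : Prop :=
  exists (phi : gmap (bi_src S) (bi_src S')) (psi : gmap (bi_tgt S) (bi_tgt S')),
    [/\ bijective phi /\ bijective psi,
        gcomp (bi_res S') phi = bi_res S,
        gcomp (bi_norm S') phi = gcomp psi (bi_norm S)
      & gcomp (bi_tr S') psi = bi_tr S].

Lemma bispan_iso_refl X (S : bispan O T X) : bispan_iso S S.
Proof.
by exists (gid _), (gid _); split; try exact: gmap_eq; split; exists id.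
Qed.

Lemma bispan_iso_sym X (S S' : bispan O T X) :
  bispan_iso S S' -> bispan_iso S' S.
Proof.
move=> [p [q [[pb qb] pf pg ph]]].
have [p' [pK p'K]] := gmap_inv pb; have [q' [qK q'K]] := gmap_inv qb.
exists p', q'; split.
- by split; [exists p | exists q].
- by apply: gmap_eq => x; rewrite -pf /= p'K.
- apply: gmap_eq => x /=; apply: (can_inj qK); rewrite q'K.
  by rewrite -[LHS]/(gcomp q (bi_norm S) (p' x)) -pg /= p'K.
- by apply: gmap_eq => x; rewrite -ph /= q'K.
Qed.

Lemma bispan_iso_trans X (S S' S'' : bispan O T X) :
  bispan_iso S S' -> bispan_iso S' S'' -> bispan_iso S S''.
Proof.
move=> [p [q [[pb qb] pf pg ph]]] [p' [q' [[pb' qb'] pf' pg' ph']]].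
exists (gcomp p' p), (gcomp q' q); split.
- by split; apply: bij_comp.
- by rewrite -pf -pf'; apply: gmap_eq.
- apply: gmap_eq => x.
  rewrite -[LHS]/(gcomp (bi_norm S'') p' (p x)) pg'.
  by rewrite -[LHS]/(q' (gcomp (bi_norm S') p x)) pg.
- by rewrite -ph -ph'; apply: gmap_eq.
Qed.

Definition bispan_setoid X : setoid :=
  Setoid (@bispan_iso_refl X) (@bispan_iso_sym X) (@bispan_iso_trans X).

(* the hom-set from T to X in the category of polynomials with exponents in O *)
Definition poly_hom X : Type := quot (bispan_setoid X).
HB.instance Definition _ X := Choice.on (poly_hom X).

Lemma mkpoly_subproof A B (g : gmap A B) : O _ _ g ->
  O _ _ (gcomp (rank_map B) (gcomp g (val_map A))).
Proof.
move=> Og; apply: indexing_comp; last apply: indexing_comp => //.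
  by apply: indexing_bij; exists (val_map B); [exact: rank_mapK | exact: val_mapK].
by apply: indexing_bij; exists (rank_map A); [exact: val_mapK | exact: rank_mapK].
Qed.

(* the class of a bispan T <- A -> B -> X with arbitrary A and B *)
Definition mkpoly X A B (f : gmap A T) (g : gmap A B) (h : gmap B X)
    (Og : O _ _ g) : poly_hom X :=
  cls (E := bispan_setoid X)
    (BiSpan (gcomp f (val_map A)) (gcomp h (val_map B)) (mkpoly_subproof Og)).

Lemma mkpoly_eq X A B A' B' (f : gmap A T) (g : gmap A B) (h : gmap B X)
    (Og : O _ _ g) (f' : gmap A' T) (g' : gmap A' B') (h' : gmap B' X)
    (Og' : O _ _ g') (phi : gmap A A') (psi : gmap B B') :
    injective phi -> (forall y, exists x, phi x = y) ->
    injective psi -> (forall y, exists x, psi x = y) ->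
    (forall x, f' (phi x) = f x) -> (forall x, g' (phi x) = psi (g x)) ->
    (forall x, h' (psi x) = h x) ->
  mkpoly f h Og = mkpoly f' h' Og'.
Proof.
move=> pi ps qi qs ef eg eh; apply/clsP.
have vb C : bijective (val_map C).
  by exists (rank_map C); [exact: val_mapK | exact: rank_mapK].
have rb C : bijective (rank_map C).
  by exists (val_map C); [exact: rank_mapK | exact: val_mapK].
exists (gcomp (rank_map A') (gcomp phi (val_map A))).
exists (gcomp (rank_map B') (gcomp psi (val_map B))); split.
- split; apply: bij_comp; try exact: rb.
    by apply: bij_comp; [exact: gmap_bij | exact: vb].
  by apply: bij_comp; [exact: gmap_bij | exact: vb].
- by apply: gmap_eq => x; rewrite /= enum_rankK ef.
- by apply: gmap_eq => x; rewrite /= !enum_rankK eg.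
- by apply: gmap_eq => x; rewrite /= enum_rankK eh.
Qed.

Lemma mkpoly_congr X A B (f f' : gmap A T) (g : gmap A B) (h h' : gmap B X)
    (Og Og' : O _ _ g) :
  f =1 f' -> h =1 h' -> mkpoly f h Og = mkpoly f' h' Og'.
Proof.
move=> /gmap_eq -> /gmap_eq ->; congr mkpoly; exact: Prop_irrelevance.
Qed.

Arguments mkpoly_eq {X A B A' B' f g h Og f' g' h' Og' phi psi}.

Lemma mkpoly_rep X (c : poly_hom X) :
  mkpoly (bi_res (rep c)) (bi_tr (rep c)) (bi_normP (rep c)) = c.
Proof.
rewrite -[RHS]repK; apply/clsP; exists (val_map _), (val_map _).
have vb C : bijective (val_map C).
  by exists (rank_map C); [exact: val_mapK | exact: rank_mapK].
split=> //; apply: gmap_eq => x //=; symmetry; exact: enum_rankK.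
Qed.

Lemma rep_mkpoly X A B (f : gmap A T) (g : gmap A B) (h : gmap B X)
    (Og : O _ _ g) (S := rep (mkpoly f h Og)) :
  exists (phi : gmap (bi_src S) A) (psi : gmap (bi_tgt S) B),
    [/\ injective phi /\ (forall y, exists x, phi x = y),
        injective psi /\ (forall y, exists x, psi x = y),
        forall x, f (phi x) = bi_res S x,
        forall x, g (phi x) = psi (bi_norm S x)
      & forall x, h (psi x) = bi_tr S x].
Proof.
have [p [q [[pb qb] pf pg ph]]] := rep_cls (E := bispan_setoid X)
  (BiSpan (gcomp f (val_map A)) (gcomp h (val_map B)) (mkpoly_subproof Og)).
exists (gcomp (val_map A) p), (gcomp (val_map B) q); split.
- split; first exact: inj_comp (can_inj (@val_mapK _ A)) (bij_inj pb).
  move=> y; have [x ex] := bij_surj pb (rank_map A y).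
  by exists x; rewrite /= ex; apply: rank_mapK.
- split; first exact: inj_comp (can_inj (@val_mapK _ B)) (bij_inj qb).
  move=> y; have [x ex] := bij_surj qb (rank_map B y).
  by exists x; rewrite /= ex; apply: rank_mapK.
- by move=> x; rewrite -[RHS]/(bi_res _ x) -pf.
- move=> x; have /(congr1 (fun u => val_map B (gfun u x))) := pg.
  by rewrite /= enum_rankK.
- by move=> x; rewrite -[RHS]/(bi_tr _ x) -ph.
Qed.

Lemma poly_ind X (P : poly_hom X -> Prop) :
    (forall A B (f : gmap A T) (g : gmap A B) (h : gmap B X) (Og : O _ _ g),
      P (mkpoly f h Og)) ->
  forall c, P c.
Proof. by move=> h c; rewrite -(mkpoly_rep c). Qed.

Definition poly_add X (c d : poly_hom X) : poly_hom X :=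
  mkpoly (gcopair (bi_res (rep c)) (bi_res (rep d)))
         (gcopair (bi_tr (rep c)) (bi_tr (rep d)))
         (indexing_sum (bi_normP (rep c)) (bi_normP (rep d))).

Definition poly_zero X : poly_hom X :=
  mkpoly (gempty_map T) (gempty_map X) (indexing_id O (gempty gT)).

Lemma poly_addE X A B A' B' (f : gmap A T) (g : gmap A B) (h : gmap B X)
    (Og : O _ _ g) (f' : gmap A' T) (g' : gmap A' B') (h' : gmap B' X)
    (Og' : O _ _ g') :
  poly_add (mkpoly f h Og) (mkpoly f' h' Og')
  = mkpoly (gcopair f f') (gcopair h h') (indexing_sum Og Og').
Proof.
have [p [q [[pi ps] [qi qs] pf pg ph]]] := rep_mkpoly f h Og.
have [p' [q' [[pi' ps'] [qi' qs'] pf' pg' ph']]] := rep_mkpoly f' h' Og'.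
apply: (mkpoly_eq (phi := gsum_map p p') (psi := gsum_map q q')).
- exact: gsum_map_inj.
- exact: gsum_map_surj.
- exact: gsum_map_inj.
- exact: gsum_map_surj.
- by case=> x /=.
- by case=> x /=; rewrite ?pg ?pg'.
- by case=> x /=.
Qed.

Definition gassoc A B C : gmap (gsum A (gsum B C)) (gsum (gsum A B) C) :=
  gcopair (gcomp (ginl _ _) (ginl A B))
    (gcopair (gcomp (ginl _ _) (ginr A B)) (ginr _ C)).

Lemma gassoc_inj A B C : injective (gassoc A B C).
Proof. by move=> [x|[x|x]] [y|[y|y]] //= [->]. Qed.

Lemma gassoc_surj A B C y : exists x, gassoc A B C x = y.
Proof.
by case: y => [[x|x]|x];
  [exists (inl x) | exists (inr (inl x)) | exists (inr (inr x))].
Qed.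

Lemma poly_addA X : associative (@poly_add X).
Proof.
elim/poly_ind=> A B f g h Og; elim/poly_ind=> A' B' f' g' h' Og'.
elim/poly_ind=> A'' B'' f'' g'' h'' Og''.
rewrite !poly_addE.
apply: (mkpoly_eq (phi := gassoc _ _ _) (psi := gassoc _ _ _)).
- exact: gassoc_inj.
- exact: gassoc_surj.
- exact: gassoc_inj.
- exact: gassoc_surj.
- by move=> [x|[x|x]].
- by move=> [x|[x|x]].
- by move=> [x|[x|x]].
Qed.

Definition gswap A B : gmap (gsum A B) (gsum B A) :=
  gcopair (ginr B A) (ginl B A).

Lemma gswap_inj A B : injective (gswap A B).
Proof. by move=> [x|x] [y|y] //= [->]. Qed.

Lemma gswap_surj A B y : exists x, gswap A B x = y.
Proof. by case: y => [x|x]; [exists (inr x) | exists (inl x)]. Qed.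

Lemma poly_addC X : commutative (@poly_add X).
Proof.
elim/poly_ind=> A B f g h Og; elim/poly_ind=> A' B' f' g' h' Og'.
rewrite !poly_addE; apply: (mkpoly_eq (phi := gswap _ _) (psi := gswap _ _)).
- exact: gswap_inj.
- exact: gswap_surj.
- exact: gswap_inj.
- exact: gswap_surj.
- by move=> [x|x].
- by move=> [x|x].
- by move=> [x|x].
Qed.

Lemma poly_add0 X : left_id (poly_zero X) (@poly_add X).
Proof.
elim/poly_ind=> A B f g h Og; rewrite poly_addE; symmetry.
apply: (mkpoly_eq (phi := ginr (gempty gT) A) (psi := ginr (gempty gT) B)) => //.
- by move=> x y [].
- by move=> [[]|x]; exists x.
- by move=> x y [].
- by move=> [[]|x]; exists x.
Qed.

HB.instance Definition _ X := GRing.isNmodule.Build (poly_hom X)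
  (@poly_addA X) (@poly_addC X) (@poly_add0 X).

Lemma mkpolyD X A B A' B' (f : gmap A T) (g : gmap A B) (h : gmap B X)
    (Og : O _ _ g) (f' : gmap A' T) (g' : gmap A' B') (h' : gmap B' X)
    (Og' : O _ _ g') :
  mkpoly f h Og + mkpoly f' h' Og'
  = mkpoly (gcopair f f') (gcopair h h') (indexing_sum Og Og').
Proof. exact: poly_addE. Qed.

(* postcomposition with T_k *)
Definition poly_tr X Y (k : gmap X Y) (c : poly_hom X) : poly_hom Y :=
  mkpoly (bi_res (rep c)) (gcomp k (bi_tr (rep c))) (bi_normP (rep c)).

(* postcomposition with R_k:
   R_k T_h N_g R_f = T_h' R_k' N_g R_f = T_h' N_g' R_k'' R_f,
   where k' : B * _X Y -> B and k'' : A * _B (B * _X Y) -> A *)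
Definition poly_res_mk X Y (k : gmap Y X) A B (f : gmap A T) (g : gmap A B)
    (h : gmap B X) (Og : O _ _ g) : poly_hom Y :=
  mkpoly (gcomp f (gpb1 g (gpb1 h k))) (gpb2 h k)
         (indexing_gpb2 (gpb1 h k) Og).

Definition poly_res X Y (k : gmap Y X) (c : poly_hom X) : poly_hom Y :=
  poly_res_mk k (bi_res (rep c)) (bi_tr (rep c)) (bi_normP (rep c)).

Lemma poly_trE X Y (k : gmap X Y) A B (f : gmap A T) (g : gmap A B)
    (h : gmap B X) (Og : O _ _ g) :
  poly_tr k (mkpoly f h Og) = mkpoly f (gcomp k h) Og.
Proof.
have [p [q [[pi ps] [qi qs] pf pg ph]]] := rep_mkpoly f h Og.
apply: (mkpoly_eq (phi := p) (psi := q)) => //.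
by move=> x /=; rewrite ph.
Qed.

Lemma poly_resE X Y (k : gmap Y X) A B (f : gmap A T) (g : gmap A B)
    (h : gmap B X) (Og : O _ _ g) :
  poly_res k (mkpoly f h Og) = poly_res_mk k f h Og.
Proof.
have [p [q [[pi ps] [qi qs] pf pg ph]]] := rep_mkpoly f h Og.
set S := rep (mkpoly f h Og) in p q pi ps qi qs pf pg ph *.
have e1 w : h (gcomp q (gpb1 (bi_tr S) k) w) = k (gpb2 (bi_tr S) k w).
  by rewrite /= ph; apply: (gpbE w).
set psi := gpb_pair e1.
have e2 w : g (gcomp p (gpb1 (bi_norm S) (gpb1 (bi_tr S) k)) w)
    = gpb1 h k (gcomp psi (gpb2 (bi_norm S) (gpb1 (bi_tr S) k)) w).
  rewrite -[LHS]/(g (p (gpb1 (bi_norm S) (gpb1 (bi_tr S) k) w))) pg.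
  by rewrite (gpbE w).
have psi_inj : injective psi.
  apply: gpb_pair_inj => x y /qi exy1 exy2.
  by apply: gpb_ext; [exact: exy1 | exact: exy2].
have psi_surj : forall y, exists x, psi x = y.
  apply: gpb_pair_surj => x y exy; have [b eb] := qs x.
  have [|w [w1 w2]] := @gpb_ex _ _ _ _ (bi_tr S) k b y; first by rewrite -ph eb.
  by exists w; rewrite -eb -w1.
apply: (mkpoly_eq (phi := gpb_pair e2) (psi := psi)) => //.
- apply: gpb_pair_inj => x y /pi exy1 /psi_inj exy2.
  by apply: gpb_ext; [exact: exy1 | exact: exy2].
- apply: gpb_pair_surj => x y exy; have [a ea] := ps x.
  have [b eb] := psi_surj y.
  have [|w [w1 w2]] := @gpb_ex _ _ _ _ (bi_norm S) (gpb1 (bi_tr S) k) a b.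
    by apply: qi; rewrite -pg ea exy -eb.
  exists w; split; first by rewrite -ea -w1.
  by rewrite -eb -w2.
- by move=> x; rewrite -[LHS]/(f (p (gpb1 _ _ x))) pf.
Qed.

Lemma poly_trD X Y (k : gmap X Y) : {morph @poly_tr X Y k : c d / c + d}.
Proof.
elim/poly_ind=> A B f g h Og; elim/poly_ind=> A' B' f' g' h' Og'.
rewrite mkpolyD !poly_trE mkpolyD.
apply: (mkpoly_eq (phi := gid _) (psi := gid _)) => //.
- by move=> y; exists y.
- by move=> y; exists y.
- by case.
Qed.

Lemma poly_resD X Y (k : gmap Y X) : {morph @poly_res X Y k : c d / c + d}.
Proof.
elim/poly_ind=> A B f g h Og; elim/poly_ind=> A' B' f' g' h' Og'.
rewrite mkpolyD !poly_resE [RHS]mkpolyD; symmetry.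
have e1 w : gcopair h h' (gsum_map (gpb1 h k) (gpb1 h' k) w)
    = k (gcopair (gpb2 h k) (gpb2 h' k) w) by case: w => w; apply: (gpbE w).
set psi := gpb_pair e1.
have e2 w : gsum_map g g' (gsum_map (gpb1 g (gpb1 h k)) (gpb1 g' (gpb1 h' k)) w)
    = gpb1 (gcopair h h') k
        (gcomp psi (gsum_map (gpb2 g (gpb1 h k)) (gpb2 g' (gpb1 h' k))) w).
  by case: w => w; rewrite /= -?[g _](gpbE w) -?[g' _](gpbE w);
    congr (_ _); apply: (gpbE w).
have psi_inj : injective psi.
  apply: gpb_pair_inj => -[x|x] [y|y] //= [] h1 h2; congr (_ _).
  - by apply: gpb_ext; [exact: h1 | exact: h2].
  - by apply: gpb_ext; [exact: h1 | exact: h2].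
have psi_surj : forall y, exists x, psi x = y.
  apply: gpb_pair_surj => -[x|x] y /= exy.
  - by have [w [<- <-]] := gpb_ex exy; exists (inl w).
  - by have [w [<- <-]] := gpb_ex exy; exists (inr w).
apply: (mkpoly_eq (phi := gpb_pair e2) (psi := psi)) => //.
- apply: gpb_pair_inj => -[x|x] [y|y] //= [] h1 /psi_inj [] h2; congr (_ _).
  - by apply: gpb_ext; [exact: h1 | exact: h2].
  - by apply: gpb_ext; [exact: h1 | exact: h2].
- apply: gpb_pair_surj => x y; have [b <-] := psi_surj y.
  case: x b => [x|x] [b|b] //= [] exy.
  - by have [w [<- <-]] := gpb_ex (g := gpb1 h k) exy; exists (inl w).
  - by have [w [<- <-]] := gpb_ex (g := gpb1 h' k) exy; exists (inr w).
- by case.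
Qed.

Lemma poly_tr_comp X Y Z (k' : gmap Y Z) (k : gmap X Y) (c : poly_hom X) :
  poly_tr (gcomp k' k) c = poly_tr k' (poly_tr k c).
Proof.
elim/poly_ind: c => A B f g h Og; rewrite !poly_trE.
exact: mkpoly_congr.
Qed.

Lemma poly_tr_id X (c : poly_hom X) : poly_tr (gid X) c = c.
Proof.
elim/poly_ind: c => A B f g h Og; rewrite !poly_trE.
exact: mkpoly_congr.
Qed.

Lemma poly_res_mk_eq X Y (k : gmap Y X) A B (f : gmap A T) (g : gmap A B)
    (h : gmap B X) (Og : O _ _ g) A' B' (g' : gmap A' B') (Og' : O _ _ g')
    (h' : gmap B' Y) (u : gmap A' A) (v : gmap B' B) :
    (forall x, h (v x) = k (h' x)) -> (forall x, g (u x) = v (g' x)) ->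
    (forall x y, v x = v y -> h' x = h' y -> x = y) ->
    (forall b y, h b = k y -> exists x, v x = b /\ h' x = y) ->
    (forall x y, u x = u y -> g' x = g' y -> x = y) ->
    (forall a b, g a = v b -> exists x, u x = a /\ g' x = b) ->
  poly_res_mk k f h Og = mkpoly (gcomp f u) h' Og'.
Proof.
move=> e1 eg vi vs ui us; symmetry.
set psi := gpb_pair e1.
have e2 w : g (u w) = gpb1 h k (gcomp psi g' w) by rewrite eg.
have psi_inj : injective psi by apply: gpb_pair_inj.
have psi_surj : forall y, exists x, psi x = y by apply: gpb_pair_surj.
apply: (mkpoly_eq (phi := gpb_pair e2) (psi := psi)) => //.
- by apply: gpb_pair_inj => x y h1 /psi_inj; apply: ui.
- apply: gpb_pair_surj => x y; have [b <-] := psi_surj y.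
  by move=> /us [w [w1 w2]]; exists w; split=> //; rewrite -w2.
Qed.

Lemma poly_res_id X (c : poly_hom X) : poly_res (gid X) c = c.
Proof.
elim/poly_ind: c => A B f g h Og; rewrite poly_resE.
rewrite (poly_res_mk_eq f Og Og (u := gid A) (v := gid B) (h' := h)) //.
- exact: mkpoly_congr.
- by move=> b y e; exists b.
- by move=> a b e; exists a.
Qed.

Lemma poly_res_comp X Y Z (k : gmap Y X) (k' : gmap Z Y) (c : poly_hom X) :
  poly_res (gcomp k k') c = poly_res k' (poly_res k c).
Proof.
elim/poly_ind: c => A B f g h Og; rewrite poly_resE [poly_res k _]poly_resE.
rewrite [poly_res_mk k _ _ _]/poly_res_mk poly_resE [RHS]/poly_res_mk.
set P := gpb1 h k; set Q := gpb1 _ k'.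
have := indexing_gpb2 Q (indexing_gpb2 P Og); set g' := gpb2 _ Q => Og'.
rewrite (poly_res_mk_eq f Og Og' (k := gcomp k k')
  (u := gcomp (gpb1 g P) (gpb1 (gpb2 g P) Q)) (v := gcomp P Q)
  (h' := gpb2 (gpb2 h k) k')).
- exact: mkpoly_congr.
- move=> x; rewrite -[LHS]/(h (P (Q x))) [LHS](gpbE (Q x)).
  by rewrite -[RHS]/(k (k' _)) -(gpbE x).
- move=> x; rewrite -[LHS]/(g (gpb1 g P (gpb1 (gpb2 g P) Q x))).
  by rewrite (gpbE (gpb1 (gpb2 g P) Q x)) (gpbE x).
- move=> x y h1 h2; apply: gpb_ext => //; apply: gpb_ext => //.
  by rewrite (gpbE x) (gpbE y) h2.
- move=> b y /= hb; have [p [p1 p2]] := gpb_ex hb.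
  have [x [x1 x2]] := gpb_ex p2; exists x; split=> //.
  by rewrite -p1 -x1.
- move=> x y h1 h2; apply: gpb_ext => //; apply: gpb_ext => //.
  by rewrite (gpbE x) (gpbE y) -/g' h2.
- move=> a b hb; have [p [p1 p2]] := gpb_ex (g := P) hb.
  have [x [x1 x2]] := gpb_ex (f := gpb2 g P) p2; exists x; split=> //.
  by rewrite -p1 -x1.
Qed.

Lemma poly_res_tr X Y Z (r : gmap X Y) (l : gmap Z Y) (c : poly_hom X) :
  poly_res l (poly_tr r c) = poly_tr (gpb2 r l) (poly_res (gpb1 r l) c).
Proof.
elim/poly_ind: c => A B f g h Og; rewrite poly_trE !poly_resE poly_trE.
set P := gpb1 h _.
rewrite (poly_res_mk_eq f Og (indexing_gpb2 P Og) (k := l) (u := gpb1 g P) (v := P)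
  (h' := gcomp (gpb2 r l) (gpb2 h (gpb1 r l)))) //.
- by move=> x; rewrite -[LHS]/(r (h (P x))) (gpbE x) [LHS](gpbE (gpb2 _ _ x)).
- by move=> x; exact: (gpbE x).
- move=> x y h1 h2; apply: gpb_ext => //; apply: gpb_ext => //.
  by rewrite -(gpbE x) -(gpbE y) -/P h1.
- move=> b y hb; have [p [p1 p2]] := gpb_ex (f := r) hb.
  have [x [x1 x2]] := gpb_ex (esym p1); exists x; split=> //.
  by rewrite -p2 -x2.
- by move=> x y h1 h2; apply: gpb_ext.
- by move=> a b hb; apply: gpb_ex.
Qed.

Lemma poly_tr_res X Y (k : gmap X Y) (c : poly_hom Y) : bijective k ->
  poly_tr k (poly_res k c) = c.
Proof.
move=> kb; have [k' [kK k'K]] := gmap_inv kb.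
elim/poly_ind: c => A B f g h Og; rewrite poly_resE.
rewrite (poly_res_mk_eq f Og Og (u := gid A) (v := gid B) (h' := gcomp k' h)) //.
- by rewrite poly_trE; apply: mkpoly_congr => x //=; rewrite k'K.
- by move=> x; rewrite /= k'K.
- by move=> b y hb; exists b; split=> //; rewrite /= hb kK.
- by move=> a b e; exists a.
Qed.

(* postcomposition with the span X <- S -> Y, i.e. with T_(rleg) R_(lleg) *)
Definition poly_act X Y (s : spancls X Y) (c : poly_hom X) : poly_hom Y :=
  poly_tr (rleg (rep s)) (poly_res (lleg (rep s)) c).

Lemma poly_actE X Y S (l : gmap S X) (r : gmap S Y) (c : poly_hom X) :
  poly_act (mkspan l r) c = poly_tr r (poly_res l c).
Proof.
have [p [pi ps pl pr]] := rep_mkspan l r.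
rewrite /poly_act -(gmap_eq (f := gcomp l p) pl) -(gmap_eq (f := gcomp r p) pr).
by rewrite poly_tr_comp poly_res_comp poly_tr_res //; apply: gmap_bij.
Qed.

Lemma poly_actDr X Y (s : spancls X Y) :
  {morph (fun c : poly_hom X => poly_act s c) : c d / c + d}.
Proof. by move=> c d; rewrite /poly_act poly_resD poly_trD. Qed.

Lemma poly_actDl X Y (c : poly_hom X) :
  {morph (fun s : spancls X Y => poly_act s c) : s t / s + t}.
Proof.
elim/span_ind=> S l r; elim/span_ind=> S' l' r'.
rewrite mkspanD !poly_actE; elim/poly_ind: c => A B f g h Og.
rewrite !poly_resE; set P := gpb1 h l; set P' := gpb1 h l'.
rewrite (poly_res_mk_eq f Og
  (indexing_sum (indexing_gpb2 P Og) (indexing_gpb2 P' Og))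
  (u := gcopair (gpb1 g P) (gpb1 g P')) (v := gcopair P P')
  (h' := gsum_map (gpb2 h l) (gpb2 h l'))).
- by rewrite !poly_trE mkpolyD; apply: mkpoly_congr; case.
- by case=> x; apply: (gpbE x).
- by case=> x; apply: (gpbE x).
- by move=> [x|x] [y|y] //= h1 [h2]; congr (_ _); apply: gpb_ext.
- move=> b [y|y] hy.
  + by have [x [x1 x2]] := gpb_ex (g := l) hy; exists (inl x); rewrite /= -x1 -x2.
  + by have [x [x1 x2]] := gpb_ex (g := l') hy; exists (inr x); rewrite /= -x1 -x2.
- by move=> [x|x] [y|y] //= h1 [h2]; congr (_ _); apply: gpb_ext.
- move=> a [y|y] hy.
  + by have [x [x1 x2]] := gpb_ex (g := P) hy; exists (inl x); rewrite /= -x1 -x2.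
  + by have [x [x1 x2]] := gpb_ex (g := P') hy; exists (inr x); rewrite /= -x1 -x2.
Qed.

Lemma poly_act_id X (c : poly_hom X) : poly_act (span_id X) c = c.
Proof. by rewrite poly_actE poly_tr_id poly_res_id. Qed.

Lemma poly_act_comp X Y Z (t : spancls Y Z) (s : spancls X Y) (c : poly_hom X) :
  poly_act (span_comp t s) c = poly_act t (poly_act s c).
Proof.
elim/span_ind: t => B l' r'; elim/span_ind: s => A l r.
rewrite span_compE !poly_actE poly_tr_comp poly_res_comp.
by rewrite poly_res_tr.
Qed.

Definition free_obj X : zmodType := gcompl (poly_hom X).

Definition free_map X Y (a : burn X Y) (c : free_obj X) : free_obj Y :=
  gc_lift2 (fun s p => gc_in (poly_act s p) : free_obj Y) a c.

Let act_auxl X Y (c : poly_hom X) :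
  {morph (fun s : spancls X Y => gc_in (poly_act s c)) : s t / s + t}.
Proof. by move=> s t; rewrite poly_actDl gc_inD. Qed.

Let act_auxr X Y (s : spancls X Y) :
  {morph (fun c : poly_hom X => gc_in (poly_act s c)) : c d / c + d}.
Proof. by move=> c d; rewrite poly_actDr gc_inD. Qed.

Lemma free_map_in X Y (s : spancls X Y) (p : poly_hom X) :
  free_map (gc_in s) (gc_in p) = gc_in (poly_act s p).
Proof. by apply: gc_lift2_in => ?; [apply: act_auxl | apply: act_auxr]. Qed.

Lemma free_mapDr X Y (a : burn X Y) (c d : free_obj X) :
  free_map a (c + d) = free_map a c + free_map a d.
Proof. by apply: gc_lift2Dr => ?; apply: act_auxr. Qed.

Lemma free_mapDl X Y (a b : burn X Y) (c : free_obj X) :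
  free_map (a + b) c = free_map a c + free_map b c.
Proof.
exact: (gc_lift2Dl (f := fun s p => gc_in (poly_act s p) : free_obj Y)
  (fun p => @act_auxl X Y p) c a b).
Qed.

Lemma free_ext X (V : zmodType) (f g : free_obj X -> V) :
    {morph f : x y / x + y} -> {morph g : x y / x + y} ->
  (forall p : poly_hom X, f (gc_in p) = g (gc_in p)) -> f =1 g.
Proof. exact: gc_in_ext. Qed.

Lemma free_map_id X (c : free_obj X) : free_map (burn_id X) c = c.
Proof.
move: c; apply: free_ext => [x y|//|p]; first exact: free_mapDr.
by rewrite free_map_in poly_act_id.
Qed.

Lemma free_map_comp X Y Z (b : burn Y Z) (a : burn X Y) (c : free_obj X) :
  free_map (burn_comp b a) c = free_map b (free_map a c).
Proof.
move: b; apply: burn_ext => [x y|x y|t].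
- by rewrite (burn_compDl a x y) (free_mapDl (burn_comp x a) (burn_comp y a)).
- exact: free_mapDl.
move: a; apply: burn_ext => [x y|x y|s].
- rewrite (burn_compDr (gc_in t) x y).
  exact: (free_mapDl (burn_comp (gc_in t) x) (burn_comp (gc_in t) y)).
- by rewrite (free_mapDl x y) (free_mapDr (gc_in t) (free_map x c) (free_map y c)).
move: c; apply: free_ext => [x y|x y|p].
- exact: free_mapDr.
- rewrite (free_mapDr (gc_in s) x y).
  exact: (free_mapDr (gc_in t) (free_map (gc_in s) x) (free_map (gc_in s) y)).
by rewrite burn_comp_in !free_map_in poly_act_comp.
Qed.

(* The underlying Mackey functor of the free O-Tambara functor on a generator
   at level T. It only involves postcomposition with restrictions and
   transfers, so the rule for N_h T_g does not enter. *)
Definition free_tambara : mackey gT :=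
  Mackey free_mapDr free_mapDl free_map_id free_map_comp.

End BiSpans.

(* Main.v *)
From HB Require Import structures.
From mathcomp Require Import all_boot all_algebra all_fingroup all_solvable.
From mathcomp Require Import boolp.
Require Import Defs.

Set Implicit Arguments.
Unset Strict Implicit.
Unset Printing Implicit Defensive.

Import GRing.Theory.

(** Write T = G/H and let M be the Mackey functor underlying the free functor
    on a generator at level T.  A class in M(Y) is a formal difference of bispans
    T <- C -> B -> Y, and the value of N box M at a point is the colimit of the
    groups N(B), along transfers, over all pairs of a finite G-set B and a map
    C -> B of O decorated by a map C -> T.  So flatness of M says that these
    colimits preserve injections of Mackey functors N.

    One family of injections suffices.  Let Q be normal in P with |P : Q| = q
    prime, let L(X) be the group of functions X^Q -> Z/q, with restrictions given
    by pulling back and transfers by summing over fibres, and let K be the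
    subfunctor of P-invariant functions.  In L box M two relations hold.

    - If y in Y is fixed by P and k : G/Q -> Y hits y, the indicator of y is a
      transfer along k, so its product with n in M(Y) depends on k^* n only.
    - If y in Y^Q is not fixed by P and n in M(Y) is invariant under P, then the
      product of n with the indicator of the P-orbit of y is a sum of q equal
      terms, hence 0.

    For flat M both relations already hold in K box M.  There they can be tested
    against functionals: a mark of M counts the points b of B above y whose fibre
    C_b has a prescribed shape, and pairing invariant functions with marks defines
    a functional on K box M (lemma [detect]).  The result is two closure
    properties of O.

    - [fixed_fibre_step]: if g : C -> B is in O and lies over T, if P fixes b and
      Q acts trivially on the fibre C_b, then so does P.  Otherwise C and the
      bispan whose fibre over b is C_b with trivial action would agree after
      restriction to Q, while the mark counting fibres with trivial P-action
      separates them.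
    - [orbit_proj_step]: if G/Q x T -> G/Q is in O, so is G/P x T -> G/P.
      Otherwise T <- G/Q x T -> G/Q is a P-invariant class that is not restricted
      from any class over a P-fixed point, and the mark counting fibres that map
      bijectively to T takes on it a value that is not killed by q in Z/q^2.

    Since H fixes a point of T, induction on the order of h in H turns the first
    property into [fibre_fixed]: an element of H fixing g(c) fixes c.  So the
    restriction of O to H is trivial, because stabilizer-preserving maps lie in
    every indexing category.  The
    two properties together, for the cyclic subgroups of H, show that H acts
    trivially on G/H, which is normality.  If G/H is solvable, climbing from H to
    G through normal subgroups of prime index with the second property puts
    G/G x T -> G/G in O, and this map is G/H -> G/G. *)

Lemma sum_bij_in (V : nmodType) (I J : finType) (P : pred I) (Q : pred J)
    (u : I -> J) (F : J -> V) :
    (forall i, P i -> Q (u i)) -> {in P &, injective u} ->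
    (forall j, Q j -> exists2 i, P i & u i = j) ->
  (\sum_(j | Q j) F j = \sum_(i | P i) F (u i))%R.
Proof.
move=> PQ uinj usurj; rewrite -(big_imset F uinj); apply: eq_bigl => j.
apply/idP/imsetP => [/usurj[i Pi <-]|[i Pi ->]]; first by exists i.
exact: PQ.
Qed.

(** * Indexing categories *)
Section Indexing.
Variable gT : finGroupType.
Implicit Types (X Y Z A B C D : gset gT) (O : indexing gT).

Lemma indexing_square O A B C D (u : gmap A B) (f : gmap A C) (g : gmap B D)
    (k : gmap C D) :
    (forall x, g (u x) = k (f x)) ->
    (forall x y, u x = u y -> f x = f y -> x = y) ->
    (forall b c, g b = k c -> exists x, u x = b /\ f x = c) ->
  O _ _ g -> O _ _ f.
Proof.
move=> sq uf_inj uf_surj Og.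
have -> : f = gcomp (gpb2 g k) (gpb_pair sq) by apply: gmap_eq.
apply: indexing_comp; first exact: indexing_gpb2.
by apply/indexing_bij/gmap_bij; [apply: gpb_pair_inj | apply: gpb_pair_surj].
Qed.

Section Sub.
Variables (X : gset gT) (D : pred X).
Hypothesis DP : forall x a, D x -> D (gact X x a).

Definition gsub_act (x : {x : X | D x}) a : {x : X | D x} :=
  exist _ (gact X (val x) a) (DP a (valP x)).

Fact gsub_act1 x : gsub_act x 1%g = x.
Proof. by apply: val_inj; rewrite /= act1. Qed.

Fact gsub_actM x : act_morph gsub_act x.
Proof. by move=> a b; apply: val_inj; rewrite /= actM. Qed.

Definition gsub : gset gT := GSet (TotalAction gsub_act1 gsub_actM).

Definition gsub_val : gmap gsub X := @GMap gT gsub X val (fun _ _ => erefl).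
End Sub.

(** The target is the coproduct of the image and its complement, and coproduct
    inclusions are in [O]. *)
Lemma indexing_injective O X Y (f : gmap X Y) : injective f -> O _ _ f.
Proof.
move=> f_inj.
have DP y a : y \notin codom f -> gact Y y a \notin codom f.
  apply: contra => /codomP[x ex]; apply/codomP; exists (gact X x a^-1%g).
  by rewrite gfunP -ex actK.
have -> : f = gcomp (gcopair f (gsub_val DP)) (ginl X (gsub DP)).
  exact: gmap_eq.
apply: indexing_comp; last exact: (@indexing_inj _ O _ _ _ _ (@bool_coproduct _ X (gsub DP)) true).
apply/indexing_bij/gmap_bij => [[x|[y Dy]] [x'|[y' Dy']] /=|y].
- by move/f_inj->.
- by move=> e; case/codomP: Dy'; exists x.
- by move=> e; case/codomP: Dy; exists x'.
- by move=> e; congr inr; apply: val_inj.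
- have [/codomP[x ->]|Dy] := boolP (y \in codom f); first by exists (inl x).
  by exists (inr (exist _ y Dy)).
Qed.

Section Fibres.
Variables (I : finType) (X : gset gT) (pr : X -> I).
Hypothesis prP : forall x a, pr (gact X x a) = pr x.

Fact fibreP i x a : pr x == i -> pr (gact X x a) == i.
Proof. by rewrite prP. Qed.

Lemma fibre_coproduct : is_coproduct (fun i => gsub_val (@fibreP i)).
Proof.
move=> Z f; pose h x := f (pr x) (exist _ x (eqxx (pr x))).
have hE i (z : gsub (@fibreP i)) : f i z = h (val z).
  by case: z => x /= xi; have e := eqP xi; subst i; rewrite /h /= (bool_irrelevance xi (eqxx _)).
have hP x a : h (gact X x a) = gact Z (h x) a by rewrite -gfunP hE.
exists (GMap hP); split=> [i|h' hh']; first by apply: gmap_eq => z /=; rewrite hE.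
by apply: gmap_eq => x; rewrite /= /h -hh'.
Qed.
End Fibres.

Lemma trivial_indexingP X Y (f : gmap X Y) :
  trivial_indexing f <-> forall x a, gact Y (f x) a = f x -> gact X x a = x.
Proof.
split=> [ft x a fxa|ft x]; first by apply/astab1P; rewrite ft; apply/astab1P.
apply/setP=> a; apply/astab1P/astab1P => [xa|/ft//].
by rewrite -gfunP xa.
Qed.

(** A stabilizer-preserving map is injective on each orbit, and its source is the
    coproduct of its orbits. *)
Lemma indexing_trivial O X Y (f : gmap X Y) : trivial_indexing f -> O _ _ f.
Proof.
move/trivial_indexingP=> ft; pose pr x := orbit (gact X) [set: gT] x.
have prP x a : pr (gact X x a) = pr x by apply: orbit_act; rewrite inE.
apply: (@indexing_copair _ O _ _ _ _ (@fibre_coproduct _ X pr prP)) => i.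
apply: indexing_injective => -[x xi] [y yi] /= fxy; apply: val_inj => /=.
have /orbitP[a _ xay] : y \in pr x by rewrite (eqP xi) -(eqP yi) orbit_refl.
by rewrite -xay ft // -gfunP xay.
Qed.

Definition gtriv (F : finType) : gset gT :=
  GSet (TotalAction (to := fun (x : F) (_ : gT) => x)
    (fun _ => erefl) (fun _ _ _ => erefl)).

Definition gfst X Y : gmap (gprod X Y) X := @GMap gT (gprod X Y) X fst (fun _ _ => erefl).
Definition gsnd X Y : gmap (gprod X Y) Y := @GMap gT (gprod X Y) Y snd (fun _ _ => erefl).

Definition gpair X Y Z (f : gmap Z X) (g : gmap Z Y) : gmap Z (gprod X Y).
Proof.
by exists (fun z => (f z, g z)) => z a; rewrite !gfunP.
Defined.

Lemma indexing_prodr O X Y Z (f : gmap X Y) : O _ _ f -> O _ _ (gprod_map f (gid Z)).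
Proof.
apply: (indexing_square (u := gfst X Z) (k := gfst Y Z)) => //.
- by move=> [x z] [x' z'] /= -> /(congr1 snd) /= ->.
- by move=> b [y z] /= <-; exists (b, z).
Qed.

End Indexing.

(** * Fixed points and maps out of orbits *)
Section Fixed.
Variables (gT : finGroupType) (Q : {set gT}).
Implicit Types (X Y Z : gset gT).

Definition fixb X (x : X) : bool := [forall a in Q, gact X x a == x].

Lemma fixbP X (x : X) : reflect (forall a, a \in Q -> gact X x a = x) (fixb x).
Proof. by apply: (iffP forall_inP) => h a /h => [/eqP|->]. Qed.

Lemma fixb_map X Y (f : gmap X Y) x : fixb x -> fixb (f x).
Proof. by move/fixbP=> h; apply/fixbP=> a /h xa; rewrite -gfunP xa. Qed.

End Fixed.

Section OrbitMap.
Variables (gT : finGroupType) (Q : {group gT}).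
Implicit Types (X Y Z : gset gT).

Fact orbit_pt_subproof : (Q : {set gT}) \in rcosets Q [set: gT].
Proof. by rewrite -{1}(rcoset1 Q) mem_rcosets mulSGid ?subsetT ?inE. Qed.
Definition orbit_pt : orbit_gset Q := exist _ (Q : {set gT}) orbit_pt_subproof.

Lemma orbit_ptE (A : orbit_gset Q) a :
  a \in val A -> A = gact (orbit_gset Q) orbit_pt a.
Proof.
move=> Aa; apply: val_inj => /=; case: A Aa => _ /= /rcosetsP[b _ ->] ab.
by rewrite (rcoset_eqP ab).
Qed.

Lemma orbit_ptP (A : orbit_gset Q) : exists a, A = gact (orbit_gset Q) orbit_pt a.
Proof.
have /rcosetsP[a _ eA] := valP A; exists a; apply: orbit_ptE.
by rewrite eA rcoset_refl.
Qed.

Lemma orbit_pt_fix a :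
  (gact (orbit_gset Q) orbit_pt a == orbit_pt) = (a \in Q).
Proof.
apply/eqP/idP => [/(congr1 val) /= <-|Qa]; first exact: rcoset_refl.
by apply: val_inj; rewrite /= rcoset_id.
Qed.

Section Map.
Variables (X : gset gT) (x : X).
Hypothesis xQ : fixb Q x.

(** The choice of a representative of the coset is immaterial, as x is fixed by Q. *)
Definition orbit_map_fun (A : orbit_gset Q) : X := gact X x (repr (val A)).

Lemma orbit_map_act a : orbit_map_fun (gact (orbit_gset Q) orbit_pt a) = gact X x a.
Proof.
rewrite /orbit_map_fun /=; have [b /(fixbP _ _ xQ) xb] := repr_rcosetP Q a.
by rewrite actM xb.
Qed.

Fact orbit_map_subproof A a :
  orbit_map_fun (gact (orbit_gset Q) A a) = gact X (orbit_map_fun A) a.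
Proof. by have [b ->] := orbit_ptP A; rewrite -actM !orbit_map_act actM. Qed.

Definition orbit_map : gmap (orbit_gset Q) X := GMap orbit_map_subproof.

Lemma orbit_map_pt : orbit_map orbit_pt = x.
Proof. by rewrite -(act1 (gact (orbit_gset Q)) orbit_pt) [LHS]orbit_map_act act1. Qed.

End Map.
End OrbitMap.

(** * Functions on fixed points as a Mackey functor *)
Section MarkFunctor.
Local Open Scope ring_scope.
Variables (gT : finGroupType) (Q : {set gT}).
Implicit Types (X Y Z : gset gT).

Definition fixT X : finType := {x : X | fixb Q x}.

Definition fixed_pt X (x : X) (xQ : fixb Q x) : fixT X :=
  exist (fun x : X => fixb Q x) x xQ.

Definition fix_map X Y (f : gmap X Y) (x : fixT X) : fixT Y :=
  exist _ (f (val x)) (fixb_map f (valP x)).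

Lemma fix_map_comp X Y Z (g : gmap Y Z) (f : gmap X Y) x :
  fix_map (gcomp g f) x = fix_map g (fix_map f x).
Proof. exact: val_inj. Qed.

Lemma fix_map_id X x : fix_map (gid X) x = x.
Proof. exact: val_inj. Qed.

Lemma fix_map_inj X Y (f : gmap X Y) : injective f -> injective (fix_map f).
Proof. by move=> fi x y /(congr1 val) /fi /val_inj. Qed.

Lemma fix_map_square X Y Z W (u : gmap W X) (v : gmap W Y) (f : gmap X Z)
    (g : gmap Y Z) :
    (forall x y, u x = u y -> v x = v y -> x = y) ->
    (forall x y, f x = g y -> exists w, u w = x /\ v w = y) ->
  forall x y, fix_map f x = fix_map g y ->
    exists w, fix_map u w = x /\ fix_map v w = y.
Proof.
move=> ui us [x xQ] [y yQ] /(congr1 val) /= /us [w [wx wy]].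
suff wQ : fixb Q w by exists (exist _ w wQ); split; apply: val_inj.
by apply/fixbP=> a Qa; apply: ui; rewrite gfunP ?wx ?wy ?(fixbP _ _ xQ) ?(fixbP _ _ yQ).
Qed.

Variable V : zmodType.

Definition fun_obj X : zmodType := {ffun fixT X -> V}.
Definition fun_res X Y (l : gmap X Y) (f : fun_obj Y) : fun_obj X :=
  [ffun x => f (fix_map l x)].
Definition fun_tr X Y (r : gmap X Y) (f : fun_obj X) : fun_obj Y :=
  [ffun y => \sum_(x | fix_map r x == y) f x].

Lemma fun_resD X Y (l : gmap X Y) : {morph @fun_res X Y l : f g / f + g}.
Proof. by move=> f g; apply/ffunP=> x; rewrite !ffunE. Qed.

Lemma fun_trD X Y (r : gmap X Y) : {morph @fun_tr X Y r : f g / f + g}.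
Proof.
move=> f g; apply/ffunP=> y; rewrite !ffunE -big_split.
by apply: eq_bigr => x _; rewrite ffunE.
Qed.

Lemma fun_res_comp X Y Z (g : gmap Y Z) (f : gmap X Y) h :
  fun_res (gcomp g f) h = fun_res f (fun_res g h).
Proof. by apply/ffunP=> x; rewrite !ffunE fix_map_comp. Qed.

Lemma fun_tr_comp X Y Z (g : gmap Y Z) (f : gmap X Y) h :
  fun_tr (gcomp g f) h = fun_tr g (fun_tr f h).
Proof.
apply/ffunP=> z; rewrite !ffunE (partition_big (fix_map f) (fun y => fix_map g y == z)) /=.
  apply: eq_bigr => y /eqP yz; rewrite ffunE; apply: eq_bigl => x.
  by rewrite fix_map_comp andb_idl // => /eqP->; rewrite yz.
by move=> x; rewrite fix_map_comp.
Qed.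

Lemma fun_res_id X h : fun_res (gid X) h = h.
Proof. by apply/ffunP=> x; rewrite !ffunE fix_map_id. Qed.

Lemma fun_tr_id X h : fun_tr (gid X) h = h.
Proof.
by apply/ffunP=> x; rewrite !ffunE (big_pred1 x) // => y; rewrite fix_map_id.
Qed.

(** Base change holds because taking Q-fixed points preserves pullback squares
    ([fix_map_square]). *)
Lemma fun_res_tr X Y Z W (f : gmap X Z) (g : gmap Y Z) (u : gmap W X)
    (v : gmap W Y) h :
    (forall w, f (u w) = g (v w)) ->
    (forall x y, u x = u y -> v x = v y -> x = y) ->
    (forall x y, f x = g y -> exists w, u w = x /\ v w = y) ->
  fun_res g (fun_tr f h) = fun_tr v (fun_res u h).
Proof.
move=> sq ui us; apply/ffunP=> y; rewrite !ffunE.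
rewrite (sum_bij_in (u := fix_map u) (P := fun w => fix_map v w == y)).
- by apply: eq_bigr => w _; rewrite ffunE.
- by move=> w /eqP <-; rewrite -!fix_map_comp; apply/eqP; apply: val_inj; apply: sq.
- move=> w w' /eqP ew /eqP ew' /(congr1 val) /= euw; apply: val_inj; apply: ui => //.
  by move: ew; rewrite -ew' => /(congr1 val).
- move=> x /eqP /(fix_map_square ui us) [w [<- <-]]; by exists w.
Qed.

Lemma fun_res_tr_gpb X Y Z (f : gmap X Z) (g : gmap Y Z) h :
  fun_res g (fun_tr f h) = fun_tr (gpb2 f g) (fun_res (gpb1 f g) h).
Proof.
apply: fun_res_tr => [w|x y|x y]; [exact: gpbE | exact: gpb_ext | exact: gpb_ex].
Qed.

Lemma fun_tr_res_bij X Y (k : gmap X Y) h : injective k ->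
  (forall y, exists x, k x = y) -> fun_tr k (fun_res k h) = h.
Proof.
move=> ki ks; rewrite -(fun_res_tr (f := gid Y) (g := gid Y)) ?fun_tr_id ?fun_res_id //.
  by move=> x y /ki.
by move=> x y /= ->; have [z <-] := ks y; exists z.
Qed.

Lemma fun_tr_injE X Y (k : gmap X Y) h x :
  injective k -> fun_tr k h (fix_map k x) = h x.
Proof.
move=> ki; rewrite ffunE (big_pred1 x) // => z.
by rewrite (inj_eq (fix_map_inj ki)).
Qed.
Definition fun_act X Y (s : spancls X Y) (h : fun_obj X) : fun_obj Y :=
  fun_tr (rleg (rep s)) (fun_res (lleg (rep s)) h).

Lemma fun_actE X Y S (l : gmap S X) (r : gmap S Y) h :
  fun_act (mkspan l r) h = fun_tr r (fun_res l h).
Proof.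
have [p [pi ps pl pr]] := rep_mkspan l r.
rewrite /fun_act -(gmap_eq (f := gcomp l p) pl) -(gmap_eq (f := gcomp r p) pr).
by rewrite fun_tr_comp fun_res_comp fun_tr_res_bij.
Qed.

Lemma fun_actDr X Y (s : spancls X Y) :
  {morph (fun h : fun_obj X => fun_act s h) : f g / f + g}.
Proof. by move=> f g; rewrite /fun_act fun_resD fun_trD. Qed.

Lemma fun_tr_copair X X' Y (r : gmap X Y) (r' : gmap X' Y) (h : fun_obj (gsum X X')) :
  fun_tr (gcopair r r') h
  = fun_tr r (fun_res (ginl X X') h) + fun_tr r' (fun_res (ginr X X') h).
Proof.
apply/ffunP=> y; rewrite !ffunE.
rewrite (bigID (fun x : fixT (gsum X X') => if val x is inl _ then true else false)) /=.
congr (_ + _).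
- rewrite (sum_bij_in (u := fix_map (ginl X X')) (P := fun x => fix_map r x == y)).
  + by apply: eq_bigr => x _; rewrite ffunE.
  + by move=> x /eqP<-; rewrite andbT -fix_map_comp; apply/eqP; apply: val_inj.
  + by move=> x x' _ _ /(congr1 val) [] /val_inj.
  + move=> [[x|x] xQ] /= /andP[/eqP<- //] _.
    have xQ' : fixb Q x by apply/fixbP=> a /(fixbP _ _ xQ) [].
    by exists (exist _ x xQ'); [apply/eqP|]; apply: val_inj.
- rewrite (sum_bij_in (u := fix_map (ginr X X')) (P := fun x => fix_map r' x == y)).
  + by apply: eq_bigr => x _; rewrite ffunE.
  + by move=> x /eqP<-; rewrite andbT -fix_map_comp; apply/eqP; apply: val_inj.
  + by move=> x x' _ _ /(congr1 val) [] /val_inj.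
  + move=> [[x|x] xQ] /= /andP[/eqP<- //] _.
    have xQ' : fixb Q x by apply/fixbP=> a /(fixbP _ _ xQ) [].
    by exists (exist _ x xQ'); [apply/eqP|]; apply: val_inj.
Qed.

Lemma fun_actDl X Y h : {morph (fun s : spancls X Y => fun_act s h) : s t / s + t}.
Proof.
elim/span_ind=> S l r; elim/span_ind=> S' l' r'.
rewrite mkspanD !fun_actE fun_tr_copair -!fun_res_comp.
by congr (fun_tr r _ + fun_tr r' _); congr fun_res; apply: gmap_eq.
Qed.

Lemma fun_act_comp X Y Z (t : spancls Y Z) (s : spancls X Y) h :
  fun_act (span_comp t s) h = fun_act t (fun_act s h).
Proof.
elim/span_ind: t => B l' r'; elim/span_ind: s => A l r.
by rewrite span_compE !fun_actE fun_tr_comp fun_res_comp fun_res_tr_gpb.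
Qed.

Definition fun_mk_map X Y (a : burn X Y) (h : fun_obj X) : fun_obj Y :=
  gc_lift (fun s => fun_act s h) a.

Lemma fun_mk_map_in X Y (s : spancls X Y) h : fun_mk_map (gc_in s) h = fun_act s h.
Proof. exact: (gc_lift_in (@fun_actDl X Y h)). Qed.

Lemma fun_mk_mapDl X Y (a b : burn X Y) h :
  fun_mk_map (a + b) h = fun_mk_map a h + fun_mk_map b h.
Proof. exact: (gc_liftD (@fun_actDl X Y h)). Qed.

Lemma fun_mk_mapDr X Y (a : burn X Y) f g :
  fun_mk_map a (f + g) = fun_mk_map a f + fun_mk_map a g.
Proof.
move: a; apply: burn_ext => [a b|a b|s]; first exact: fun_mk_mapDl.
  by rewrite !fun_mk_mapDl addrACA.
by rewrite !fun_mk_map_in fun_actDr.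
Qed.

Lemma fun_mk_map_id X h : fun_mk_map (burn_id X) h = h.
Proof. by rewrite fun_mk_map_in fun_actE fun_tr_id fun_res_id. Qed.

Lemma fun_mk_map_comp X Y Z (b : burn Y Z) (a : burn X Y) h :
  fun_mk_map (burn_comp b a) h = fun_mk_map b (fun_mk_map a h).
Proof.
move: b; apply: burn_ext => [b b'|b b'|t].
- by rewrite (burn_compDl a b b') fun_mk_mapDl.
- exact: fun_mk_mapDl.
move: a; apply: burn_ext => [a a'|a a'|s].
- by rewrite (burn_compDr (gc_in t) a a') fun_mk_mapDl.
- by rewrite fun_mk_mapDl fun_mk_mapDr.
by rewrite burn_comp_in !fun_mk_map_in fun_act_comp.
Qed.

Definition fun_mackey : mackey gT :=
  Mackey fun_mk_mapDr fun_mk_mapDl fun_mk_map_id fun_mk_map_comp.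

End MarkFunctor.

(** * Subfunctors, kernels and flatness *)
Section SubMackey.
Local Open Scope ring_scope.
Variable gT : finGroupType.

Record submackey (M : mackey gT) := SubMackey {
  sub_mem :> forall X, M X -> Prop;
  sub_mem0 : forall X, @sub_mem X 0;
  sub_memB : forall X x y, @sub_mem X x -> sub_mem y -> sub_mem (x - y);
  sub_mem_map : forall X Y (a : burn X Y) x, sub_mem x -> sub_mem (mk_map a x) }.

Section Obj.
Variables (M : mackey gT) (S : submackey M).

Definition sub_pred X : {pred M X} := fun x => `[< S X x >].
Arguments sub_pred X : clear implicits.

Fact sub_pred_zmod X : zmod_closed (sub_pred X).
Proof.
split=> [|x y /asboolP Sx /asboolP Sy]; apply/asboolP; first exact: sub_mem0.
exact: sub_memB.
Qed.
HB.instance Definition _ X := GRing.isZmodClosed.Build (M X) (sub_pred X) (sub_pred_zmod X).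

Record sub_obj X := SubObj { sub_val : M X; sub_valP : sub_val \in sub_pred X }.
HB.instance Definition _ X := [isSub for @sub_val X].
HB.instance Definition _ X := [Choice of sub_obj X by <:].
HB.instance Definition _ X := [SubChoice_isSubZmodule of sub_obj X by <:].

Lemma sub_objP X (x : sub_obj X) : S X (val x).
Proof. exact/asboolP/sub_valP. Qed.

Definition sub_in X x (Sx : S X x) : sub_obj X := SubObj (introT (asboolP _) Sx).

Definition sub_map X Y (a : burn X Y) (x : sub_obj X) : sub_obj Y :=
  sub_in (sub_mem_map a (sub_objP x)).

Fact sub_mapDr X Y (a : burn X Y) x y : sub_map a (x + y) = sub_map a x + sub_map a y.
Proof. by apply: val_inj; rewrite /= mk_mapDr. Qed.

Fact sub_mapDl X Y (a b : burn X Y) x : sub_map (a + b) x = sub_map a x + sub_map b x.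
Proof. by apply: val_inj; rewrite /= mk_mapDl. Qed.

Fact sub_map_id X x : sub_map (burn_id X) x = x.
Proof. by apply: val_inj; rewrite /= mk_map_id. Qed.

Fact sub_map_comp X Y Z (b : burn Y Z) (a : burn X Y) x :
  sub_map (burn_comp b a) x = sub_map b (sub_map a x).
Proof. by apply: val_inj; rewrite /= mk_map_comp. Qed.

Definition sub_mackey : mackey gT :=
  @Mackey gT (fun X => sub_obj X : zmodType) _ sub_mapDr sub_mapDl sub_map_id sub_map_comp.

Definition sub_incl : mkhom sub_mackey M :=
  @MkHom gT sub_mackey M (fun X x => val x) (fun _ _ _ => erefl) (fun _ _ _ _ => erefl).
End Obj.

Lemma mk_map0 (M : mackey gT) X Y (a : burn X Y) : mk_map a (0 : M X) = 0.
Proof. by apply: (@addrI _ (mk_map a 0)); rewrite -mk_mapDr !addr0. Qed.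

Lemma mkhom0 (M N : mackey gT) (d : mkhom M N) X : d X 0 = 0.
Proof. by apply: (@addrI _ (d X 0)); rewrite -mkhomD !addr0. Qed.

Lemma mkhomB (M N : mackey gT) (d : mkhom M N) X x y : d X (x - y) = d X x - d X y.
Proof. by apply: (@addIr _ (d X y)); rewrite -mkhomD !subrK. Qed.

Section KernelImage.
Variables (M N : mackey gT) (d : mkhom M N).

Definition ker_sub : submackey M.
Proof.
exists (fun X x => d X x = 0) => [X|X x y dx dy|X Y a x dx].
- exact: mkhom0.
- by rewrite mkhomB dx dy subr0.
- by rewrite mkhom_nat dx mk_map0.
Defined.

Definition im_sub : submackey N.
Proof.
exists (fun X y => exists x, d X x = y) => [X|X _ _ [x <-] [y <-]|X Y a _ [x <-]].
- by exists 0; apply: mkhom0.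
- by exists (x - y); apply: mkhomB.
- by exists (mk_map a x); apply: mkhom_nat.
Defined.

Definition to_im_fun X (x : M X) : sub_mackey im_sub X :=
  sub_in (S := im_sub) (ex_intro _ x erefl).

Definition to_im : mkhom M (sub_mackey im_sub).
Proof.
exists to_im_fun => [X x y|X Y a x]; apply: val_inj => /=.
  exact: mkhomD.
exact: mkhom_nat.
Defined.

(** Flatness is only used through injections; a kernel comes with an explicit
    quotient, the image, so that no general cokernel is needed. *)
Lemma ker_im_exact : short_exact (sub_incl ker_sub) to_im.
Proof.
move=> X; split=> [|x|y].
- exact: val_inj.
- split=> [/(congr1 val) /= dx|[k <-]].
    by exists (sub_in (S := ker_sub) dx).
  by apply: val_inj; apply: (sub_objP k).
- have [x dx] := sub_objP y; exists x; exact: val_inj.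
Qed.

Lemma flat_ker (F : mackey gT) Z : flat F ->
  injective (box_hom (sub_incl ker_sub) F Z).
Proof. by move=> /(_ _ _ _ _ _ ker_im_exact) /(_ Z) []. Qed.
End KernelImage.
End SubMackey.

(** Naturality for virtual spans follows from naturality for spans. *)
Lemma span_natural (gT : finGroupType) (M N : mackey gT)
    (d : forall X : gset gT, M X -> N X) :
    (forall X, {morph @d X : x y / (x + y)%R}) ->
    (forall X Y (s : spancls X Y) x,
      d Y (mk_map (gc_in s) x) = mk_map (gc_in s) (d X x)) ->
  forall X Y (a : burn X Y) x, d Y (mk_map a x) = mk_map a (d X x).
Proof.
move=> dD ds X Y a x; move: a; apply: burn_ext => [a b|a b|s].
- by rewrite mk_mapDl dD.
- by rewrite mk_mapDl.
exact: ds.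
Qed.

(** * The action of P on Q-fixed points *)
Section Invariant.
Local Open Scope ring_scope.
Variables (gT : finGroupType) (P Q : {group gT}).
Hypothesis nQP : P \subset 'N(Q)%g.
Implicit Types (X Y Z : gset gT).

(** For g outside the normalizer of Q the point x g need not be fixed by Q; the
    default value x then makes the function total. *)
Definition fix_shift X (g : gT) (x : fixT Q X) : fixT Q X :=
  insubd x (gact X (val x) g).

Lemma val_fix_shift X g (x : fixT Q X) : g \in P ->
  val (fix_shift g x) = gact X (val x) g.
Proof.
move=> Pg; apply: insubdK; apply/fixbP=> a Qa.
have Qag : (a ^ g^-1)%g \in Q by rewrite memJ_norm // groupV (subsetP nQP).
by rewrite -{2}(fixbP _ _ (valP x) _ Qag) -!actM conjgE invgK -!mulgA mulVg mulg1.
Qed.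

Lemma fix_shift_map X Y (f : gmap X Y) g x : g \in P ->
  fix_map f (fix_shift g x) = fix_shift g (fix_map f x).
Proof. by move=> Pg; apply: val_inj; rewrite /= !val_fix_shift // gfunP. Qed.

Lemma fix_shiftK X g (x : fixT Q X) : g \in P -> fix_shift g^-1 (fix_shift g x) = x.
Proof. by move=> Pg; apply: val_inj; rewrite !val_fix_shift ?groupV // actK. Qed.

Lemma fix_shift_fixed X g (x : fixT Q X) : g \in P -> fixb P (val x) -> fix_shift g x = x.
Proof. by move=> Pg /fixbP xP; apply: val_inj; rewrite val_fix_shift // xP. Qed.

Definition invariant (V : Type) X (h : fixT Q X -> V) :=
  forall g x, g \in P -> h (fix_shift g x) = h x.

Section Deviation.
Variable V : zmodType.

(** Invariance is expressed as the vanishing of a single map of Mackey functors, so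
    that invariant functions form a kernel.  Elements g outside P contribute 0. *)
Definition dev_fun X (h : fun_mackey Q V X) : fun_mackey Q {ffun gT -> V} X :=
  [ffun x => [ffun g => if g \in P then h (fix_shift g x) - h x else 0]].

Lemma dev_funD X : {morph @dev_fun X : h k / h + k}.
Proof.
move=> h k; apply/ffunP=> x; apply/ffunP=> g; rewrite !ffunE.
by case: ifP; rewrite ?addr0 // opprD addrACA.
Qed.

Lemma dev_fun_res X Y (l : gmap X Y) h : dev_fun (fun_res l h) = fun_res l (dev_fun h).
Proof.
apply/ffunP=> x; apply/ffunP=> g; rewrite !ffunE; case: ifP => // Pg.
by rewrite fix_shift_map.
Qed.

Lemma dev_fun_tr X Y (r : gmap X Y) h : dev_fun (fun_tr r h) = fun_tr r (dev_fun h).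
Proof.
apply/ffunP=> y; apply/ffunP=> g; rewrite !ffunE sum_ffunE.
have [Pg|Pg] := ifPn; last first.
  by rewrite big1 // => x _; rewrite !ffunE (negPf Pg).
rewrite (sum_bij_in (u := fix_shift g) (P := fun x => fix_map r x == y)
  (Q := fun x => fix_map r x == fix_shift g y)).
- by rewrite -sumrB; apply: eq_bigr => x _; rewrite !ffunE Pg.
- by move=> x /eqP<-; rewrite fix_shift_map.
- by move=> x x' _ _ e; rewrite -(fix_shiftK x Pg) e fix_shiftK.
- move=> x /eqP rx; exists (fix_shift g^-1 x).
    by rewrite fix_shift_map ?groupV // rx fix_shiftK.
  by rewrite -{1}(invgK g) fix_shiftK ?groupV.
Qed.

Definition dev : mkhom (fun_mackey Q V) (fun_mackey Q {ffun gT -> V}).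
Proof.
exists dev_fun; first exact: dev_funD.
apply: span_natural => [|X Y s h]; first exact: dev_funD.
rewrite [mk_map _ h]fun_mk_map_in [RHS]fun_mk_map_in /fun_act.
by rewrite dev_fun_tr dev_fun_res.
Defined.

Lemma dev_eq0 X (h : fun_mackey Q V X) : dev X h = 0 <-> invariant h.
Proof.
split=> [h0 g x Pg|h0].
  have := congr1 (fun k : fun_mackey Q {ffun gT -> V} X => k x g) h0.
  by rewrite /= !ffunE Pg => /eqP; rewrite subr_eq0 => /eqP.
apply/ffunP=> x; apply/ffunP=> g; rewrite !ffunE; case: ifP => // Pg.
by rewrite h0 // subrr.
Qed.

Lemma invariant_tr X Y (r : gmap X Y) (h : fun_mackey Q V X) :
  invariant h -> invariant (fun_tr r h).
Proof.
move/dev_eq0=> h0; apply/dev_eq0; rewrite /= dev_fun_tr -[dev_fun h]/(dev X h) h0.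
by apply/ffunP=> y; rewrite !ffunE big1 // => x _; rewrite ffunE.
Qed.
End Deviation.

Definition fix_orbit X (x : fixT Q X) : {set fixT Q X} :=
  [set y | val y \in orbit (gact X) P (val x)].

Lemma fix_orbitP X (x y : fixT Q X) :
  reflect (exists2 g, g \in P & fix_shift g x = y) (y \in fix_orbit x).
Proof.
rewrite inE; apply: (iffP orbitP) => -[g Pg gx]; exists g => //.
  by apply: val_inj; rewrite val_fix_shift.
by rewrite -gx val_fix_shift.
Qed.

(** The stabilizer in P of a Q-fixed point lies between Q and P, and there is
    nothing strictly between them. *)
Lemma card_fix_orbit X (x : fixT Q X) :
    Q \subset P -> prime #|P : Q|%g -> ~~ fixb P (val x) ->
  #|fix_orbit x| = #|P : Q|%g.
Proof.
move=> sQP q_pr xP.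
have -> : #|fix_orbit x| = #|orbit (gact X) P (val x)|.
  rewrite -(card_imset _ val_inj); apply: eq_card => z.
  apply/imsetP/idP => [[y]|/[dup] zx /orbitP[g Pg gx]]; first by rewrite inE => yx ->.
  exists (fix_shift g x); last by rewrite val_fix_shift.
  by apply/fix_orbitP; exists g.
rewrite card_orbit; pose S := 'C_P[val x | gact X]%G; rewrite -[X in #|P : X|%g]/(gval S).
have sQS : Q \subset S.
  rewrite subsetI sQP /=; apply/subsetP=> a Qa; apply/astab1P.
  exact: (fixbP _ _ (valP x)).
have : (#|P : S|%g %| #|P : Q|%g)%N.
  by rewrite -(Lagrange_index (subsetIl P _ : S \subset P) sQS) dvdn_mulr.
case/primeP: q_pr => _ /[apply] /orP[|/eqP//].
rewrite indexg_eq1 => /subsetIP[_ sPC]; case/negP: xP; apply/fixbP=> a Pa.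
by apply/astab1P; apply: (subsetP sPC).
Qed.

(** A point outside X^P has an orbit of q points on which F is constant, and these
    contribute q F = 0. *)
Lemma sum_invariant (V : zmodType) X (F : fixT Q X -> V) :
    Q \subset P -> prime #|P : Q|%g -> invariant F ->
    (forall x, F x *+ #|P : Q|%g = 0) ->
  \sum_x F x = \sum_(x | fixb P (val x)) F x.
Proof.
move=> sQP q_pr Finv Fq; rewrite (bigID (fun x => fixb P (val x))) /=.
rewrite [X in _ + X](_ : _ = 0) ?addr0 //.
pose pr (x : fixT Q X) := orbit (gact X) P (val x).
rewrite (partition_big pr predT) //= big1 // => o _.
have [x /andP[xP /eqP xo]|none] :=
  pickP (fun x : fixT Q X => ~~ fixb P (val x) && (pr x == o)); last first.
  by rewrite big_pred0.
rewrite (eq_bigl (mem (fix_orbit x))) => [|y].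
  rewrite (eq_bigr (fun=> F x)) => [|_ /fix_orbitP[g Pg <-]]; last exact: Finv.
  by rewrite sumr_const card_fix_orbit.
apply/andP/fix_orbitP => [[_ /eqP yo]|[g Pg <-]].
  by apply/fix_orbitP; rewrite inE -/(pr x) xo -yo orbit_refl.
rewrite /pr val_fix_shift // orbit_act // -/(pr x) xo; split=> //.
apply: contra xP; rewrite -[val _]/(sval _) val_fix_shift // => /fixbP xgP; apply/fixbP=> a Pa.
by apply: (act_inj (gact X) g); rewrite -actM conjgC actM xgP // groupJ.
Qed.
End Invariant.

(** * Elements of a box product at a point *)
Section BurnsideProduct.
Local Open Scope ring_scope.
Variable gT : finGroupType.
Implicit Types (X Y Z : gset gT).

Let prod_auxl X Y X' Y' (d : spancls Y Y') :
  {morph (fun c : spancls X X' => gc_in (span_prod c d)) : c c' / c + c'}.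
Proof. by move=> c c'; rewrite span_prodDl gc_inD. Qed.

Let prod_auxr X Y X' Y' (c : spancls X X') :
  {morph (fun d : spancls Y Y' => gc_in (span_prod c d)) : d d' / d + d'}.
Proof. by move=> d d'; rewrite span_prodDr gc_inD. Qed.

Lemma burn_prod_in X Y X' Y' (c : spancls X X') (d : spancls Y Y') :
  burn_prod (gc_in c) (gc_in d) = gc_in (span_prod c d).
Proof. by apply: gc_lift2_in => ?; [apply: prod_auxl | apply: prod_auxr]. Qed.

Lemma burn_prodDl X Y X' Y' (b : burn Y Y') :
  {morph (fun a : burn X X' => burn_prod a b) : a a' / a + a'}.
Proof. by apply: gc_lift2Dl => ?; apply: prod_auxl. Qed.

Lemma burn_prodDr X Y X' Y' (a : burn X X') :
  {morph (fun b : burn Y Y' => burn_prod a b) : b b' / b + b'}.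
Proof. by apply: gc_lift2Dr => ?; apply: prod_auxr. Qed.

End BurnsideProduct.

Section BoxElements.
Local Open Scope ring_scope.
Variable gT : finGroupType.
Implicit Types (X Y Z : gset gT) (M N : mackey gT).

Definition gpoint : gset gT := gtriv gT unit.
Definition to_point X : gmap X gpoint := @GMap gT X gpoint (fun=> tt) (fun _ _ => erefl).

Definition tr_span X Y (k : gmap X Y) : burn X Y := gc_in (mkspan (gid X) k).
Definition res_span X Y (k : gmap X Y) : burn Y X := gc_in (mkspan k (gid X)).
Definition diag_span X : burn (gprod X X) gpoint :=
  gc_in (mkspan (gpair (gid X) (gid X)) (to_point X)).

(** The internal product of [m] and [n] at level Y, transferred to a point. *)
Definition diag_gen M N (Y : ordgset gT) (m : M Y) (n : N Y) : box M N gpoint :=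
  box_cls (BoxGen (diag_span Y) m n).

Lemma diag_genD M N (Y : ordgset gT) (n : N Y) :
  {morph (fun m : M Y => diag_gen m n) : m m' / m + m'}.
Proof. by move=> m m'; rewrite [RHS]box_qaddE; apply/box_clsP; apply: box_genD2. Qed.

(** Both composites are the span with legs (id, k) : X -> X x Y and X -> pt. *)
Lemma frobenius_span X Y (k : gmap X Y) :
  burn_comp (diag_span Y) (burn_prod (tr_span k) (burn_id Y))
  = burn_comp (diag_span X) (burn_prod (burn_id X) (res_span k)).
Proof.
rewrite !burn_prod_in !burn_comp_in !span_prodE !span_compE; congr gc_in.
transitivity (mkspan (gpair (gid X) k) (to_point X)).
  symmetry.
  have e x : gprod_map k (gid Y) (gpair (gid X) k x) = gpair (gid Y) (gid Y) (k x) by [].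
  apply: (mkspan_eq (phi := gpb_pair e)) => //.
  - by move=> x y /(congr1 val) [].
  - move=> y; have [yk y2] := gpbE y; exists (gpb1 _ _ y).1; apply: gpb_ext => /=.
      by rewrite [RHS]surjective_pairing /= [in RHS]y2 /= -yk.
    exact: yk.
have e x : gprod_map (gid X) (gid X) (gpair (gid X) (gid X) x)
    = gpair (gid X) (gid X) (gid X x) by [].
apply: (mkspan_eq (phi := gpb_pair e)) => //.
- by move=> x y /(congr1 val) [].
- move=> y; exists (gpb2 _ _ y); apply: gpb_ext => //=.
  by rewrite [RHS]surjective_pairing; exact: (esym (gpbE y)).
Qed.

Lemma diag_gen_tr M N (X Y : ordgset gT) (k : gmap X Y) (m : M X) (n : N Y) :
  diag_gen (mk_map (tr_span k) m) n = diag_gen m (mk_map (res_span k) n).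
Proof.
rewrite /diag_gen -[in LHS](mk_map_id n) -[in RHS](mk_map_id m).
apply/box_clsP; apply: box_trans (box_coend _ _ _ _ _).
by rewrite -frobenius_span; apply: box_sym; apply: box_coend.
Qed.

End BoxElements.

(** * Functionals on a box product *)

(** A functional on K box M at a point is built from maps [rho] from K and [theta]
    from M to functions on Q-fixed points, by multiplying values.  The
    multiplication goes through a set-theoretic map [s] of coefficients that is
    additive only modulo [e].  The error disappears because [theta] is killed by
    [e] on P-fixed points, and invariant e-torsion functions have the same sum
    over Q-fixed points as over P-fixed points.  The two cases of interest are
    Q = P with [s] the identity and e = 0, and |P : Q| = q with e = q in Z/q^2. *)
Section Detection.
Local Open Scope ring_scope.
Variables (gT : finGroupType) (P Q : {group gT}).
Hypothesis nQP : P \subset 'N(Q)%g.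

Variables (V : zmodType) (R : comNzRingType) (s : V -> R) (e : R).
Hypothesis ee0 : e * e = 0.
Hypothesis sD : forall v w, exists k, s (v + w) = s v + s w + e * k.
Hypothesis sum_fixed : forall X (F : fixT Q X -> R),
  invariant P F -> (forall x, e * F x = 0) ->
  \sum_x F x = \sum_(x | fixb P (val x)) F x.

Variables (K : mackey gT) (rho : mkhom K (fun_mackey Q V)).
Hypothesis rho_inv : forall X k, invariant P (rho X k).

Variables (M : mackey gT) (theta : mkhom M (fun_mackey Q R)).
Hypothesis theta_inv : forall X n, invariant P (theta X n).
Hypothesis theta_fix : forall X n x, fixb P (val x) -> e * theta X n x = 0.
Implicit Types X Y Z : gset gT.

Lemma s_sum (I : finType) (A : pred I) (F : I -> V) :
  exists k, s (\sum_(i | A i) F i) = \sum_(i | A i) s (F i) + e * k.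
Proof.
elim/big_rec2: _ => [|i r v _ [k sv]].
  have [k /eqP] := sD 0 0; rewrite addr0 -subr_eq0 !opprD !addrA subrr add0r => s0.
  by exists (- k); apply/eqP; rewrite add0r mulrN -addr_eq0 -oppr_eq0 opprD.
have [l ->] := sD (F i) v; exists (k + l).
by rewrite sv mulrDr !addrA.
Qed.

Definition pairing X Y (m : fun_mackey Q V X) (t : fun_mackey Q R Y) :
    fun_mackey Q R (gprod X Y) :=
  [ffun z => s (m (fix_map (gfst X Y) z)) * t (fix_map (gsnd X Y) z)].

Lemma pairing_invariant X Y (m : fun_mackey Q V X) (t : fun_mackey Q R Y) :
    invariant P m -> invariant P t ->
  invariant P (pairing m t).
Proof. by move=> mP tP g z Pg; rewrite !ffunE !(fix_shift_map nQP) // mP ?tP. Qed.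

Lemma mk_map_invariant (W : zmodType) X Y (a : burn X Y) (h : fun_mackey Q W X) :
  invariant P h -> invariant P (mk_map a h).
Proof.
by move=> /(dev_eq0 nQP) h0; apply/(dev_eq0 nQP); rewrite mkhom_nat h0 mk_map0.
Qed.

Definition total X (a : burn X (gpoint gT)) (h : fun_mackey Q R X) : R :=
  mk_map a h (fixed_pt (introT (fixbP Q (X := gpoint gT) tt) (fun _ _ => erefl))).

Lemma totalDr X a (h k : fun_mackey Q R X) : total a (h + k) = total a h + total a k.
Proof. by rewrite /total mk_mapDr ffunE. Qed.

Lemma totalDl X a b (h : fun_mackey Q R X) : total (a + b) h = total a h + total b h.
Proof. by rewrite /total mk_mapDl ffunE. Qed.

Lemma total_span X S (l : gmap S X) (r : gmap S (gpoint gT)) (h : fun_mackey Q R X) :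
  total (gc_in (mkspan l r)) h = \sum_x h (fix_map l x).
Proof.
rewrite /total [mk_map _ _]fun_mk_map_in fun_actE ffunE.
by apply: eq_big => [x|x _]; [apply/eqP/val_inj; case: (val _) | rewrite ffunE].
Qed.

Lemma total_eq0 X a (h : fun_mackey Q R X) : invariant P h ->
    (forall x, e * h x = 0) -> (forall x, fixb P (val x) -> h x = 0) ->
  total a h = 0.
Proof.
move=> hP hq h0; move: a; apply: burn_ext => [a b|a b|]; first exact: totalDl.
  by rewrite addr0.
elim/span_ind=> S l r; rewrite total_span sum_fixed //.
- by rewrite big1 // => x xP; apply: h0; apply: fixb_map.
- by move=> g x Pg; rewrite (fix_shift_map nQP) ?hP.
Qed.

(** Errors of the shape e c t, with t killed by e on P-fixed points, are invisible
    to [total]. *)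
Lemma total_cong X a (h k : fun_mackey Q R X) :
    invariant P h -> invariant P k ->
    (forall x, exists c t, h x = k x + e * c * t /\ (fixb P (val x) -> e * t = 0)) ->
  total a h = total a k.
Proof.
move=> hP kP hk; rewrite -[h](subrK k) totalDr total_eq0 ?add0r //.
- by move=> g x Pg; rewrite !ffunE hP ?kP.
- move=> x; have [c [t [hx _]]] := hk x; rewrite !ffunE hx addrAC subrr add0r.
  by rewrite !mulrA ee0 !mul0r.
- move=> x xP; have [c [t [hx /(_ xP) tq]]] := hk x; rewrite !ffunE hx addrAC subrr add0r.
  by rewrite -mulrA mulrCA tq mulr0.
Qed.

Lemma total_pairingDl X Y a (m m' : fun_mackey Q V X) n :
    invariant P m -> invariant P m' ->
  total a (pairing (m + m') (theta Y n))
  = total a (pairing m (theta Y n)) + total a (pairing m' (theta Y n)).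
Proof.
move=> mP mP'; rewrite -totalDr; apply: total_cong => [||x].
- by apply: pairing_invariant => // g x Pg; rewrite !ffunE mP ?mP'.
- by move=> g x Pg; rewrite !ffunE -!mulrDl !(fix_shift_map nQP) // mP ?mP' ?theta_inv.
rewrite !ffunE; have [k ->] := sD (m (fix_map (gfst X Y) x)) (m' (fix_map (gfst X Y) x)).
exists k, (theta Y n (fix_map (gsnd X Y) x)); split; first by rewrite !mulrDl.
by move=> xP; apply: theta_fix; apply: fixb_map.
Qed.

Lemma total_pairingDr X Y a (m : fun_mackey Q V X) n n' :
  total a (pairing m (theta Y (n + n')))
  = total a (pairing m (theta Y n)) + total a (pairing m (theta Y n')).
Proof.
rewrite -totalDr mkhomD; congr total; apply/ffunP=> x.
by rewrite !ffunE mulrDr.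
Qed.

Lemma pairing_span X Y X' Y' A B (l : gmap A X) (r : gmap A X') (l' : gmap B Y)
    (r' : gmap B Y') (m : fun_mackey Q V X) (t : fun_mackey Q R Y) z :
  mk_map (gc_in (span_prod (mkspan l r) (mkspan l' r'))) (pairing m t) z
  = (\sum_(a | fix_map r a == fix_map (gfst X' Y') z) s (m (fix_map l a)))
    * mk_map (gc_in (mkspan l' r')) t (fix_map (gsnd X' Y') z).
Proof.
rewrite [mk_map _ _]fun_mk_map_in [mk_map _ t]fun_mk_map_in span_prodE !fun_actE !ffunE.
rewrite big_distrlr /= pair_big /=.
rewrite (sum_bij_in (u := fun w => (fix_map (gfst A B) w, fix_map (gsnd A B) w))
  (P := fun w => fix_map (gprod_map r r') w == z)).
- by apply: eq_bigr => w _; rewrite !ffunE; congr (s (m _) * t _); apply: val_inj.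
- by move=> w /eqP <-; rewrite -!fix_map_comp; apply/andP; split; apply/eqP/val_inj.
- move=> [[w1 w2] wP] [[w1' w2'] wP'] _ _ [e1 e2]; apply: val_inj.
  by rewrite /= e1 e2.
- move=> [a b] /= /andP[/eqP/(congr1 val) /= ra /eqP/(congr1 val) /= rb].
  have abQ : fixb Q ((val a, val b) : gprod A B).
    by apply/fixbP=> g Qg; rewrite /= /gprod_act /= (fixbP _ _ (valP a)) ?(fixbP _ _ (valP b)).
  exists (fixed_pt abQ); last by congr pair; apply: val_inj.
  by apply/eqP/val_inj; rewrite /= /gprod_fun /= ra rb -surjective_pairing.
Qed.

(** Compatibility with transfers, where [s] has to commute with sums over fibres:
    it does so up to an error handled by [total_cong]. *)
Lemma total_coend X Y X' Y' (a : burn (gprod X' Y') (gpoint gT)) (u : burn X X')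
    (v : burn Y Y') (m : K X) (n : M Y) :
  total (burn_comp a (burn_prod u v)) (pairing (rho _ m) (theta Y n))
  = total a (pairing (rho _ (mk_map u m)) (theta Y' (mk_map v n))).
Proof.
move: u; apply: burn_ext => [u u'|u u'|].
- by rewrite (burn_prodDl v u u') (burn_compDr a) totalDl.
- by rewrite mk_mapDl mkhomD total_pairingDl.
elim/span_ind=> A l r; move: v; apply: burn_ext => [v v'|v v'|].
- by rewrite (burn_prodDr (gc_in (mkspan l r)) v v') (burn_compDr a) totalDl.
- by rewrite mk_mapDl total_pairingDr.
elim/span_ind=> B l' r'; rewrite burn_prod_in.
have um : rho _ (mk_map (gc_in (mkspan l r)) m) = fun_tr r (fun_res l (rho X m)).
  by rewrite -fun_actE -fun_mk_map_in mkhom_nat.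
rewrite {1}/total mk_map_comp -/(total _ _); apply: total_cong => [||z].
- by apply: mk_map_invariant; apply: pairing_invariant.
- by apply: pairing_invariant.
set I := fun a => fix_map r a == fix_map (gfst X' Y') z.
have [k sk] := s_sum I (fun a => rho X m (fix_map l a)).
have trE : fun_tr r (fun_res l (rho X m)) (fix_map (gfst X' Y') z)
    = \sum_(a | I a) rho X m (fix_map l a).
  by rewrite ffunE; apply: eq_bigr => i _; rewrite ffunE.
set t := theta Y' _; exists (- k), (t (fix_map (gsnd X' Y') z)); split.
  rewrite pairing_span -mkhom_nat -/t um [pairing _ _ z]ffunE trE sk.
  by rewrite mulrN mulNr mulrDl addrK.
by move=> zP; apply: theta_fix; apply: fixb_map.
Qed.

Fixpoint detect_term (x : box_term K M (gpoint gT)) : R :=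
  match x with
  | BoxZero => 0
  | BoxAdd y z => detect_term y + detect_term z
  | BoxOpp y => - detect_term y
  | BoxGen X Y a m n => total a (pairing (rho _ m) (theta Y n))
  end.

Lemma detect_rel x y : box_rel x y -> detect_term x = detect_term y.
Proof.
elim=> {x y} //=.
- by move=> x y z _ -> _ ->.
- by move=> x x' y y' _ -> _ ->.
- by move=> x x' _ ->.
- by move=> x y z; rewrite addrA.
- by move=> x y; rewrite addrC.
- by move=> x; rewrite add0r.
- by move=> x; rewrite addNr.
- by move=> X Y a a' m n; rewrite totalDl.
- by move=> X Y a m m' n; rewrite mkhomD total_pairingDl.
- by move=> X Y a m n n'; rewrite total_pairingDr.
- by move=> X Y X' Y' a u v m n; apply: total_coend.
Qed.

Lemma detect (Y : ordgset gT) (m m' : K Y) (n n' : M Y) :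
    diag_gen m n = diag_gen m' n' ->
  \sum_y s (rho Y m y) * theta Y n y = \sum_y s (rho Y m' y) * theta Y n' y.
Proof.
move=> /box_clsP/detect_rel /=.
have pd (k : K Y) l (x : fixT Q Y) :
    pairing (rho Y k) (theta Y l) (fix_map (gpair (gid Y) (gid Y)) x)
    = s (rho Y k x) * theta Y l x.
  by rewrite ffunE; congr (s (rho Y k _) * theta Y l _); apply: val_inj.
by rewrite !total_span !(eq_bigr _ (fun x _ => pd _ _ x)).
Qed.

End Detection.

(** * The two consequences of flatness *)
Section Lift.
Local Open Scope ring_scope.
Variables (p : nat).
Hypothesis p_gt1 : (1 < p)%N.

Lemma Zp_mulrn_eq0 (v : 'Z_p) : v *+ p = 0.
Proof. by rewrite -mulr_natr pchar_Zp ?mulr0. Qed.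

Let p2_gt1 : (1 < p ^ 2)%N.
Proof. by rewrite -(exp1n 2) ltn_exp2r. Qed.

Lemma Zp2_natr_sq : p%:R * p%:R = 0 :> 'Z_(p ^ 2).
Proof. by rewrite -natrM mulnn pchar_Zp. Qed.

Lemma Zp2_natr_neq0 : p%:R != 0 :> 'Z_(p ^ 2).
Proof.
rewrite -val_eqE /= val_Zp_nat // modn_small ?ltn_Pmulr //; last exact: ltnW.
by rewrite -lt0n ltnW.
Qed.

(** Over an orbit of p points the pairing takes p equal values, so it has to take
    place in Z/p^2 for their sum to remain visible. *)
Definition Zp_lift (v : 'Z_p) : 'Z_(p ^ 2) := (val v)%:R.

Lemma Zp_liftD v w : exists k, Zp_lift (v + w) = Zp_lift v + Zp_lift w + p%:R * k.
Proof.
(* the carry of the addition in Z/p *)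
exists (- ((val v + val w) %/ p)%:R); rewrite /Zp_lift /= -natrD.
rewrite {2}(divn_eq (val v + val w) p) [X in (_ %% X)%:R]Zp_cast // natrD natrM.
by rewrite mulrN [p%:R * _]mulrC addrAC subrr add0r.
Qed.

End Lift.

Section Separation.
Local Open Scope ring_scope.
Variables (gT : finGroupType) (P Q : {group gT}).
Hypotheses (nQP : P \subset 'N(Q)%g) (sQP : Q \subset P) (q_pr : prime #|P : Q|%g).
Local Notation q := #|P : Q|%g.
Variables (M : mackey gT) (flatM : flat M).
Implicit Types X Y Z : gset gT.

Let inv_sub := ker_sub (dev nQP 'Z_q).
Let inv_mackey := sub_mackey inv_sub.
Let inv_in X (h : fun_mackey Q 'Z_q X) (hP : invariant P h) : inv_mackey X :=
  sub_in (S := inv_sub) ((dev_eq0 nQP h).2 hP).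

Let val_inv X (m : inv_mackey X) : invariant P (val m).
Proof. by apply/(dev_eq0 nQP); exact: (sub_objP m). Qed.

Let Zq_mulrn_eq0 (v : 'Z_q) : v *+ q = 0.
Proof. exact/Zp_mulrn_eq0/prime_gt1. Qed.

Lemma flat_diag_gen (Y : ordgset gT) (m m' : inv_mackey Y) (n n' : M Y) :
    diag_gen (val m : fun_mackey Q 'Z_q Y) n = diag_gen (val m' : fun_mackey Q 'Z_q Y) n' ->
  diag_gen m n = diag_gen m' n'.
Proof.
move=> e; apply: (flat_ker (d := dev nQP 'Z_q) flatM).
by rewrite [LHS]box_hom_funE [RHS]box_hom_funE.
Qed.

Definition indicator X (A : {set fixT Q X}) : fun_mackey Q 'Z_q X :=
  [ffun x => if x \in A then 1 else 0].

Lemma indicator_tr X Y (k : gmap X Y) y :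
  mk_map (tr_span k) (indicator [set y]) = indicator [set fix_map k y].
Proof.
rewrite [LHS]fun_mk_map_in fun_actE fun_res_id; apply/ffunP=> z; rewrite !ffunE.
under eq_bigr => x _ do rewrite ffunE inE.
rewrite -big_mkcondr inE; case: eqP => [->|ne].
  rewrite (big_pred1 y) // => x; apply: andb_idl => /eqP->; exact: eqxx.
by rewrite big_pred0 // => x; apply/andP => -[/eqP xz /eqP xy]; case: ne; rewrite -xz xy.
Qed.

Lemma sub_fixT X (x : fixT P X) : fixb Q (val x).
Proof. by apply/fixbP=> a /(subsetP sQP); apply: (fixbP _ _ (valP x)). Qed.

Definition fix_sub X (x : fixT P X) : fixT Q X := exist _ (val x) (sub_fixT x).

(** Restriction to P-fixed points.  On all functions it does not commute with
    transfers; on invariant ones it does, by [sum_invariant]. *)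
Definition restr_fun X (m : inv_mackey X) : fun_mackey P 'Z_q X :=
  [ffun x => val m (fix_sub x)].

Lemma restr_funD X : {morph @restr_fun X : m n / m + n}.
Proof. by move=> m n; apply/ffunP=> x; rewrite !ffunE. Qed.

Lemma restr_fun_act X Y (a : spancls X Y) m :
  restr_fun (mk_map (gc_in a) m) = mk_map (gc_in a) (restr_fun m).
Proof.
elim/span_ind: a => S l r; rewrite [RHS]fun_mk_map_in fun_actE.
apply/ffunP=> y; rewrite ffunE -[val _]/(mk_map _ (val m)).
rewrite [mk_map _ _]fun_mk_map_in fun_actE !ffunE.
rewrite !(big_mkcond (fun x => fix_map r x == _)) (sum_invariant nQP) //.
- rewrite (sum_bij_in (u := @fix_sub S) (P := predT)).
  + apply: eq_bigr => x _; rewrite !ffunE -!val_eqE.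
    by rewrite [fix_map l (fix_sub x)](_ : _ = fix_sub (fix_map l x)) //; apply: val_inj.
  + by move=> x _; apply: (valP x).
  + by move=> x x' _ _ /(congr1 val) e; apply: val_inj.
  + by move=> x xP; exists (exist _ (val x) xP) => //; apply: val_inj.
- move=> g x Pg; rewrite !ffunE !(fix_shift_map nQP) // (val_inv m) //.
  rewrite -{1}(fix_shift_fixed nQP Pg (x := fix_sub y) (valP y)).
  by rewrite (inj_eq (can_inj (fun z => fix_shiftK nQP z Pg))).
Qed.

Definition restr : mkhom inv_mackey (fun_mackey P 'Z_q).
Proof.
exists restr_fun; first exact: restr_funD.
by apply: span_natural; [exact: restr_funD | exact: restr_fun_act].
Defined.

(** The indicator of a P-fixed point y is invariant, and among all functions it is
    the transfer of the indicator of a Q-fixed point x of X above y.  By Frobenius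
    reciprocity its product with n then depends only on the restriction of n along
    k, and by flatness this is true among invariant functions too, where [theta]
    reads off the value at y. *)
Lemma flat_fixed (theta : mkhom M (fun_mackey P 'Z_q)) (X Y : ordgset gT)
    (k : gmap X Y) (x : fixT Q X) (y : fixT P Y) (n n' : M Y) :
    k (val x) = val y -> mk_map (res_span k) n = mk_map (res_span k) n' ->
  theta Y n y = theta Y n' y.
Proof.
move=> kx kn; have xy : fix_map k x = fix_sub y by apply: val_inj.
have mP : invariant P (indicator [set fix_map k x]).
  move=> g z Pg; rewrite !ffunE !inE; congr (if _ then _ else _).
  rewrite -{1}(fix_shift_fixed nQP Pg (x := fix_map k x)); last by rewrite xy; apply: (valP y).
  by rewrite (inj_eq (can_inj (fun z => fix_shiftK nQP z Pg))).
have trivP Z (V : Type) (h : fixT P Z -> V) : invariant P h.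
  by move=> g z Pg; rewrite (fix_shift_fixed (normG P) Pg (valP z)).
have := @detect _ P P (normG P) ('Z_q) ('Z_q) id 0 _ _ _ inv_mackey restr _ M theta _ _ Y
  (inv_in mP) (inv_in mP) n n'.
have restrE z : restr Y (inv_in mP) z = if z == y then 1 else 0.
  by rewrite ffunE -[val _]/(indicator [set fix_map k x]) ffunE inE -!val_eqE /= kx.
have sumE (l : M Y) :
    \sum_z restr Y (inv_in mP) z * theta Y l z = theta Y l y.
  rewrite (bigD1 y) //= restrE eqxx mul1r big1 ?addr0 // => z zy.
  by rewrite restrE (negPf zy) mul0r.
rewrite !sumE; apply => //.
- by rewrite mul0r.
- by move=> v w; exists 0; rewrite mul0r addr0.
- by move=> Z F _ _; apply: eq_bigl => z; rewrite (valP z).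
- by move=> Z l z _; rewrite mul0r.
- by apply: flat_diag_gen; rewrite -[val _]/(indicator [set fix_map k x]) -indicator_tr !diag_gen_tr kn.
Qed.

(** The indicator of the P-orbit of y is invariant.  Among all functions it is the
    sum of the indicators of q points; all of them have the same product with n,
    since P moves y by maps c that preserve n.  As the coefficients have exponent q,
    the product is 0, and flatness transports this to invariant functions, where
    the functional takes the value q [theta] n y. *)
Lemma flat_orbit (theta : mkhom M (fun_mackey Q 'Z_(q ^ 2))) (Y : ordgset gT)
    (y : fixT Q Y) (n : M Y) :
    (forall X l, invariant P (theta X l)) ->
    (forall X l x, fixb P (val x) -> theta X l x *+ q = 0) ->
    ~~ fixb P (val y) ->
    (forall g, g \in P -> exists2 c : gmap Y Y, c (val y) = gact Y (val y) g
       & mk_map (res_span c) n = n) ->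
  theta Y n y *+ q = 0.
Proof.
move=> theta_inv theta_fix yP nP; pose A := fix_orbit P y.
have mP : invariant P (indicator A).
  move=> g x Pg; rewrite !ffunE; congr (if _ then _ else _); rewrite !inE.
  by rewrite (val_fix_shift nQP) // -[gact _ _ g]/(gact Y (val x) g) orbit_actr.
have := @detect _ P Q nQP ('Z_q) ('Z_(q ^ 2)) (@Zp_lift q) q%:R _ _ _ inv_mackey
  (sub_incl inv_sub) _ M theta theta_inv _ Y (inv_in mP) 0 n 0.
have -> : \sum_z Zp_lift (sub_incl inv_sub Y 0 z) * theta Y 0 z = 0.
  by rewrite (mkhom0 theta) big1 // => z _; rewrite [X in _ * X]ffunE mulr0.
have -> : \sum_z Zp_lift (sub_incl inv_sub Y (inv_in mP) z) * theta Y n z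
    = theta Y n y *+ q.
  rewrite (eq_bigr (fun z => if z \in A then theta Y n y else 0)) => [|z _]; last first.
    rewrite ffunE; case: ifP => [/(fix_orbitP nQP)[g Pg <-]|_]; last exact: mul0r.
    by rewrite theta_inv // [Zp_lift _]mulr1n mul1r.
  by rewrite -big_mkcond sumr_const card_fix_orbit.
apply.
- exact/Zp2_natr_sq/prime_gt1.
- exact/Zp_liftD/prime_gt1.
- move=> X F FP Fq; apply: (sum_invariant nQP) => // x; by rewrite -mulr_natl.
- by move=> X k; apply: val_inv.
- by move=> X l x xP; rewrite mulr_natl theta_fix.
apply: flat_diag_gen.
have gen0 l : diag_gen (0 : fun_mackey Q 'Z_q Y) l = 0 :> box _ M _.
  by apply: (@addrI _ (diag_gen 0 l)); rewrite -diag_genD !addr0.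
have gen_sum := big_morph (fun m => diag_gen (m : fun_mackey Q 'Z_q Y) n) (diag_genD n) (gen0 n).
rewrite -[val 0]/(0 : fun_mackey Q 'Z_q Y) gen0 -[val _]/(indicator A).
have -> : indicator A = \sum_(x in A) indicator [set x].
  apply/ffunP=> x; rewrite sum_ffunE ffunE; case: ifP => xA.
    rewrite (bigD1 x) //= ffunE set11 big1 ?addr0 // => z /andP[_ zx].
    by rewrite ffunE inE eq_sym (negPf zx).
  rewrite big1 // => z zA; rewrite ffunE inE; case: eqP => // xz.
  by rewrite xz zA in xA.
rewrite gen_sum (eq_bigr (fun=> diag_gen (indicator [set y]) n)) => [|x]; last first.
  move=> /(fix_orbitP nQP)[g Pg <-]; have [c cy cn] := nP g Pg.
  have <- : fix_map c y = fix_shift g y.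
    by apply: val_inj; rewrite (val_fix_shift nQP).
  by rewrite -indicator_tr diag_gen_tr cn.
rewrite -gen_sum [X in diag_gen X](_ : _ = 0) ?gen0 //.
apply/ffunP=> x; rewrite sum_ffunE sumr_const card_fix_orbit // !ffunE.
by case: ifP; rewrite ?mul0rn.
Qed.

End Separation.

(** * Marks of the free functor *)

(** A weight [w] assigns to a bispan T <- C -> B a function on the Q-fixed points of
    B.  If it is stable under base change of C -> B, summing it along B -> X defines
    a map of Mackey functors out of the free functor. *)
Section Marks.
Local Open Scope ring_scope.
Variables (gT : finGroupType) (O : indexing gT) (T : gset gT) (Q : {set gT}) (R : zmodType).
Implicit Types (X Y Z A B C : gset gT).

Variable w : forall C B, gmap C T -> gmap C B -> fun_mackey Q R B.
Hypothesis w_square : forall C B C' B' (f : gmap C T) (g : gmap C B)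
    (g' : gmap C' B') (u : gmap C' C) (v : gmap B' B),
    (forall x, g (u x) = v (g' x)) ->
    (forall x y, u x = u y -> g' x = g' y -> x = y) ->
    (forall a b, g a = v b -> exists x, u x = a /\ g' x = b) ->
  w (gcomp f u) g' = fun_res v (w f g).

Definition mark_poly X (c : poly_hom O T X) : fun_mackey Q R X :=
  fun_tr (bi_tr (rep c)) (w (bi_res (rep c)) (bi_norm (rep c))).

Lemma mark_mkpoly X A B (f : gmap A T) (g : gmap A B) (h : gmap B X) (Og : O _ _ g) :
  mark_poly (mkpoly f h Og) = fun_tr h (w f g).
Proof.
have [u [v [[ui us] [vi vs] uf ug vh]]] := rep_mkpoly f h Og.
rewrite /mark_poly -(gmap_eq (f := gcomp f u) uf) -(gmap_eq (f := gcomp h v) vh).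
rewrite (w_square f ug).
- by rewrite fun_tr_comp fun_tr_res_bij.
- by move=> x y /ui.
- by move=> a b gab; have [x xa] := us a; exists x; split=> //; apply: vi; rewrite -ug xa.
Qed.

(** Each summand of a disjoint union is a base change of the whole. *)
Lemma mark_polyD X : {morph @mark_poly X : c d / c + d}.
Proof.
elim/poly_ind=> A B f g h Og; elim/poly_ind=> A' B' f' g' h' Og'.
rewrite mkpolyD !mark_mkpoly fun_tr_copair.
rewrite -(w_square _ (u := ginl A A') (v := ginl B B') (g' := g)) //.
- rewrite -(w_square _ (u := ginr A A') (v := ginr B B') (g' := g')) //.
  + rewrite -(gmap_eq (f := f) (g := gcomp (gcopair f f') (ginl A A'))) //.
    by rewrite -(gmap_eq (f := f') (g := gcomp (gcopair f f') (ginr A A'))).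
  + by move=> x y [].
  + by move=> [a|a] b //= [<-]; exists a.
- by move=> x y [].
- by move=> [a|a] b //= [<-]; exists a.
Qed.

Lemma mark_poly_act X Y (s : spancls X Y) (c : poly_hom O T X) :
  mark_poly (poly_act s c) = fun_act s (mark_poly c).
Proof.
elim/span_ind: s => S l r; elim/poly_ind: c => A B f g h Og.
rewrite poly_actE fun_actE poly_resE poly_trE !mark_mkpoly fun_tr_comp; congr fun_tr.
rewrite fun_res_tr_gpb (w_square f (v := gpb1 h l) (g := g)) // => [x|x y|a b].
- exact: gpbE.
- exact: gpb_ext.
- exact: gpb_ex.
Qed.

Definition mark_fun X (c : free_tambara O T X) : fun_mackey Q R X :=
  gc_lift (@mark_poly X) c.

Lemma mark_funD X : {morph @mark_fun X : c d / c + d}.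
Proof. exact: (gc_liftD (@mark_polyD X)). Qed.

Lemma mark_fun_in X c : @mark_fun X (gc_in c) = mark_poly c.
Proof. exact: (gc_lift_in (@mark_polyD X)). Qed.

Definition mark : mkhom (free_tambara O T) (fun_mackey Q R).
Proof.
exists mark_fun; first exact: mark_funD.
apply: span_natural; first exact: mark_funD.
move=> X Y s; apply: free_ext => [c d|c d|c].
- by rewrite mk_mapDr mark_funD.
- by rewrite mark_funD mk_mapDr.
by rewrite [mk_map _ _]free_map_in !mark_fun_in mark_poly_act [RHS]fun_mk_map_in.
Defined.

Lemma mark_mkpoly_in X A B (f : gmap A T) (g : gmap A B) (h : gmap B X) (Og : O _ _ g) :
  mark X (gc_in (mkpoly f h Og)) = fun_tr h (w f g).
Proof. by rewrite -mark_mkpoly -mark_fun_in. Qed.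

Lemma mark_ind X (p : fun_mackey Q R X -> Prop) :
    (forall h k, p h -> p k -> p (h - k)) ->
    (forall A B (f : gmap A T) (g : gmap A B) (h : gmap B X), O _ _ g ->
      p (fun_tr h (w f g))) ->
  forall n, p (mark X n).
Proof.
move=> pB pmk n; rewrite -(gc_repK n) gc_clsE mkhomB.
by apply: pB; [move: (gc_pos n) | move: (gc_neg n)]; elim/poly_ind=> A B f g h Og;
  rewrite mark_mkpoly_in; apply: pmk.
Qed.

Lemma res_mkpoly X Y A B A' B' (k : gmap Y X) (f : gmap A T) (g : gmap A B)
    (h : gmap B X) (Og : O _ _ g) (g' : gmap A' B') (Og' : O _ _ g')
    (h' : gmap B' Y) (u : gmap A' A) (v : gmap B' B) :
    (forall x, h (v x) = k (h' x)) -> (forall x, g (u x) = v (g' x)) ->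
    (forall x y, v x = v y -> h' x = h' y -> x = y) ->
    (forall b y, h b = k y -> exists x, v x = b /\ h' x = y) ->
    (forall x y, u x = u y -> g' x = g' y -> x = y) ->
    (forall a b, g a = v b -> exists x, u x = a /\ g' x = b) ->
  mk_map (res_span k) (gc_in (mkpoly f h Og) : free_tambara O T X)
  = gc_in (mkpoly (gcomp f u) h' Og').
Proof.
move=> e1 eg vi vs ui us; rewrite [LHS]free_map_in poly_actE poly_tr_id poly_resE.
by rewrite (poly_res_mk_eq f Og Og' e1 eg).
Qed.

End Marks.

(** * Two closure properties of the indexing category *)
Section FlatFree.
Local Open Scope ring_scope.
Variables (gT : finGroupType) (O : indexing gT) (T : gset gT).
Hypothesis flatM : flat (free_tambara O T).
Variables (P Q : {group gT}).
Hypotheses (nQP : P \subset 'N(Q)%g) (sQP : Q \subset P) (q_pr : prime #|P : Q|%g).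
Local Notation q := #|P : Q|%g.
Implicit Types B C X Y : gset gT.

Definition fixed_fibre_weight C B (f : gmap C T) (g : gmap C B) : fun_mackey P 'Z_q B :=
  [ffun b => if [forall c, (g c == val b) ==> fixb P c] then 1 else 0].

Lemma fixed_fibre_square C B C' B' (f : gmap C T) (g : gmap C B)
    (g' : gmap C' B') (u : gmap C' C) (v : gmap B' B) :
    (forall x, g (u x) = v (g' x)) ->
    (forall x y, u x = u y -> g' x = g' y -> x = y) ->
    (forall a b, g a = v b -> exists x, u x = a /\ g' x = b) ->
  fixed_fibre_weight (gcomp f u) g' = fun_res v (fixed_fibre_weight f g).
Proof.
move=> sq ui us; apply/ffunP=> b; rewrite !ffunE; congr (if _ then _ else _).
apply/forall_inP/forall_inP => [h c /eqP gc|h c /eqP gc].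
  have [x [<- gx]] := us c (val b) gc.
  by apply/fixb_map/h; rewrite gx.
have /fixbP uc : fixb P (u c) by apply: h; rewrite sq gc.
apply/fixbP=> a Pa; apply: ui; first by rewrite gfunP uc.
by rewrite gfunP gc (fixbP _ _ (valP b)).
Qed.

(** Compare C -> B with the trivial family B x F -> B, where F is the fibre over b
    without its action; both are decorated through p.  Pulled back along the map
    v : G/Q -> B hitting b they become isomorphic, because Q fixes each point of
    the fibre, so [flat_fixed] equates their marks at b. *)
Lemma fixed_fibre_step C B (g : gmap C B) (p : gmap B T) b : O _ _ g -> fixb P b ->
  (forall c, g c = b -> fixb Q c) -> forall c, g c = b -> fixb P c.
Proof.
move=> Og bP cQ; have bQ : fixb Q b by apply/fixbP=> a /(subsetP sQP); apply/fixbP.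
pose F : finType := {c : C | g c == b}.
pose G := orbit_gset Q; pose v := orbit_map bQ.
have fstO X : O _ _ (gfst X (gtriv gT F)).
  by apply/indexing_trivial/trivial_indexingP => -[x c] a /= xa; congr pair.
have FQ (c : F) : fixb Q (val c) := cQ _ (eqP (valP c)).
have uP (w : gprod G (gtriv gT F)) a : orbit_map (FQ (gact (gprod G (gtriv gT F)) w a).2)
    (gact (gprod G (gtriv gT F)) w a).1 = gact C (orbit_map (FQ w.2) w.1) a.
  exact: gfunP (orbit_map (FQ w.2)) w.1 a.
pose u : gmap (gprod G (gtriv gT F)) C := GMap uP.
have sq w : g (u w) = v (gfst G (gtriv gT F) w).
  by rewrite gfunP (eqP (valP w.2)).
pose k : gmap (to_ord G) (to_ord B) := gcomp (rank_map B) (gcomp v (val_map G)).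
have kP x : rank_map B (v x) = k (rank_map G x) by rewrite /= enum_rankK.
have rank_inj X : injective (rank_map X) := can_inj (@rank_mapK _ X).
pose n : free_tambara O T (to_ord B) := gc_in (mkpoly (gcomp p g) (rank_map B) Og).
pose n' : free_tambara O T (to_ord B) :=
  gc_in (mkpoly (gcomp p (gfst B (gtriv gT F))) (rank_map B) (fstO B)).
have kn : mk_map (res_span k) n = mk_map (res_span k) n'.
  rewrite (res_mkpoly (gcomp p g) Og (fstO G) kP sq).
  - rewrite (res_mkpoly (gcomp p (gfst B (gtriv gT F))) (fstO B) (fstO G) kP
      (u := gprod_map v (gid _))) //.
    + by congr gc_in; apply: mkpoly_congr => // w; rewrite /= -[g _]/(g (u w)) sq.
    + by move=> x y _; apply: rank_inj.
    + move=> c y hc; exists (val_map G y); rewrite [rank_map G _]val_mapK; split=> //.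
      exact: (rank_inj _ _ _ (esym hc)).
    + by move=> [x c] [x' c'] /= [_ ->] ->.
    + by move=> [x c] y /= ->; exists (y, c).
  - by move=> x y _; apply: rank_inj.
  - move=> c y hc; exists (val_map G y); rewrite [rank_map G _]val_mapK; split=> //.
    exact: (rank_inj _ _ _ (esym hc)).
  - move=> [x c] [x' c'] /= uc xx'; rewrite xx' in uc *.
    by congr pair; apply: val_inj; apply: (act_inj (gact C) (repr (val x'))).
  - move=> c x gc; have e : g (gact C c (repr (val x))^-1%g) == b.
      by rewrite gfunP gc /= /orbit_map_fun actK.
    exists (x, exist (fun c => g c == b) _ e); split=> //=.
    by rewrite /orbit_map_fun /= actKV.
have pQ : fixb Q (rank_map G (orbit_pt Q)).
  by apply: fixb_map; apply/fixbP=> a Qa; apply/eqP; rewrite orbit_pt_fix.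
have := flat_fixed nQP sQP q_pr flatM (mark O fixed_fibre_square) (k := k)
  (x := fixed_pt pQ) (y := fix_map (rank_map B) (fixed_pt bP)) _ kn.
rewrite !mark_mkpoly_in !(fun_tr_injE _ _ (@rank_inj B)) !ffunE /=.
rewrite enum_rankK [orbit_map_fun _ _](orbit_map_pt bQ).
move=> /(_ erefl); rewrite [in X in _ = X -> _]ifT; last first.
  apply/forall_inP=> -[x c] /= /eqP->; apply/fixbP=> a Pa.
  by rewrite /= /gprod_act /= (fixbP _ _ bP).
case: ifP => [/forall_inP h _ c /eqP/h //|_ /eqP].
by rewrite eq_sym oner_eq0.
Qed.

(** The fibre of g over b is mapped bijectively to T by f. *)
Definition section_fibre C B (f : gmap C T) (g : gmap C B) (b : B) :=
  forall t, exists! c, g c = b /\ f c = t.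

Lemma section_fibre_act C B (f : gmap C T) (g : gmap C B) b a :
  section_fibre f g b -> section_fibre f g (gact B b a).
Proof.
move=> fgb t; have [c [[gc fc] c_uniq]] := fgb (gact T t a^-1%g).
exists (gact C c a); split=> [|c' [gc' fc']]; first by rewrite !gfunP gc fc actKV.
apply: (act_inj (gact C) a^-1%g); rewrite actK; apply: c_uniq.
by rewrite !gfunP gc' fc' actK.
Qed.

Lemma section_fibre_actE C B (f : gmap C T) (g : gmap C B) b a :
  section_fibre f g (gact B b a) <-> section_fibre f g b.
Proof.
split=> [/section_fibre_act - /(_ a^-1%g)|/section_fibre_act//].
by rewrite actK.
Qed.

Definition section_fibre_weight C B (f : gmap C T) (g : gmap C B) :
    fun_mackey Q ('Z_(q ^ 2)) B :=
  [ffun b => if `[< section_fibre f g (val b) >] then 1 else 0].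

Lemma section_fibre_square C B C' B' (f : gmap C T) (g : gmap C B)
    (g' : gmap C' B') (u : gmap C' C) (v : gmap B' B) :
    (forall x, g (u x) = v (g' x)) ->
    (forall x y, u x = u y -> g' x = g' y -> x = y) ->
    (forall a b, g a = v b -> exists x, u x = a /\ g' x = b) ->
  section_fibre_weight (gcomp f u) g' = fun_res v (section_fibre_weight f g).
Proof.
move=> sq ui us; apply/ffunP=> b; rewrite !ffunE; congr (if _ then _ else _).
apply/asboolP/asboolP => /= h t; have [c [[gc fc] c_uniq]] := h t.
  exists (u c); split=> [|c' [gc' fc']]; first by rewrite sq gc.
  have [x [ux gx]] := us _ _ gc'; rewrite -ux; congr (u _); apply: c_uniq.
  by rewrite /= ux.
have [x [ux gx]] := us _ _ gc; exists x; split=> [|c' [gc' fc']].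
  by rewrite /= ux.
by apply: ui; rewrite ?gx // ux; apply: c_uniq; rewrite sq gc'.
Qed.

(** The pullback of g along the map G/P -> B hitting b is then the projection. *)
Lemma section_fibre_orbit C B (f : gmap C T) (g : gmap C B) b : O _ _ g ->
  fixb P b -> section_fibre f g b -> O _ _ (gfst (orbit_gset P) T).
Proof.
move=> Og bP fgb; set G := orbit_gset P; pose k := orbit_map bP.
have fgk A : section_fibre f g (k A) by apply: section_fibre_act.
pose phi : gmap (gpb g k) (gprod G T) := gpair (gpb2 g k) (gcomp f (gpb1 g k)).
have phib : bijective phi.
  apply: gmap_bij => [x y [e2 e1]|[A t]].
    apply: gpb_ext => //; have [c [_ c_uniq]] := fgk (gpb2 g k x) (f (gpb1 g k x)).
    transitivity c; first by symmetry; apply: c_uniq; split=> //; apply: gpbE.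
    by apply: c_uniq; split=> //; rewrite [RHS](congr1 k e2); apply: gpbE.
  have [c [[gc fc] _]] := fgk A t; have [x [x1 x2]] := gpb_ex gc.
  by exists x; rewrite -fc -x2 -x1.
have [psi [phiK psiK]] := gmap_inv phib.
have -> : gfst G T = gcomp (gpb2 g k) psi.
  by apply: gmap_eq => w; rewrite -[in LHS](psiK w).
apply: indexing_comp; first exact: indexing_gpb2.
by apply: indexing_bij; exists phi.
Qed.

(** If the conclusion fails, no fibre of a map C -> B of O over a P-fixed point
    is mapped bijectively to T ([section_fibre_orbit]), so the mark counting such fibres is
    killed by q at P-fixed points, as [flat_orbit] requires.  The class n of
    T <- G/Q x T -> G/Q is preserved by the automorphisms of G/Q coming from P, and
    its mark at the base point is 1; hence q = 0 in Z/q^2, a contradiction. *)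
Lemma orbit_proj_step :
  O _ _ (gfst (orbit_gset Q) T) -> O _ _ (gfst (orbit_gset P) T).
Proof.
move=> OQ; apply: contrapT => nOP; set G := orbit_gset Q.
pose theta := mark O section_fibre_square.
have w_inv C B (f : gmap C T) (g : gmap C B) : invariant P (section_fibre_weight f g).
  move=> a b Pa; rewrite !ffunE (val_fix_shift nQP) //; congr (if _ then _ else _).
  by apply/asboolP/asboolP => /section_fibre_actE.
have theta_inv X l : invariant P (theta X l).
  move: l; apply: (@mark_ind _ O _ _ _ _ section_fibre_square X (fun h => invariant P h)).
    by move=> h k hP kP a x Pa; rewrite !ffunE hP ?kP.
  move=> C B f g h Og;
  exact: invariant_tr.
have q_gt1 : (1 < q)%N := prime_gt1 q_pr.
have theta_fix X l x : fixb P (val x) -> theta X l x *+ q = 0.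
  move=> xP; move: l; apply: (@mark_ind _ O _ _ _ _ section_fibre_square X
    (fun h => h x *+ q = 0)) => [h k hP kP|C B f g h Og].
    by rewrite !ffunE mulrnDl mulNrn hP kP subrr.
  rewrite ffunE -sumrMnl big_mkcond (sum_invariant nQP) //.
  - apply: big1 => b bP; case: ifP => // _; rewrite ffunE.
    case: asboolP => [fgb|]; last by rewrite mul0rn.
    by case: nOP; apply: section_fibre_orbit Og bP fgb.
  - move=> a b Pa; rewrite w_inv // (fix_shift_map nQP) //.
    rewrite -{1}(fix_shift_fixed nQP Pa xP).
    by rewrite (inj_eq (can_inj (fun z => fix_shiftK nQP z Pa))).
  - move=> b; case: ifP => _; last by rewrite mul0rn.
    by rewrite -mulr_natr -[X in X * _]mulr_natr -mulrA Zp2_natr_sq ?mulr0.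
have rank_inj X : injective (rank_map X) := can_inj (@rank_mapK _ X).
pose n : free_tambara O T (to_ord G) := gc_in (mkpoly (gsnd G T) (rank_map G) OQ).
have ptQ : fixb Q (orbit_pt Q) by apply/fixbP=> a Qa; apply/eqP; rewrite orbit_pt_fix.
pose pt := fixed_pt ptQ.
have := flat_orbit nQP sQP q_pr flatM (n := n) (y := fix_map (rank_map G) pt) theta_inv theta_fix.
rewrite mark_mkpoly_in (fun_tr_injE _ _ (@rank_inj G)) ffunE asboolT; last first.
  move=> t; exists (orbit_pt Q, t); split=> // -[A t'] /= [-> ->] //.
move=> h; case/eqP: (Zp2_natr_neq0 q_gt1); apply: h.
- apply/negP=> /= rP; move: q_gt1; suff /eqP-> : q == 1%N by [].
  rewrite indexg_eq1; apply/subsetP=> a Pa; rewrite -orbit_pt_fix.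
  apply/eqP/(@rank_inj G); rewrite gfunP; exact: (fixbP _ _ rP a Pa).
- move=> a Pa; pose c := orbit_map (valP (fix_shift a pt)).
  exists (gcomp (rank_map G) (gcomp c (val_map G))).
    rewrite /= enum_rankK -[orbit_map_fun _ _]/(c (orbit_pt Q)) orbit_map_pt.
    by rewrite (val_fix_shift nQP) //; exact: (gfunP (rank_map G) (orbit_pt Q) a).
  rewrite (res_mkpoly (gsnd G T) OQ OQ (h' := rank_map G)
    (u := gprod_map c (gid T)) (v := c)) //.
  + by congr gc_in; apply: mkpoly_congr.
  + by move=> x; rewrite /= enum_rankK.
  + by move=> x y _; apply: rank_inj.
  + move=> x y hx; exists (val_map G y); rewrite [rank_map G _]val_mapK; split=> //.
    exact: (rank_inj _ _ _ (esym hx)).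
  + by move=> [x t] [x' t'] /= [_ ->] ->.
  + by move=> [x t] y /= ->; exists (y, t).
Qed.

End FlatFree.

(** * The case of an orbit T = G/H *)
Section OrbitLevel.
Local Open Scope group_scope.
Variables (gT : finGroupType) (O : indexing gT) (H : {group gT}).
Hypothesis flatM : flat (free_tambara O (orbit_gset H)).
Local Notation T := (orbit_gset H).
Implicit Types B C X Y : gset gT.

Lemma fixb_cycle X (x : X) h : fixb <[h]> x = (gact X x h == x).
Proof.
apply/fixbP/eqP => [|xh a]; first by apply; apply: cycle_id.
have : <[h]> \subset 'C[x | gact X] by rewrite cycle_subG; apply/astab1P.
by move=> /subsetP/[apply] /astab1P.
Qed.

Lemma cycle_prime_step (h : gT) : h != 1 -> exists p,
  [/\ prime p, #[h ^+ p] < #[h], <[h]> \subset 'N(<[h ^+ p]>),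
      <[h ^+ p]> \subset <[h]> & #|<[h]> : <[h ^+ p]>| = p]%N.
Proof.
move=> h1; have h_gt1 : (1 < #[h])%N by rewrite order_gt1.
pose p := pdiv #[h]; have p_pr : prime p := pdiv_prime h_gt1.
have p_dvd : (p %| #[h])%N := pdiv_dvd _.
have sub : <[h ^+ p]> \subset <[h]> := cycleX h p.
have op : #[h ^+ p] = (#[h] %/ p)%N by apply: orderXdiv.
exists p; split=> //.
- by rewrite op ltn_Pdiv ?prime_gt1 ?order_gt0.
- exact: sub_abelian_norm (cycle_abelian h) sub.
- by rewrite -divgS // -!orderE op divnA // mulKn // order_gt0.
Qed.

(** By induction on the order of h, the subgroup generated by h^p acts trivially on
    the fibre.  To apply [fixed_fibre_step], g is multiplied by T to make it a map
    over T; the base point (g c, H) is still fixed by h because h is in H. *)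
Lemma fibre_fixed B C (g : gmap C B) c h : O _ _ g -> h \in H ->
  gact B (g c) h = g c -> gact C c h = c.
Proof.
have [n] := ubnP #[h]; elim: n => // n IHn in B C g c h *; rewrite ltnS => le_h_n Og Hh gch.
have [->|/cycle_prime_step[p [p_pr lt_hp nQP sQP indexP]]] := eqVneq h 1.
  exact: act1.
have ptH : gact T (orbit_pt H) h = orbit_pt H by apply/eqP; rewrite orbit_pt_fix.
pose b : gprod B T := (g c, orbit_pt H).
have bP : fixb <[h]> b by rewrite fixb_cycle; apply/eqP; exact: (congr2 pair gch ptH).
have q_pr : prime #|<[h]> : <[h ^+ p]>| by rewrite indexP.
have bQ (d : gprod C T) : gprod_map g (gid T) d = b -> fixb <[h ^+ p]> d.
  move=> gd; rewrite fixb_cycle; apply/eqP.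
  apply: IHn (indexing_prodr T Og) _ _; first exact: leq_trans lt_hp le_h_n.
    exact: groupX.
  rewrite gd; apply/eqP; rewrite -fixb_cycle; apply/fixbP=> a ha.
  by apply: (fixbP _ _ bP); apply: (subsetP sQP).
have := fixed_fibre_step flatM nQP sQP q_pr (gsnd B T) (indexing_prodr T Og) bP bQ.
move=> /(_ (c, orbit_pt H) erefl); rewrite fixb_cycle => /eqP e.
exact: (congr1 fst e).
Qed.

(** The projection then preserves stabilizers. *)
Lemma orbit_proj_trivial (Q : {group gT}) :
    (forall a (t : T), a \in Q -> gact T t a = t) ->
  O _ _ (gfst (orbit_gset Q) T).
Proof.
move=> QT; apply/indexing_trivial/trivial_indexingP => -[A t] a; rewrite -[gfst _ _ _]/A => Aa.
congr pair => //; have [x eA] := orbit_ptP A.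
have Qxax : x * a * x^-1 \in Q.
  rewrite -orbit_pt_fix !actM -eA Aa eA; apply/eqP; exact: actK.
apply: (act_inj (gact T) x^-1); rewrite -actM.
by rewrite -(QT _ (gact T t x^-1) Qxax) -actM !mulgA mulVg mul1g.
Qed.

(** By induction h^p acts trivially on T, so P = <h> satisfies the conclusion of
    [orbit_proj_step]; but in the fibre of G/P x T over the base point, which is
    fixed by h, [fibre_fixed] leaves no room for a nontrivial action on T. *)
Lemma act_orbit_trivial h (t : T) : h \in H -> gact T t h = t.
Proof.
have [n] := ubnP #[h]; elim: n => // n IHn in h t *; rewrite ltnS => le_h_n Hh.
have [->|/cycle_prime_step[p [p_pr lt_hp nQP sQP indexP]]] := eqVneq h 1.
  exact: act1.
have q_pr : prime #|<[h]> : <[h ^+ p]>| by rewrite indexP.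
have OP : O _ _ (gfst (orbit_gset <[h]>%G) T).
  apply: (orbit_proj_step flatM nQP sQP q_pr); apply: orbit_proj_trivial => a s Qa.
  suff : fixb <[h ^+ p]> s by move/fixbP; apply.
  rewrite fixb_cycle; apply/eqP; apply: IHn; last exact: groupX.
  exact: leq_trans lt_hp le_h_n.
have ptP : gact (orbit_gset <[h]>%G) (orbit_pt <[h]>%G) h = orbit_pt <[h]>%G.
  by apply/eqP; rewrite orbit_pt_fix cycle_id.
have := fibre_fixed (c := (orbit_pt <[h]>%G, t) : gprod _ T) OP Hh ptP.
by move/(congr1 snd).
Qed.

Lemma flat_normal : H <| [set: gT].
Proof.
rewrite /normal subsetT; apply/subsetP=> x _; rewrite inE.
apply/subsetP=> _ /imsetP[y Hy ->]; rewrite -orbit_pt_fix conjgE !actM.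
by rewrite (act_orbit_trivial _ Hy) actKV.
Qed.

Lemma orbit_proj_solvable (P : {group gT}) : H \subset P ->
  solvable (P / H) -> O _ _ (gfst (orbit_gset P) T).
Proof.
have [n] := ubnP #|P|; elim: n => // n IHn in P *; rewrite ltnS => le_P_n sHP solP.
have nHP : P \subset 'N(H) := subset_trans (subsetT P) (normal_norm flat_normal).
have [sPH|nsPH] := boolP (P \subset H).
  by apply: orbit_proj_trivial => a t Pa; apply/act_orbit_trivial/(subsetP sPH).
have ntP : (P / H)%G :!=: 1 by rewrite -subG1 quotient_sub1.
have [K nsK pr_K] := sol_prime_factor_exists solP ntP.
have [Q eK sHQ nsQ] := inv_quotientN (normalS sHP (subsetT P) flat_normal) nsK.
have iQ : #|P : Q| = #|P / H : K|.
  rewrite eK index_quotient_eq ?(subset_trans _ sHQ) ?subsetIr //.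
  exact: normal_sub nsQ.
apply: (orbit_proj_step flatM (normal_norm nsQ) (normal_sub nsQ)); first by rewrite iQ.
apply: IHn => //.
- apply: leq_trans le_P_n; apply: proper_card; rewrite properEneq (normal_sub nsQ) andbT.
  by apply: contraTneq pr_K => eQ; rewrite -iQ eQ indexgg.
- by rewrite -eK; apply: solvableS solP; apply: normal_sub.
Qed.

Lemma admissible_solvable : solvable ([set: gT] / H) -> admissible O H.
Proof.
move=> sol; have OG := @orbit_proj_solvable [set: gT]%G (subsetT H) sol.
set S := orbit_gset [set: gT]%G; have one (A : S) : A = orbit_pt [set: gT]%G.
  by have [a ->] := orbit_ptP A; apply/eqP; rewrite orbit_pt_fix inE.
have kP t a : (orbit_pt [set: gT]%G, gact T t a) = gact (gprod S T) (orbit_pt [set: gT]%G, t) a.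
  by rewrite -[RHS]/(gact S (orbit_pt _) a, gact T t a) (one (gact S _ a)).
pose k : gmap T (gprod S T) := @GMap _ T (gprod S T) (fun t => (orbit_pt [set: gT]%G, t)) kP.
exists (gcomp (gfst S T) k); apply: indexing_comp => //.
apply/indexing_bij/gmap_bij => [t t' [] //|[A t]].
by exists t; rewrite (one A).
Qed.

End OrbitLevel.

(** * Restriction to H *)
Section Restriction.
Variables (gT : finGroupType) (H : {group gT}).
Implicit Types X Y : gset (subg_of H).

Fact ind_pt_subproof X (x : X) (a : gT) :
  ind_cls (x, a) \in [set ind_cls p | p : X * gT].
Proof. by rewrite imset_f. Qed.

Definition ind_pt X (x : X) (a : gT) : ind_gset X :=
  exist (fun A : {set X * gT} => A \in [set ind_cls p | p : X * gT])
    (ind_cls (x, a)) (ind_pt_subproof x a).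

Lemma ind_ptP X (A : ind_gset X) : exists x a, A = ind_pt x a.
Proof.
by have /imsetP[[x a] _ eA] := valP A; exists x, a; apply: val_inj.
Qed.

Lemma ind_pt_act X (x : X) a b : gact (ind_gset X) (ind_pt x a) b = ind_pt x (a * b)%g.
Proof. by apply: val_inj; rewrite /= ind_tr_cls. Qed.

Lemma ind_map_pt X Y (f : gmap X Y) x a : ind_map f (ind_pt x a) = ind_pt (f x) a.
Proof. by apply: val_inj; rewrite /= ind_fun_cls. Qed.

Lemma ind_ptE X (x y : X) a b :
  ind_pt x a = ind_pt y b <-> exists h, y = gact X x h /\ b = ((sgval h)^-1 * a)%g.
Proof.
split=> [/(congr1 val) /= e|[h [-> ->]]].
  have : (y, b) \in ind_cls (x, a) by rewrite e; apply: orbit_refl.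
  by case/orbitP=> h _ [<- <-]; exists h.
apply: val_inj => /=; apply/esym/orbit_eqP; apply/orbitP.
by exists h; rewrite ?inE.
Qed.

Lemma trivial_ind_map X Y (f : gmap X Y) : trivial_indexing f -> trivial_indexing (ind_map f).
Proof.
move=> /trivial_indexingP ft; apply/trivial_indexingP => A a.
have [x [b ->]] := ind_ptP A; rewrite ind_map_pt !ind_pt_act.
case/ind_ptE=> h [fx eb]; apply/ind_ptE; exists h; split=> //.
exact/esym/ft/esym.
Qed.

End Restriction.

Theorem theorem2 (gT : finGroupType) (O : indexing gT) (H : {group gT}) :
  flat (free_tambara O (orbit_gset H)) ->
  (forall (X Y : gset (subg_of H)) (f : gmap X Y),
     restrict_indexing O f <-> trivial_indexing f) /\
  (H <| [set: gT])%g /\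
  (solvable ([set: gT] / H)%g -> admissible O H).
Proof.
move=> flatM; split; [|split]; last first.
- exact: admissible_solvable.
- exact: flat_normal flatM.
move=> X Y f; split=> [Of|]; last by move/trivial_ind_map; apply: indexing_trivial.
apply/trivial_indexingP => x h fxh.
have hV : (1 = (sgval h)^-1 * sgval h :> gT)%g by rewrite mulVg.
have := fibre_fixed flatM (c := ind_pt x 1%g) (h := sgval h) Of (subgP h).
rewrite ind_map_pt !ind_pt_act mul1g => /(_ _)/ind_ptE[].
  by apply/ind_ptE; exists h; rewrite fxh.
move=> k [xk /(congr1 (mulg (sgval k)))]; rewrite mulg1 mulKVg => /val_inj kh.
by rewrite -kh -xk.
Qed.
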